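(* Let $d\ge 2$, let $T\subset\mathbb R^d$ be a $d$-simplex and let $k\ge 3$. Then the following degrees of freedom are unisolvent for the space $\mathbb P_k(T;\mathbb S)$ (with $\boldsymbol\tau\in\mathbb P_k(T;\mathbb S)$): (a) $(\operatorname{tr}_e(\boldsymbol\tau),q)_e$, for $q\in\mathbb P_k(e)$, $e\in\Delta_{d-2}(T)$; (b) $(\boldsymbol n^{\intercal}\boldsymbol\tau\boldsymbol n,q)_F$, for $q\in\mathbb P_k(F)$, $F\in\Delta_{d-1}(T)$; (c) $(\operatorname{tr}_2(\boldsymbol\tau),q)_F$, for $q\in\mathbb P_{k-1}(F)$, $F\in\Delta_{d-1}(T)$; (d) $(\Pi_F\boldsymbol\tau\boldsymbol n,\boldsymbol q)_F$, for $\boldsymbol q\in \mathrm{ND}_{k-2}(F)$, $F\in\Delta_{d-1}(T)$; (e) $(\boldsymbol\tau,\operatorname{def}\boldsymbol q)_T$, for $\boldsymbol q\in\mathrm{ND}_{k-3}(T)$; (f) $(\boldsymbol\tau,\boldsymbol q)_T$, for $\boldsymbol q\in\mathbb P_{k-2}(T;\mathbb S)$ with $\boldsymbol q(\boldsymbol x)\boldsymbol x=0$ for all $\boldsymbol x$.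
   Context: $\mathbb S$ and $\mathbb K$ are the spaces of symmetric and skew-symmetric real $d\times d$ matrices. $\mathbb P_k(D)$ is the space of polynomials of total degree at most $k$ on $D$ ($\{0\}$ if $k<0$), $\mathbb H_k(D)$ the homogeneous polynomials of degree $k$, and $\mathbb P_k(D;\mathbb X)=\mathbb P_k(D)\otimes\mathbb X$. $(\cdot,\cdot)_D$ is the $L^2$ inner product on $D$ (product of point values if $D$ is a point). $\Delta_\ell(T)$ is the set of $\ell$-dimensional subsimplices of $T$. $\operatorname{div}$ acts row-wise on matrices; $\operatorname{def}\boldsymbol q=\operatorname{sym}\operatorname{grad}\boldsymbol q$. For $F\in\Delta_{d-1}(T)$, $\boldsymbol n=\boldsymbol n_{\partial T}|_F$ is the unit normal of $F$ outward to $T$, $\Pi_F=\boldsymbol I-\boldsymbol n\boldsymbol n^{\intercal}$, and $\operatorname{div}_F\boldsymbol v$ is the surface divergence of $\Pi_F\boldsymbol v$. For $e\in\Delta_{d-2}(T)$ with $e\subset\partial F$, $\boldsymbol n_{F,e}$ is the unit vector tangent to $F$, normal to $e$ and pointing outward from $F$. The traces are $\operatorname{tr}_2(\boldsymbol\tau)=\boldsymbol n^{\intercal}\operatorname{div}\boldsymbol\tau+\operatorname{div}_F(\boldsymbol\tau\boldsymbol n)$ on each $F$, and $\operatorname{tr}_e(\boldsymbol\tau)=\sum_{F\in\Delta_{d-1}(T),\,e\subset\partial F}\boldsymbol n_{F,e}^{\intercal}\boldsymbol\tau\,\boldsymbol n_{\partial T}|_F$ on $e$ (two faces contribute). For a simplex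 $D$ (of dimension $m$, with $\mathbb K$ the $m\times m$ skew matrices and intrinsic coordinates) and $k\ge0$, $\mathrm{ND}_k(D)=\mathbb P_k(D;\mathbb R^m)\oplus\mathbb H_k(D;\mathbb K)\boldsymbol x=\operatorname{grad}\mathbb P_{k+1}(D)\oplus\mathbb P_k(D;\mathbb K)\boldsymbol x$; on $F$ these are tangential fields. Since $\ker(\operatorname{def})=\mathrm{ND}_0(T)\subseteq\mathrm{ND}_{k-3}(T)$, in (e) only $\boldsymbol q$ in a complement of $\mathrm{ND}_0(T)$ in $\mathrm{ND}_{k-3}(T)$ give nontrivial functionals. ''Unisolvent'' means: letting the test functions run through bases of the test spaces (modulo $\mathrm{ND}_0(T)$ in (e)), the number of functionals equals $\dim\mathbb P_k(T;\mathbb S)$ and $\boldsymbol\tau\in\mathbb P_k(T;\mathbb S)$ vanishes if all functionals vanish on it. *)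

(* Defs.v *)
From mathcomp Require Import all_boot all_order all_algebra.
From mathcomp Require Import classical_sets reals ereal.
From mathcomp Require Import measure lebesgue_measure lebesgue_integral.
(* The notations of multinomials clash with those of mathcomp-analysis. *)
From mathcomp Require Import -(notations) mpoly.

Set Implicit Arguments.
Unset Strict Implicit.
Unset Printing Implicit Defensive.

Import Order.TTheory GRing.Theory Num.Theory.
Local Open Scope ring_scope.

(* Vectors are columns; [mpoly m R] is the ring of polynomials in m variables
   over R, and polynomial vector and matrix fields are matrices over it. *)

Definition dot (A : pzSemiRingType) (n : nat) (u v : 'cV[A]_n) : A :=
  (u^T *m v) 0 0.

Definition frob (A : pzSemiRingType) (n : nat) (U V : 'M[A]_n) : A :=
  \sum_i \sum_j U i j * V i j.

Definition peval (R : realType) (m : nat) (x : 'cV[R]_m) (q : mpoly m R) : R :=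
  meval (fun i => x i 0) q.

Definition mxeval (R : realType) (m a b : nat) (x : 'cV[R]_m)
    (q : 'M[mpoly m R]_(a, b)) : 'M[R]_(a, b) :=
  map_mx (peval x) q.

Definition constp (R : realType) (m a b : nat) (A : 'M[R]_(a, b)) :
    'M[mpoly m R]_(a, b) :=
  map_mx (@mpolyC m R) A.

Definition grad (R : realType) (d : nat) (q : mpoly d R) : 'cV[mpoly d R]_d :=
  \col_i mderiv i q.

Definition divm (R : realType) (d : nat) (t : 'M[mpoly d R]_d) :
    'cV[mpoly d R]_d :=
  \col_i \sum_j mderiv j (t i j).

Definition defm (R : realType) (d : nat) (q : 'cV[mpoly d R]_d) :
    'M[mpoly d R]_d :=
  \matrix_(i, j) ((2^-1 : R) *: (mderiv j (q i 0) + mderiv i (q j 0))).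

Definition P_ (R : realType) (m k : nat) (q : (mpoly m R)^o) : Prop :=
  (msize q <= k.+1)%N.

Definition PS (R : realType) (d k : nat) (t : 'M[mpoly d R]_d) : Prop :=
  t^T = t /\ forall i j, (msize (t i j) <= k.+1)%N.

Definition PSker (R : realType) (d k : nat) (q : 'M[mpoly d R]_d) : Prop :=
  PS k q /\ forall x : 'cV[R]_d, mxeval x q *m x = 0.

Definition coordp (R : realType) (m : nat) : 'cV[mpoly m R]_m :=
  \col_i mpolyX R (mnm1 i).

Definition ND (R : realType) (m k : nat) (q : 'cV[mpoly m R]_m) : Prop :=
  exists (u : 'cV[mpoly m R]_m) (K : 'M[mpoly m R]_m),
    [/\ forall i, (msize (u i 0%R) <= k.+1)%N,
        K^T = - K,
        forall i j, K i j \is ishomog1 k mdeg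
      & q = u + K *m coordp R m].

(* [b] represents an R-basis of the quotient S / S0. Real scalars act on
   polynomial fields as constant polynomials. *)
Definition basis_mod (R : realType) (m : nat) (V : lmodType (mpoly m R))
    (S S0 : V -> Prop) (b : seq V) : Prop :=
  [/\ forall q, q \in b -> S q,
      forall c : 'I_(size b) -> R,
        S0 (\sum_i mpolyC m (c i) *: b`_i) -> forall i, c i = 0
    & forall q, S q -> exists c : 'I_(size b) -> R,
        S0 (q - \sum_i mpolyC m (c i) *: b`_i)].

Definition is_basis (R : realType) (m : nat) (V : lmodType (mpoly m R))
    (S : V -> Prop) (b : seq V) : Prop :=
  basis_mod S (fun q => q = 0) b.

(* An m-simplex in R^d is given by its vertices v 0, ..., v m. *)
Definition edges (R : realType) (d m : nat) (v : 'I_m.+1 -> 'cV[R]_d) :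
    'M[R]_(d, m) :=
  \matrix_(i, j) (v (lift ord0 j) i 0 - v ord0 i 0).

Definition nondeg_simplex (R : realType) (d m : nat)
    (v : 'I_m.+1 -> 'cV[R]_d) : Prop :=
  \rank (edges v) = m.

(* Iterated Lebesgue integral of f over {y | 0 <= y_i, \sum_i y_i <= s}. *)
Fixpoint corner_int (R : realType) (m : nat) : R -> ('cV[R]_m -> R) -> R :=
  match m return R -> ('cV[R]_m -> R) -> R with
  | 0 => fun _ f => f 0
  | m'.+1 => fun s f =>
      Rintegral (@lebesgue_measure R) [set` `[0, s]] (fun t : R =>
        corner_int (s - t) (fun y : 'cV[R]_m' =>
          f (col_mx (t%:M : 'cV[R]_1) y)))
  end.

(* Integral over an m-simplex for the m-dimensional volume measure, through the
   parametrisation y |-> v 0 + \sum_i y_i (v i - v 0) by the standard corner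
   simplex, whose Jacobian is the square root of the Gram determinant; this is
   the value at the point when m = 0. *)
Definition simplex_int (R : realType) (d m : nat) (v : 'I_m.+1 -> 'cV[R]_d)
    (f : 'cV[R]_d -> R) : R :=
  Num.sqrt (\det ((edges v)^T *m edges v)) *
  corner_int 1 (fun y => f (v ord0 + edges v *m y)).

(* Isometric affine coordinates y |-> org + frm y on the affine hull of an
   m-simplex. *)
Record chart (R : realType) (m d : nat) : Type :=
  Chart { org : 'cV[R]_d; frm : 'M[R]_(d, m) }.

Definition is_chart (R : realType) (m d : nat) (v : 'I_m.+1 -> 'cV[R]_d)
    (c : chart R m d) : Prop :=
  (frm c)^T *m frm c = 1%:M /\
  forall i, exists y : 'cV[R]_m, v i = org c + frm c *m y.

Definition coord (R : realType) (m d : nat) (c : chart R m d) (x : 'cV[R]_d) :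
    'cV[R]_m :=
  (frm c)^T *m (x - org c).

(* The l-dimensional subsimplices of a d-simplex, as sets of vertex indices. *)
Definition Delta (d l : nat) : finType :=
  {A : {set 'I_d.+1} | #|A| == l.+1}.

Definition vset (d l : nat) (A : Delta d l) : {set 'I_d.+1} := sval A.

Definition vert (R : realType) (d l : nat) (p : 'I_d.+1 -> 'cV[R]_d)
    (A : Delta d l) (j : 'I_l.+1) : 'cV[R]_d :=
  p (enum_val (cast_ord (esym (eqP (svalP A))) j)).

(* n is the unit normal to the face A of the simplex B, tangent to B and
   pointing outward from B. *)
Definition is_outer_normal (R : realType) (d : nat) (p : 'I_d.+1 -> 'cV[R]_d)
    (B A : {set 'I_d.+1}) (n : 'cV[R]_d) : Prop :=
  [/\ exists c : 'I_d.+1 -> R,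
        \sum_(i in B) c i = 0 /\ n = \sum_(i in B) c i *: p i,
      dot n n = 1,
      forall i j, i \in A -> j \in A -> dot n (p j - p i) = 0
    & forall i j, i \in A -> j \in B -> j \notin A -> dot n (p j - p i) < 0].

Definition outer_normal (R : realType) (d : nat) (p : 'I_d.+1 -> 'cV[R]_d)
    (B A : {set 'I_d.+1}) : 'cV[R]_d :=
  xget 0 (is_outer_normal p B A).

Definition face_normal (R : realType) (d : nat) (p : 'I_d.+1 -> 'cV[R]_d)
    (F : Delta d (d - 1)) : 'cV[R]_d :=
  outer_normal p [set: 'I_d.+1]%SET (vset F).

Definition face_conormal (R : realType) (d : nat) (p : 'I_d.+1 -> 'cV[R]_d)
    (F : Delta d (d - 1)) (e : Delta d (d - 2)) : 'cV[R]_d :=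
  outer_normal p (vset F) (vset e).

Definition tproj (R : realType) (d : nat) (n : 'cV[R]_d) : 'M[R]_d :=
  1%:M - n *m n^T.

(* Surface divergence, on a hyperplane with unit normal n, of the tangential
   part of w; the surface gradient is the tangential part of the gradient. *)
Definition surf_div (R : realType) (d : nat) (n : 'cV[R]_d)
    (w : 'cV[mpoly d R]_d) : mpoly d R :=
  let P := constp d (tproj n) in
  \sum_i (P *m grad ((P *m w) i 0)) i 0.

Definition tr_nn (R : realType) (d : nat) (n : 'cV[R]_d)
    (t : 'M[mpoly d R]_d) : mpoly d R :=
  dot (constp d n) (t *m constp d n).

Definition tr_2 (R : realType) (d : nat) (n : 'cV[R]_d)
    (t : 'M[mpoly d R]_d) : mpoly d R :=
  dot (constp d n) (divm t) + surf_div n (t *m constp d n).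

Definition tr_t (R : realType) (d : nat) (n : 'cV[R]_d)
    (t : 'M[mpoly d R]_d) : 'cV[mpoly d R]_d :=
  constp d (tproj n) *m (t *m constp d n).

Definition tr_e (R : realType) (d : nat) (p : 'I_d.+1 -> 'cV[R]_d)
    (e : Delta d (d - 2)) (t : 'M[mpoly d R]_d) : mpoly d R :=
  \sum_(F : Delta d (d - 1) | vset e \subset vset F)
    dot (constp d (face_conormal p F e)) (t *m constp d (face_normal p F)).

(* L2 pairings on a subsimplex D of an ambient polynomial with a polynomial in
   the intrinsic coordinates of D; in the vector case the latter is a tangential
   field on D, given by its components in the orthonormal frame of D. *)
Definition pair_face (R : realType) (d l : nat) (p : 'I_d.+1 -> 'cV[R]_d)
    (D : Delta d l) (c : chart R l d) (f : mpoly d R) (q : mpoly l R) : R :=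
  simplex_int (vert p D) (fun x => peval x f * peval (coord c x) q).

Definition pair_face_vec (R : realType) (d l : nat) (p : 'I_d.+1 -> 'cV[R]_d)
    (D : Delta d l) (c : chart R l d) (f : 'cV[mpoly d R]_d)
    (q : 'cV[mpoly l R]_l) : R :=
  simplex_int (vert p D) (fun x =>
    dot (mxeval x f) (frm c *m mxeval (coord c x) q)).

Definition pair_mx (R : realType) (d : nat) (p : 'I_d.+1 -> 'cV[R]_d)
    (t q : 'M[mpoly d R]_d) : R :=
  simplex_int p (fun x => frob (mxeval x t) (mxeval x q)).

(* Main.v *)
(** Write [g i] for the gradient of the barycentric coordinate [lam i], a negative
    multiple of the outer normal of the face [F_i] opposite to [p i].

    Kernel. On [e = F_i /\ F_j], since [n^T t n] vanishes on the faces by (b),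
    [tr_e t] is a positive multiple of [g_i^T t g_j]; by (a) the tangential field
    [Pi_F t n] thus has zero normal trace on the boundary of each face [F]. With
    the moments (d), the argument for BDM elements gives [Pi_F t n = 0], so that
    [t n = 0] on all faces. Then (c) reads [n . div t = 0] on the boundary, and (e),
    integrated by parts, makes [div t] orthogonal to [ND_(k-3)(T)]; the BDM argument
    on [T] gives [div t = 0]. Hence [t] is orthogonal to every [def q], and by (f)
    and [P_(k-2)(S) = def P_(k-1) + ker (. x)] to all of [P_(k-2)(S)]. Finally
    [g_i^T t g_j = lam_i lam_j r_ij] for [i <> j], and testing [t] against the sum
    of the [r_ij sym (g_i g_j^T)] gives [t = 0]. Boundary terms vanish face by face,
    so the measures of the faces never enter.

    Integrals. By Dirichlet's formula the integral over a subsimplex is, up to a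
    positive factor, an explicit functional on monomials in barycentric
    coordinates, on which the divergence theorem is an identity of factorials.

    Count. The gradient identifies the homogeneous polynomials of degree [k + 2]
    with a complement of [ND_k] in the fields of degree at most [k + 1], and [def]
    identifies [P_(k-1) / ND_0] with [P_(k-2)(S) / ker (. x)]. *)

Require Import Defs.
From HB Require Import structures.
From mathcomp Require Import all_boot all_order all_algebra.
From mathcomp Require classical_sets set_interval ereal topology normedtype measure.
From mathcomp Require lebesgue_measure lebesgue_integral realfun derive ftc.
From mathcomp Require Import reals.
From mathcomp Require Import ssrcomplements mpoly.
From mathcomp Require Import ring lra zify.

Set Implicit Arguments.
Unset Strict Implicit.
Unset Printing Implicit Defensive.

Import Order.TTheory GRing.Theory Num.Theory.
Local Open Scope ring_scope.

(** * Substitution in polynomials *)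

(** Positivity of an integral only yields zeros in the open simplex, whereas division by [lam j]
    evaluates at projected points that may leave it. Vanishing is therefore always meant on the
    affine hull of a face, and restriction to lines carries it there from the interior. In return,
    integrals are needed only through linearity, positivity and Stokes' formula along edges, and all
    three hold for an algebraic functional on polynomials.

    The moments (d) are posed in an intrinsic chart of the face, while divergence and boundary
    conditions live in the ambient space. Tangency to a face is expressed by products with the
    [g j], and ambient test fields are traded for their tangential parts, so that a single BDM lemma
    serves a facet and, with the identity chart, [T] itself. In both uses the degree of the field
    exceeds the index of [ND] by two: one degree is lost in the division by [lam j], the other is
    regained from gradients. *)

Lemma monomial_ind n (P : 'X_{1..n} -> Prop) :
  P 0%MM -> (forall i m, P m -> P (U_(i) + m)%MM) -> forall m, P m.
Proof.
move=> P0 PS m; move: {2}(mdeg m) (erefl (mdeg m)) => k.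
elim: k m => [|k IH] m; first by move/eqP; rewrite mdeg_eq0 => /eqP ->.
move=> hm; have [i hi] : exists i, m i != 0%N.
  apply/existsP; apply: contraT; rewrite negb_exists => /forallP h.
  by move: hm; rewrite mdegE big1 // => i _; apply/eqP/negPn; apply: h.
have -> : m = (U_(i) + (m - U_(i)))%MM.
  by rewrite addmC submK //; rewrite lep1mP.
apply/PS/IH; apply: (@addnI 1%N).
by rewrite -(mdeg1 i) -mdegD addmC submK ?lep1mP // hm mdeg1 add1n.
Qed.

Lemma mderivXU (R : nzRingType) n (i j : 'I_n) :
  ('X_i : {mpoly R[n]})^`M(j) = (i == j)%:R.
Proof.
rewrite mderivX mnm1E; case: eqP => [->|_]; last by rewrite scale0r.
rewrite scale1r (_ : (U_(j) - U_(j))%MM = 0%MM) ?mpolyX0 //.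
by apply/mnmP => l; rewrite mnmBE subnn mnm0E.
Qed.

Section Compose.
Variable R : realType.

Definition psubst a b (phi : 'cV[{mpoly R[b]}]_a) : {mpoly R[a]} -> {mpoly R[b]} :=
  mmap (@mpolyC b R) (fun i => phi i 0).

HB.instance Definition _ a b (phi : 'cV[{mpoly R[b]}]_a) :=
  GRing.RMorphism.copy (psubst phi) (mmap (@mpolyC b R) (fun i => phi i 0)).

Lemma psubstC a b (phi : 'cV[{mpoly R[b]}]_a) c : psubst phi c%:MP = c%:MP.
Proof. exact: mmapC. Qed.

Lemma psubstXU a b (phi : 'cV[{mpoly R[b]}]_a) i : psubst phi 'X_i = phi i 0.
Proof. by rewrite /psubst mmapX mmap1U. Qed.

Lemma psubstZ a b (phi : 'cV[{mpoly R[b]}]_a) c q :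
  psubst phi (c *: q) = c *: psubst phi q.
Proof. by rewrite -!mul_mpolyC rmorphM /= psubstC. Qed.

HB.instance Definition _ n (x : 'cV[R]_n) :=
  GRing.RMorphism.copy (peval x) (meval (fun i => x i 0)).

Lemma pevalC n (x : 'cV[R]_n) c : peval x c%:MP = c.
Proof. exact: mevalC. Qed.

Lemma pevalXU n (x : 'cV[R]_n) i : peval x 'X_i = x i 0.
Proof. exact: mevalXU. Qed.

Lemma pevalZ n (x : 'cV[R]_n) c q : peval x (c *: q) = c * peval x q.
Proof. exact: mevalZ. Qed.

Lemma mpoly_ind_mul n (P : {mpoly R[n]} -> Prop) :
  P 1 -> (forall i q, P q -> P ('X_i * q)) ->
  (forall c p q, P p -> P q -> P (c *: p + q)) -> forall q, P q.
Proof.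
move=> P1 PX PD.
have PZ c q : P q -> P (c *: q).
  move=> hq; have : P ((-1) *: 1 + 1 : {mpoly R[n]}) by apply: PD.
  by rewrite scaleN1r addNr => P0; rewrite -[_ *: _]addr0; apply: PD.
have PM m : P 'X_[m].
  elim/monomial_ind: m => [|i m IH]; first by rewrite mpolyX0.
  by rewrite mpolyXD; apply: PX.
move=> q; rewrite [q]mpolyE; elim: (msupp q) => [|m s IH].
  by rewrite big_nil -(scale0r (1 : {mpoly R[n]})); apply: PZ.
by rewrite big_cons; apply: PD.
Qed.

Lemma peval_psubst a b (phi : 'cV[{mpoly R[b]}]_a) (x : 'cV[R]_b) q :
  peval x (psubst phi q) = peval (mxeval x phi) q.
Proof.
elim/mpoly_ind_mul: q => [|i q IH|c p q IHp IHq].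
- by rewrite !rmorph1.
- by rewrite !rmorphM /= psubstXU pevalXU mxE IH.
- by rewrite !rmorphD /= psubstZ !pevalZ IHp IHq.
Qed.

Lemma mderiv_psubst a b (phi : 'cV[{mpoly R[b]}]_a) (j : 'I_b) q :
  (psubst phi q)^`M(j) = \sum_i (phi i 0)^`M(j) * psubst phi q^`M(i).
Proof.
elim/mpoly_ind_mul: q => [|l q IH|c p q IHp IHq].
- rewrite rmorph1 -mpolyC1 mderivC big1 // => i _.
  by rewrite mderivC rmorph0 mulr0.
- rewrite rmorphM /= psubstXU mderivM IH.
  under [RHS]eq_bigr => i _.
    rewrite mderivM mderivXU rmorphD !rmorphM /= rmorph_nat psubstXU mulrDr; over.
  rewrite big_split /=; congr (_ + _).
    rewrite (bigD1 l) //= eqxx mul1r big1 ?addr0 // => i.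
    by rewrite eq_sym => /negPf ->; rewrite mul0r mulr0.
  by rewrite mulr_sumr; apply: eq_bigr => i _; rewrite mulrCA.
- rewrite rmorphD /= psubstZ mderivD mderivZ IHp IHq scaler_sumr -big_split /=.
  apply: eq_bigr => i _; rewrite mderivD mderivZ rmorphD /= psubstZ mulrDr.
  by rewrite -scalerAr.
Qed.

Lemma msizeM_leq n (p q : {mpoly R[n]}) a b :
  (msize p <= a.+1)%N -> (msize q <= b)%N -> (msize (p * q) <= a + b)%N.
Proof.
case: (eqVneq p 0) => [->|p0]; first by rewrite mul0r msize0.
case: (eqVneq q 0) => [->|q0]; first by rewrite mulr0 msize0.
rewrite msizeM // => hp hq; apply: (@leq_trans (a.+1 + b).-1) => //.
by rewrite -!subn1 leq_sub2r //; apply: leq_add.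
Qed.

Lemma msize_sum_leq n (I : Type) (r : seq I) (P : pred I) (F : I -> {mpoly R[n]}) k :
  (forall i, P i -> (msize (F i) <= k)%N) -> (msize (\sum_(i <- r | P i) F i) <= k)%N.
Proof.
move=> h; elim/big_rec: _ => [|i y Pi IH]; first by rewrite msize0.
by apply: leq_trans (msizeD_le _ _) _; rewrite geq_max h.
Qed.

Lemma msizeD_leq n (p q : {mpoly R[n]}) k :
  (msize p <= k)%N -> (msize q <= k)%N -> (msize (p + q) <= k)%N.
Proof. by move=> hp hq; apply: leq_trans (msizeD_le _ _) _; rewrite geq_max hp. Qed.

Lemma msizeB_leq n (p q : {mpoly R[n]}) k :
  (msize p <= k)%N -> (msize q <= k)%N -> (msize (p - q) <= k)%N.
Proof. by move=> hp hq; apply: msizeD_leq => //; rewrite msizeN. Qed.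

Lemma msizeZ_leq n c (p : {mpoly R[n]}) k :
  (msize p <= k)%N -> (msize (c *: p) <= k)%N.
Proof. by apply: leq_trans; apply: msizeZ_le. Qed.

Lemma msize_leqP n (p : {mpoly R[n]}) k :
  (forall m, (k <= mdeg m)%N -> p@_m = 0) <-> (msize p <= k)%N.
Proof.
split=> [h|h m hm]; last by apply: memN_msupp_eq0; apply: msize_mdeg_ge; apply: leq_trans hm.
rewrite msizeE big_seq; elim/big_rec: _ => // m y hm IH; rewrite geq_max IH andbT.
by rewrite ltnNge; apply/negP => /h; apply/eqP; rewrite -mcoeff_msupp.
Qed.

Lemma msize_mderiv n (p : {mpoly R[n]}) i k :
  (msize p <= k.+1)%N -> (msize p^`M(i) <= k)%N.
Proof.
move/msize_leqP => h; apply/msize_leqP => m hm.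
by rewrite mcoeff_mderiv h ?mul0rn // mdegD mdeg1 addn1.
Qed.

Lemma msize_psubst a b (phi : 'cV[{mpoly R[b]}]_a) q :
  (forall i, (msize (phi i 0)%R <= 2)%N) -> (msize (psubst phi q) <= msize q)%N.
Proof.
move=> hphi; have hm (m : 'X_{1..a}) : (msize (psubst phi 'X_[m]) <= (mdeg m).+1)%N.
  elim/monomial_ind: m => [|i m IH]; first by rewrite mpolyX0 rmorph1 msize1.
  rewrite mpolyXD rmorphM /= psubstXU mdegD mdeg1.
  exact: (@msizeM_leq _ _ _ 1).
rewrite {1}[q]mpolyE raddf_sum /= big_seq; apply: msize_sum_leq => m hq.
rewrite psubstZ; apply: leq_trans (msizeZ_le _ _) _; apply: leq_trans (hm m) _.
exact: msize_mdeg_lt.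
Qed.

(** The substitution moves each variable by a multiple of [l], and telescoping over the factors of a
    monomial extracts one factor [l]. For [l] a barycentric coordinate it becomes a projection onto
    a facet; division by [lam j] rests on this. *)
Lemma psubst_shift n (l : {mpoly R[n]}) (u : 'cV[R]_n) q k :
  (msize l <= 2)%N -> (msize q <= k.+1)%N ->
  let phi := \col_i ('X_i - (u i 0) *: l) in
  exists2 r, (msize r <= k)%N & q - psubst phi q = l * r.
Proof.
move=> hl hq phi.
have hphi i : (msize (phi i 0)%R <= 2)%N.
  by rewrite mxE msizeB_leq ?msizeZ_leq // msizeX mdeg1.
have hm (m : 'X_{1..n}) : exists2 r : {mpoly R[n]}, (msize r <= mdeg m)%N &
    'X_[m] - psubst phi 'X_[m] = l * r.
  elim/monomial_ind: m => [|i m [r hr e]].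
    by exists 0; rewrite ?msize0 // mpolyX0 rmorph1 subrr mulr0.
  exists ('X_i * r + u i 0 *: psubst phi 'X_[m]).
    rewrite mdegD mdeg1; apply: msizeD_leq.
      by apply: (@msizeM_leq _ _ _ 1) => //; rewrite msizeX mdeg1.
    apply: msizeZ_leq; apply: leq_trans (msize_psubst _ hphi) _.
    by rewrite msizeX.
  have {}e : 'X_[m] = l * r + psubst phi 'X_[m] by rewrite -e subrK.
  rewrite mpolyXD rmorphM /= psubstXU mxE {1}e.
  by rewrite -!mul_mpolyC; ring.
rewrite [q]mpolyE; move: hq; rewrite msizeE.
elim: (msupp q) => [|m s IH].
  by exists 0; rewrite ?msize0 // big_nil rmorph0 subrr mulr0.
rewrite !big_cons geq_max => /andP [h1 /IH [r hr e]].
have [r' hr' e'] := hm m; exists (q@_m *: r' + r).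
  by apply: msizeD_leq => //; apply: msizeZ_leq; apply: leq_trans hr' _.
rewrite rmorphD /= psubstZ mulrDr -e -scalerAr -e' scalerBr; ring.
Qed.

(** Restriction to a line is kept as a univariate polynomial, so that zeros can be counted and
    extended along the line. *)
Lemma peval_line n (x z : 'cV[R]_n) q : exists g : {poly R}, forall s,
  g.[s] = peval (x + s *: z) q /\
  g^`().[s] = \sum_i z i 0 * peval (x + s *: z) q^`M(i).
Proof.
elim/mpoly_ind_mul: q => [|i q [g hg]|c p q [g hg] [h hh]].
- exists 1%:P => s; rewrite hornerC rmorph1 derivC horner0; split=> //.
  by rewrite big1 // => i _; rewrite -mpolyC1 mderivC rmorph0 mulr0.
- exists (((x i 0)%:P + (z i 0) *: 'X) * g) => s; have [g0 g1] := hg s.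
  rewrite hornerM hornerD hornerZ hornerC hornerX rmorphM /= pevalXU !mxE g0 (mulrC s).
  split=> //; rewrite derivM derivD derivC derivZ derivX add0r hornerD !hornerM.
  rewrite hornerD hornerC !hornerZ hornerX hornerC mulr1 g0 g1.
  under [RHS]eq_bigr => j _.
    rewrite mderivM mderivXU rmorphD !rmorphM /= rmorph_nat pevalXU mulrDr; over.
  rewrite big_split /=; congr (_ + _).
    rewrite (bigD1 i) //= eqxx mul1r big1 ?addr0 // => j.
    by rewrite eq_sym => /negPf ->; rewrite mul0r mulr0.
  rewrite mulr_sumr; apply: eq_bigr => j _; rewrite !mxE; ring.
- exists (c *: g + h) => s; have [g0 g1] := hg s; have [h0 h1] := hh s.
  rewrite hornerD hornerZ rmorphD /= pevalZ derivD derivZ hornerD hornerZ.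
  rewrite g0 h0 g1 h1; split=> //.
  under [RHS]eq_bigr => i _ do rewrite mderivD mderivZ rmorphD /= pevalZ mulrDr.
  rewrite big_split /= mulr_sumr; congr (_ + _).
  by apply: eq_bigr => i _; rewrite mulrCA.
Qed.

Lemma poly_eq0_near0 (g : {poly R}) (e : R) : 0 < e ->
  (forall s, 0 < s -> s < e -> g.[s] = 0) -> g = 0.
Proof.
move=> e0 h; apply/eqP; apply: contraT => g0.
(* These are [size g] distinct points of the open interval from 0 to [e], one more than the degree
   allows as roots. *)
pose rs := [seq e / (i.+2)%:R | i <- iota 0 (size g)].
have := @max_poly_roots _ g rs g0.
rewrite size_map size_iota ltnn => -> //.
  apply/allP => x /mapP [i _ ->]; apply/rootP; apply: h.
    by rewrite divr_gt0 // ltr0n.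
  by rewrite ltr_pdivrMr ?ltr0n // -{1}[e]mulr1 ltr_pM2l // ltr1n.
rewrite map_inj_uniq ?iota_uniq // => i j /(mulfI (lt0r_neq0 e0)) /invr_inj /eqP.
by rewrite eqr_nat => /eqP [].
Qed.

(** Induction on the degree: along every coordinate line the restriction is the zero polynomial, so
    the partial derivatives vanish everywhere and are zero by induction, which leaves a constant. *)
Lemma peval_inj0 n (q : {mpoly R[n]}) : (forall x, peval x q = 0) -> q = 0.
Proof.
move: {2}(msize q) (leqnn (msize q)) => k; elim: k q => [|k IH] q.
  by rewrite leqn0 msize_poly_eq0 => /eqP.
move=> hk h0; have hd i : q^`M(i) = 0.
  apply: IH => [|x]; first exact: msize_mderiv.
  have [g hg] := peval_line x (delta_mx i 0) q.
  have g0 : g = 0 by apply: (@poly_eq0_near0 _ 1) => // s _ _; rewrite (hg s).1.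
  have := (hg 0).2; rewrite g0 deriv0 horner0 (bigD1 i) //= big1 => [|j].
    by rewrite scale0r !addr0 mxE !eqxx mul1r.
  by rewrite mxE => /negPf ->; rewrite mul0r.
have qC : q = (q@_0)%:MP.
  apply/mpolyP => m; rewrite mcoeffC; case: eqVneq => [->|m0]; first by rewrite mulr1.
  have [i hi] : exists i, m i != 0%N.
    apply/existsP; apply: contraR m0; rewrite negb_exists => /forallP h.
    by apply/eqP/mnmP => i; rewrite mnm0E; apply/eqP/negPn/h.
  have := congr1 (mcoeff (m - U_(i))%MM) (hd i).
  rewrite mcoeff0 mcoeff_mderiv submK ?lep1mP // => /eqP.
  by rewrite mulrn_eq0 /= => /eqP ->; rewrite mulr0.
by have := h0 0; rewrite qC pevalC => ->; rewrite mpolyC0.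
Qed.

Lemma peval_inj n (p q : {mpoly R[n]}) : (forall x, peval x p = peval x q) -> p = q.
Proof.
by move=> h; apply/eqP; rewrite -subr_eq0; apply/eqP/peval_inj0 => x; rewrite rmorphB /= h subrr.
Qed.

End Compose.

(** * Koszul decompositions *)

Section Koszul.
Variables (R : realType) (n : nat).
Implicit Types (q s : {mpoly R[n]}) (u v w : 'cV[{mpoly R[n]}]_n).

(** The Koszul contraction with the position field; composed with [grad] it is Euler's operator. *)
Definition xdot v : {mpoly R[n]} := \sum_i 'X_i * v i 0.

Lemma euler_monom (m : 'X_{1..n}) : xdot (grad 'X_[m]) = (mdeg m)%:R *: 'X_[R, m].
Proof.
rewrite /xdot mdegE natr_sum scaler_suml; apply: eq_bigr => i _.
rewrite mxE mderivX -scalerAr -mpolyXD; case: (posnP (m i)) => [->|mi].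
  by rewrite !scale0r.
by rewrite addmC submK // lep1mP -lt0n.
Qed.

Lemma xdot_linear c v w : xdot (c%:MP *: v + w) = c *: xdot v + xdot w.
Proof.
rewrite /xdot scaler_sumr -big_split /=; apply: eq_bigr => i _.
by rewrite !mxE mulrDr mul_mpolyC scalerAr.
Qed.

Lemma grad_linear c q s : grad (c *: q + s) = c%:MP *: grad q + grad s.
Proof.
by apply/matrixP => i j; rewrite !mxE mderivD mderivZ mul_mpolyC.
Qed.

Lemma mcoeff_euler q m : (xdot (grad q))@_m = (mdeg m)%:R * q@_m.
Proof.
rewrite [q]mpolyE; elim: (msupp q) => [|m' t IH].
  rewrite big_nil mcoeff0 mulr0 /xdot big1 ?mcoeff0 // => i _.
  by rewrite mxE mderiv0 mulr0.
rewrite big_cons grad_linear xdot_linear !mcoeffD !mcoeffZ IH euler_monom mcoeffZ mcoeffX.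
by rewrite mulrDr; case: (eqVneq m' m) => [->|_]; rewrite ?mulr0 ?mulr1 // mulrC.
Qed.

Lemma euler_homog j q : q \is j.-homog for mdeg -> xdot (grad q) = j%:R *: q.
Proof.
move=> hq; apply/mpolyP => m; rewrite mcoeff_euler mcoeffZ.
case: (eqVneq (mdeg m) j) => [->//|h].
by rewrite (dhomog_nemf_coeff hq h) !mulr0.
Qed.

Lemma mderiv_xdot i v : (xdot v)^`M(i) = v i 0 + \sum_l 'X_l * (v l 0)^`M(i).
Proof.
rewrite /xdot raddf_sum /=.
under eq_bigr => l _ do rewrite mderivM mderivXU.
rewrite big_split /= (bigD1 i) //= eqxx mul1r big1 ?addr0 // => l li.
by rewrite (negPf li) mul0r.
Qed.

Lemma homog_mderiv j q i : q \is j.+1.-homog for mdeg -> q^`M(i) \is j.-homog for mdeg.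
Proof.
move=> /dhomogP hq; apply/dhomogP => m; rewrite mcoeff_msupp mcoeff_mderiv.
case: (eqVneq q@_(m + U_(i)) 0) => [->|]; first by rewrite mul0rn eqxx.
by rewrite -mcoeff_msupp => /hq; rewrite /= mdegD mdeg1 addn1 => -[].
Qed.

Lemma homogX (i : 'I_n) : ('X_i : {mpoly R[n]}) \is 1.-homog for mdeg.
Proof. by rewrite dhomogX /= mdeg1. Qed.

Lemma homog_xdot j v : (forall i, v i 0 \is j.-homog for mdeg) ->
  xdot v \is j.+1.-homog for mdeg.
Proof.
by move=> hv; apply: rpred_sum => i _; apply: (@dhomogM _ _ _ 1); rewrite ?homogX.
Qed.

(* By Euler's identity [s = (x . u) / (j + 2)] leaves a remainder [w] with
   [x . w = 0], and then [w = K x] for [K] the skew gradient of [w] over [j + 2]. *)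
Lemma koszul_grad j u : (forall i, u i 0 \is j.+1.-homog for mdeg) ->
  exists s, exists K : 'M[{mpoly R[n]}]_n,
    [/\ s \is j.+2.-homog for mdeg, K^T = - K,
        forall i l, K i l \is j.-homog for mdeg & u = grad s + K *m coordp R n].
Proof.
move=> hu; pose c : R := j.+2%:R^-1.
have cj : c * j.+2%:R = 1 by rewrite mulVf // pnatr_eq0.
pose s := c *: xdot u; have [w wE] : {w | w = u - grad s} by exists (u - grad s).
have hs : s \is j.+2.-homog for mdeg by rewrite dhomogZ // homog_xdot.
have hw i : w i 0 \is j.+1.-homog for mdeg.
  by rewrite wE !mxE rpredB // homog_mderiv.
have xw : xdot w = 0.
  have -> : w = (-1)%:MP *: grad s + u.
    by rewrite wE; apply/matrixP => i l; rewrite !mxE mpolyCN mpolyC1 mulN1r addrC.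
  by rewrite xdot_linear (euler_homog hs) // /s [in X in -1 *: X]scalerA [_ * c]mulrC cj scale1r scaleN1r addNr.
exists s, (\matrix_(i, l) (c *: ((w i 0)^`M(l) - (w l 0)^`M(i)))); split=> //.
- by apply/matrixP => i l; rewrite !mxE -scalerN opprB.
- by move=> i l; rewrite mxE dhomogZ // rpredB // homog_mderiv.
apply/matrixP => i l; rewrite (ord1 l) mxE mxE addrC.
apply/eqP; rewrite -subr_eq; apply/eqP.
have -> : u i 0 - s^`M(i) = w i 0 by rewrite wE !mxE.
have := mderiv_xdot i w; rewrite xw mderiv0 => /esym /eqP.
rewrite addrC addr_eq0 => /eqP e.
have e2 := euler_homog (hw i).
rewrite [RHS]mxE; under [RHS] eq_bigr => r _.
  rewrite !mxE -scalerAl mulrC mulrBr scalerBr; over.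
rewrite sumrB -!scaler_sumr e -scalerBr opprK.
have -> : \sum_i0 'X_i0 * (w i 0)^`M(i0) = xdot (grad (w i 0)).
  by apply: eq_bigr => r _; rewrite mxE.
by rewrite e2 -[X in _ + X]scale1r -scalerDl natr1 scalerA cj scale1r.
Qed.

(** One half of the symmetric gradient gives Euler's operator; by the product rule the transposed
    half gives [grad (x . v) - v]. *)
Lemma defm_coordp v i : (defm v *m coordp R n) i 0 =
  2^-1 *: (xdot (grad (v i 0)) + (xdot v)^`M(i) - v i 0).
Proof.
rewrite mderiv_xdot addrA addrAC addrK mxE -big_split scaler_sumr /=.
by apply: eq_bigr => l _; rewrite !mxE -scalerAl mulrDl !(mulrC _ 'X_l).
Qed.

(* For [v] homogeneous of degree [j + 1], [2 (defm v) x = j v + grad (x . v)];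
   taking the product with [x] first determines [x . v], and then [v]. *)
Lemma defm_homog_onto j (q : 'M[{mpoly R[n]}]_n) : q^T = q ->
  (forall i l, q i l \is j.-homog for mdeg) ->
  exists2 v : 'cV[{mpoly R[n]}]_n, (forall i, v i 0 \is j.+1.-homog for mdeg) &
    (q - defm v) *m coordp R n = 0.
Proof.
move=> qT hq; have [u uE] : {u | u = q *m coordp R n} by exists (q *m coordp R n).
have hu i : u i 0 \is j.+1.-homog for mdeg.
  rewrite uE mxE; apply: rpred_sum => l _; rewrite -[j.+1]addn1; apply: dhomogM => //.
  by rewrite mxE homogX.
have two : (2^-1 : R) * 2 = 1 by rewrite mulVf // pnatr_eq0.
suff [v hv e] : exists2 v : 'cV[{mpoly R[n]}]_n, (forall i, v i 0 \is j.+1.-homog for mdeg) &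
    forall i, (defm v *m coordp R n) i 0 = u i 0.
  by exists v => //; apply/matrixP => i l; rewrite (ord1 l) mulmxBl mxE [in X in _ + X]mxE e uE subrr mxE.
(* For [j = 0] the term [j v] is lost, and the symmetry of the constant matrix [q] replaces it:
   [v = q x] satisfies [grad (x . v) = 2 q x]. *)
case: j hq hu => [|j] hq hu.
  exists u => // i; rewrite defm_coordp (euler_homog (hu i)) scale1r addrAC subrr add0r.
  have hc a b : exists c, q a b = c%:MP.
    exists (q a b)@_0; apply/mpolyP => m; rewrite mcoeffC.
    case: eqVneq => [->|m0]; first by rewrite mulr1.
    by rewrite (dhomog_nemf_coeff (hq a b)) ?mulr0 // mdeg_eq0.
  rewrite mderiv_xdot; have -> : \sum_l 'X_l * (u l 0)^`M(i) = u i 0.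
    rewrite uE [RHS]mxE; apply: eq_bigr => l _; rewrite mxE raddf_sum /=.
    rewrite (bigD1 i) //= big1 ?addr0 => [|r ri].
      have [c e] := hc l i; rewrite e mderiv_mulC mxE mderivXU eqxx mulr1.
      by rewrite -e -{1}qT mxE mxE mulrC.
    by have [c ->] := hc l r; rewrite mderiv_mulC mxE mderivXU (negPf ri) mulr0.
  by rewrite -mulr2n -scaler_nat scalerA two scale1r.
(* Now [q] has degree [j + 1], and [2 u = (j + 1) v + grad (x . v)] is to be solved. Its product
   with [x] reads [2 (x . u) = (2 j + 4) (x . v)], so [s] is the forced value of [x . v]. *)
have [s sE] : {s | s = j.+2%:R^-1 *: xdot u} by exists (j.+2%:R^-1 *: xdot u).
have hs : s \is j.+3.-homog for mdeg by rewrite sE dhomogZ // homog_xdot.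
have cj : (j.+2%:R : R) * j.+2%:R^-1 = 1 by rewrite mulfV // pnatr_eq0.
have cj1 : (j.+1%:R : R) * j.+1%:R^-1 = 1 by rewrite mulfV // pnatr_eq0.
have su : xdot u = j.+2%:R *: s by rewrite sE scalerA cj scale1r.
pose v := (j.+1%:R^-1)%:MP *: ((2%:R)%:MP *: u + ((-1)%:MP *: grad s + 0)).
have hv i : v i 0 \is j.+2.-homog for mdeg.
  rewrite !mxE !mul_mpolyC addr0; apply: dhomogZ.
  by apply: rpredD; apply: dhomogZ => //; apply: homog_mderiv.
have xv : xdot v = s.
  rewrite /v -[_ *: (_ + _)]addr0 !xdot_linear su (euler_homog hs).
  have -> : xdot 0 = 0 by rewrite /xdot big1 // => i _; rewrite mxE mulr0.
  rewrite !addr0 !scalerA -scalerDl scalerA mulN1r.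
  have -> : (2%:R * j.+2%:R - j.+3%:R : R) = j.+1%:R by rewrite -!natr1; ring.
  by rewrite mulrC cj1 scale1r.
exists v => // i; rewrite defm_coordp (euler_homog (hv i)) xv.
rewrite -[X in _ - X]scale1r addrAC -scalerBl.
have -> : (j.+2%:R - 1 : R) = j.+1%:R by rewrite -natr1 addrK.
rewrite !mxE !mul_mpolyC addr0 scalerA cj1 scale1r scaleN1r addrNK scalerA two scale1r //.
Qed.

Lemma mxeval_coordp (x : 'cV[R]_n) : mxeval x (coordp R n) = x.
Proof. by apply/matrixP => i j; rewrite !mxE (ord1 j) pevalXU. Qed.

Lemma mulmx_coordp_eq0 (q : 'M[{mpoly R[n]}]_n) :
  (forall x : 'cV[R]_n, mxeval x q *m x = 0) <-> q *m coordp R n = 0.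
Proof.
have e x : mxeval x q *m x = mxeval x (q *m coordp R n).
  by rewrite [RHS]map_mxM -[map_mx _ (coordp R n)]/(mxeval x (coordp R n)) mxeval_coordp.
split=> [h|h x]; last by rewrite e h /mxeval map_mx0.
apply/matrixP => i j; rewrite [RHS]mxE; apply: peval_inj0 => x; move/matrixP/(_ i j): (h x).
by rewrite e [LHS]mxE [RHS]mxE.
Qed.

Lemma dhomog_msize_leq j q : q \is j.-homog for mdeg -> (msize q <= j.+1)%N.
Proof.
move=> /dhomogP h; rewrite msizeE big_seq; elim/big_rec: _ => // m y hm IH.
by rewrite geq_max IH andbT (h _ hm).
Qed.

Lemma dhomog_eq0_msize j q : q \is j.-homog for mdeg -> (msize q <= j)%N -> q = 0.
Proof.
move=> /dhomogP h hj; apply/eqP; rewrite -msize_poly_eq0 -leqn0 msizeE big_seq.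
elim/big_rec: _ => // m y hm _; move: (msize_mdeg_lt hm).
by rewrite (h _ hm) ltnNge hj.
Qed.

Lemma pihomog_top k q : (msize q <= k.+1)%N -> (msize (q - pihomog mdeg k q) <= k)%N.
Proof.
move=> hq; rewrite {1}(pihomog_partitionE hq) big_ord_recr /= addrK.
apply: msize_sum_leq => i _; apply: leq_trans (ltn_ord i).
exact/dhomog_msize_leq/pihomogP.
Qed.

(** Only the part of degree [k + 1] has to be corrected: it splits as [grad s + K x], and [K x]
    together with the lower part is in [ND k]. *)
Lemma grad_ND_decomp k u : (forall i, (msize (u i 0%R) <= k.+2)%N) ->
  exists2 s, s \is k.+2.-homog for mdeg & ND k (u - grad s).
Proof.
move=> hu; pose ut := \col_i pihomog mdeg k.+1 (u i 0).
have [i|s [K [hs hK hKh e]]] := @koszul_grad k ut; first by rewrite mxE pihomogP.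
exists s => //; exists (u - ut), K; split=> // [i|].
  by rewrite !mxE; apply: pihomog_top.
by apply/eqP; rewrite subr_eq -addrA (addrC (K *m _)) -e subrK.
Qed.

(** The product with [x] kills the skew part, so by Euler [(k + 2) s = x . u], which has degree at
    most [k + 1], while [s] is homogeneous of degree [k + 2]. *)
Lemma grad_ND_eq0 k s : s \is k.+2.-homog for mdeg -> ND k (grad s) -> s = 0.
Proof.
move=> hs [u [K [hu hK _ e]]].
have e1 : k.+2%:R *: s = xdot u.
  rewrite -(euler_homog hs) e -[u + _]addrC -[K *m _]scale1r -mpolyC1 xdot_linear scale1r.
  rewrite -[RHS]add0r; congr (_ + _); rewrite /xdot.
  under eq_bigr => i _ do rewrite mxE mulr_sumr.
  set S := LHS; have : S = - S.
    rewrite /S {1}exchange_big /= -sumrN; apply: eq_bigr => i _.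
    rewrite -sumrN; apply: eq_bigr => j _; rewrite !mxE.
    have -> : K j i = - K i j by rewrite -[in LHS](trmxK K) hK !mxE.
    ring.
  move/eqP; rewrite -addr_eq0 -mulr2n -scaler_nat scaler_eq0 pnatr_eq0 /=.
  by move/eqP.
have {}e1 : s = k.+2%:R^-1 *: xdot u.
  by rewrite -e1 scalerA mulVf ?scale1r // pnatr_eq0.
apply: (dhomog_eq0_msize hs); rewrite e1; apply: msizeZ_leq.
apply: msize_sum_leq => i _; apply: (@msizeM_leq _ _ _ _ 1) => //.
by rewrite msizeX mdeg1.
Qed.

Lemma defm_linear c v w : defm (c%:MP *: v + w) = c%:MP *: defm v + defm w.
Proof.
apply/matrixP => i j; rewrite !mxE !mderivD !mderiv_mulC -!mul_mpolyC; ring.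
Qed.

Lemma defm_sum (I : Type) (r : seq I) (F : I -> 'cV[{mpoly R[n]}]_n) :
  defm (\sum_(i <- r) F i) = \sum_(i <- r) defm (F i).
Proof.
elim: r => [|a r IH].
  rewrite !big_nil; apply/matrixP => i j; rewrite !mxE !mderiv0 addr0 scaler0 //.
by rewrite !big_cons -[F a]scale1r -mpolyC1 defm_linear IH mpolyC1 !scale1r.
Qed.

Lemma defm_PS k v : (forall i, (msize (v i 0%R) <= k.+2)%N) -> PS k (defm v).
Proof.
move=> hv; split=> [|i j]; first by apply/matrixP => i j; rewrite !mxE addrC.
by rewrite mxE msizeZ_leq // msizeD_leq // msize_mderiv.
Qed.

(** The homogeneous parts are treated one by one, since the preimage under [defm] involves constants
    depending on the degree. *)
Lemma PS_defm_decomp k (q : 'M[{mpoly R[n]}]_n) : PS k q ->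
  exists2 v : 'cV[{mpoly R[n]}]_n, forall i, (msize (v i 0%R) <= k.+2)%N &
    PSker k (q - defm v).
Proof.
move=> [qT hq].
have step (j : 'I_k.+1) : exists v : 'cV[{mpoly R[n]}]_n,
   (forall i, (msize (v i 0%R) <= k.+2)%N) /\
   (map_mx (pihomog mdeg j) q - defm v) *m coordp R n = 0.
  have [||v hv e] := @defm_homog_onto j (map_mx (pihomog mdeg j) q).
  - by rewrite map_trmx qT.
  - by move=> i l; rewrite mxE pihomogP.
  exists v; split=> // i; apply: leq_trans (dhomog_msize_leq (hv i)) _.
  by rewrite ltnS.
have [v hv] := fin_all_exists step.
have hvs i : (msize ((\sum_j v j) i 0)%R <= k.+2)%N.
  by rewrite summxE; apply: msize_sum_leq => j _; apply: (hv j).1.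
exists (\sum_j v j) => //; split; first split.
- by have [dT _] := defm_PS hvs; rewrite linearB /= dT qT.
- by move=> i l; rewrite mxE msizeD_leq // mxE msizeN; apply: (defm_PS hvs).2.
apply/mulmx_coordp_eq0; rewrite defm_sum.
have -> : q = \sum_(j < k.+1) map_mx (pihomog mdeg j) q.
  apply/matrixP => i l; rewrite summxE; under eq_bigr do rewrite mxE.
  exact: pihomog_partitionE.
by rewrite -sumrB mulmx_suml big1 // => j _; case: (hv j).
Qed.

Lemma defm_ND0 v : ND 0 v -> defm v = 0.
Proof.
move=> [u [K [hu hK hKh e]]].
have dC q j : (msize q <= 1)%N -> q^`M(j) = 0.
  by move=> hq; apply/eqP; rewrite -msize_poly_eq0 -leqn0 msize_mderiv.
have dv i j : (v i 0)^`M(j) = K i j.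
  rewrite e mxE mderivD dC // add0r mxE raddf_sum /= (bigD1 j) //= big1 ?addr0 => [|l lj].
    rewrite mxE mderivM (dC (K i j)) ?dhomog_msize_leq // mul0r add0r mderivXU eqxx.
    exact: mulr1.
  rewrite mxE mderivM (dC (K i l)) ?dhomog_msize_leq // mul0r add0r mderivXU.
  by rewrite (negPf lj) mulr0.
apply/matrixP => i j; rewrite !mxE !dv -{2}(trmxK K) hK !mxE.
by rewrite addrN scaler0.
Qed.

(** The product of [2 (defm v) x = 0] with [x] says that Euler's operator fixes [x . v], which is
    thus linear. Then Euler's operator minus the identity sends [v] to a constant field, so [v] is
    affine; its constant symmetric gradient kills every [x] and is zero. This makes [ND 0] the exact
    kernel in the count for (e) and (f). *)
Lemma defm_coordp_eq0 v : defm v *m coordp R n = 0 -> ND 0 v.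
Proof.
move=> h0.
have h i : xdot (grad (v i 0)) + (xdot v)^`M(i) - v i 0 = 0.
  have := congr1 (fun A : 'cV_n => A i 0) h0; rewrite /= defm_coordp mxE => /eqP.
  by rewrite scaler_eq0 invr_eq0 pnatr_eq0 => /eqP.
have xx : \sum_i 'X_i * xdot (grad (v i 0)) = xdot (grad (xdot v)) - xdot v.
  apply/eqP; rewrite eq_sym subr_eq addrC; apply/eqP.
  rewrite {1}/xdot; under eq_bigr => j _ do rewrite mxE mderiv_xdot mulrDr mulr_sumr.
  rewrite big_split /=; congr (_ + _); rewrite exchange_big /=; apply: eq_bigr => l _.
  by rewrite /xdot mulr_sumr; apply: eq_bigr => j _; rewrite mxE mulrCA.
have ds m : (mdeg m)%:R * (xdot v)@_m = (xdot v)@_m.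
  have : 2 *: (xdot (grad (xdot v)) - xdot v) = 0.
    rewrite scaler_nat mulr2n -{1}xx addrA -{1}[xdot (grad (xdot v))]/(\sum_i _).
    under [X in _ + X - _]eq_bigr do rewrite mxE.
    rewrite -big_split /= /xdot -sumrB big1 // => i _.
    by rewrite -mulrDr -mulrBr h mulr0.
  move/(congr1 (mcoeff m)); rewrite mcoeffZ mcoeffB mcoeff_euler mcoeff0 => /eqP.
  by rewrite mulf_eq0 pnatr_eq0 /= subr_eq0 => /eqP.
have s0 m : mdeg m != 1%N -> (xdot v)@_m = 0.
  move=> hm; apply/eqP; have /eqP := ds m; rewrite -subr_eq0 -{2}[(xdot v)@_m]mul1r -mulrBl.
  by rewrite mulf_eq0 subr_eq0 -[1]/(1%:R) eqr_nat (negPf hm).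
have hv i : (msize (v i 0%R) <= 2)%N.
  apply/msize_leqP => m hm; have := congr1 (mcoeff m) (h i).
  rewrite mcoeff0 mcoeffB mcoeffD mcoeff_euler mcoeff_mderiv s0 ?mul0rn ?addr0; last first.
    by rewrite mdegD mdeg1 addn1 eqSS -lt0n (leq_trans _ hm).
  move/eqP; rewrite -{2}[(v i 0)@_m]mul1r -mulrBl mulf_eq0 subr_eq0 -[1]/(1%:R) eqr_nat.
  by case: eqP hm => [->|_ _ /eqP].
have hdv i j : exists c, (v i 0)^`M(j) = c%:MP.
  by exists ((v i 0)^`M(j))@_0; apply: msize1_polyC; apply: msize_mderiv.
have sk i j : (v i 0)^`M(j) + (v j 0)^`M(i) = 0.
  have hc l : exists c, (v i 0)^`M(l) + (v l 0)^`M(i) = c%:MP.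
    have [c ->] := hdv i l; have [c' ->] := hdv l i; exists (c + c').
    by rewrite mpolyCD.
  have := congr1 (fun A : 'cV_n => (A i 0)^`M(j)) h0.
  rewrite /= !mxE mderiv0 raddf_sum (bigD1 j) //= big1 ?addr0 => [|l lj].
    have [c e] := hc j; rewrite !mxE e mderivM mderivZ mderivC scaler0 mul0r add0r.
    rewrite mderivXU eqxx mulr1 => /eqP.
    by rewrite scaler_eq0 invr_eq0 pnatr_eq0 /= => /eqP.
  have [c e] := hc l; rewrite !mxE e mderivM mderivZ mderivC scaler0 mul0r add0r.
  by rewrite mderivXU (negPf lj) mulr0.
exists (\col_i ((v i 0)@_0)%:MP), (\matrix_(i, j) (v i 0)^`M(j)); split.
- by move=> i; rewrite mxE msizeC; case: eqP.
- by apply/matrixP => i j; rewrite !mxE; apply/eqP; rewrite -addr_eq0 sk.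
- move=> i j; rewrite mxE; have [c ->] := hdv i j; rewrite -[c%:MP]mulr1 mul_mpolyC dhomogZ //.
  exact: dhomog1.
apply/matrixP => i l; rewrite (ord1 l) !mxE.
apply/mpolyP => m; rewrite mcoeffD mcoeffC.
have -> : \sum_j (\matrix_(i, j) (v i 0)^`M(j)) i j * coordp R n j 0 = xdot (grad (v i 0)).
  by apply: eq_bigr => j _; rewrite !mxE mulrC.
rewrite mcoeff_euler; case: (eqVneq m 0%MM) => [->|m0]; first by rewrite mdeg0 mul0r addr0 mulr1.
rewrite mulr0 add0r; case: (ltnP 1 (mdeg m)) => hm.
  by rewrite ((msize_leqP _ _).2 (hv i) _ hm) mulr0.
suff -> : mdeg m = 1%N by rewrite mul1r.
by apply/eqP; rewrite eqn_leq hm lt0n mdeg_eq0.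
Qed.

End Koszul.

(** * Integrals of polynomials over simplices *)

Section Corner.
Import classical_sets set_interval ereal topology normedtype measure.
Import lebesgue_measure lebesgue_integral realfun derive ftc.
Import numFieldNormedType.Exports.
Variable R : realType.

Lemma Rintegral_deriv_poly (Q : {poly R}) a b : a <= b ->
  Rintegral (@lebesgue_measure R) [set` `[a, b]] (fun t => Q^`().[t]) = Q.[b] - Q.[a].
Proof.
rewrite le_eqVlt => /predU1P [<-|ab].
  by rewrite set_itv1 Rintegral_set1 subrr.
rewrite /Rintegral (@continuous_FTC2 _ _ (horner Q)) //.
- by apply: continuous_subspaceT => x; apply: continuous_horner.
- split=> [x _||]; first exact: derivable_horner.
    by apply: cvg_at_right_filter; apply: continuous_horner.
  by apply: cvg_at_left_filter; apply: continuous_horner.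
- by move=> x _; rewrite derivE.
Qed.

Lemma poly_antideriv (G : {poly R}) : exists Q, Q^`() = G.
Proof.
exists (\poly_(i < (size G).+1) (G`_i.-1 / i%:R)); apply/polyP => i.
rewrite coef_deriv coef_poly ltnS /=; case: ltnP => hi.
  by rewrite -(mulr_natr (_ / _)) divfK // pnatr_eq0.
by rewrite mul0rn nth_default.
Qed.

(** An antiderivative is nondecreasing on the interval with equal end values, hence constant there,
    hence constant as a polynomial. *)
Lemma poly_integral_eq0 (G : {poly R}) s : 0 < s ->
  (forall t, 0 <= t -> t <= s -> 0 <= G.[t]) ->
  Rintegral (@lebesgue_measure R) [set` `[0, s]] (fun t => G.[t]) = 0 -> G = 0.
Proof.
have [Q <-] := poly_antideriv G; move=> s0 G0.
rewrite Rintegral_deriv_poly ?ltW // => /eqP; rewrite subr_eq0 => /eqP h.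
have hI a b : 0 <= a -> b <= s -> a <= b -> Q.[a] <= Q.[b].
  move=> a0 bs ab; rewrite -subr_ge0 -Rintegral_deriv_poly //.
  apply: Rintegral_ge0 => x /=; rewrite in_itv /= => /andP [h1 h2].
  by apply: G0; [apply: le_trans h1 | apply: le_trans bs].
have Q0 t : 0 < t -> t < s -> (Q - (Q.[0])%:P).[t] = 0.
  move=> t0 ts; rewrite hornerD hornerN hornerC; apply/eqP; rewrite subr_eq0.
  rewrite eq_le -{1}h !hI //; exact: ltW.
have /eqP := poly_eq0_near0 s0 Q0; rewrite subr_eq0 => /eqP ->.
by rewrite derivC.
Qed.

(** The Beta integral, by induction on [N]: integration by parts trades a factor [s - X] for a
    factor [X]. An explicit antiderivative keeps the computation inside polynomials. *)
Lemma beta_antideriv s b N : exists2 Q : {poly R},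
  Q^`() = 'X^b * (s%:P - 'X) ^+ N &
  Q.[s] - Q.[0] = b`!%:R * N`!%:R / (b + N).+1`!%:R * s ^+ (b + N).+1.
Proof.
have nz n : n.+1%:R != 0 :> R by rewrite pnatr_eq0.
have fz n : n`!%:R != 0 :> R by rewrite pnatr_eq0 -lt0n fact_gt0.
elim: N b => [|N IH] b.
  exists (b.+1%:R^-1 *: 'X ^+ b.+1).
    by rewrite derivZ derivXn /= -(scaler_nat _ ('X ^+ _)) scalerA mulVf ?scale1r ?expr0 ?mulr1.
  rewrite !hornerZ !hornerXn expr0n mulr0 subr0 addn0 factS natrM fact0 mulr1.
  by field; rewrite fz addrC natr1 nz.
have [Q hQ1 hQ2] := IH b.+1.
exists (b.+1%:R^-1 *: ('X ^+ b.+1 * (s%:P - 'X) ^+ N.+1) + (N.+1%:R / b.+1%:R) *: Q).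
  rewrite derivD !derivZ hQ1 derivM derivXn /= deriv_exp derivB derivC derivX /=.
  rewrite sub0r -(mulr_natr ('X ^+ b)) -(mulr_natr (-1 * _)) -!polyC_natr -!mul_polyC.
  have e : (b.+1%:R^-1)%:P * (b.+1%:R)%:P = 1 :> {poly R} by rewrite -polyCM mulVf.
  rewrite polyCM !exprS; move: e; set c := (_^-1)%:P; set c' := (_)%:P => e.
 transitivity (c * c' * ('X^b * ((s%:P - 'X) * (s%:P - 'X) ^+ N))); last by rewrite e mul1r.
  ring.
rewrite !hornerD !hornerZ !hornerM !hornerXn !horner_exp !hornerD !hornerN !hornerX !hornerC.
rewrite subrr [0 ^+ N.+1]exprS [0 ^+ b.+1]exprS !mul0r !mulr0 !add0r -mulrBr hQ2 addnS addSn.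
rewrite (factS b) (factS N) (natrM _ b.+1) (natrM _ N.+1).
move: (nz b) (nz N) (fz b) (fz N) (fz (b + N).+2).
move: (b.+1%:R) (N.+1%:R) (b`!%:R) (N`!%:R) (((b + N).+2)`!%:R) => x1 x2 x3 x4 x5 *.
by field; apply/andP.
Qed.

(* The factor [(s - \sum_j y_j) ^+ a] makes the family stable under the slicing
   by which [corner_int] is defined. *)
Definition corner_monom m (s : R) (a : nat) (b : nat -> nat) (y : 'cV[R]_m) : R :=
  (s - \sum_j y j 0) ^+ a * \prod_(j < m) y j 0 ^+ b j.

(** Dirichlet's value of the integral of [corner_monom 1 a b] over the unit corner simplex. *)
Definition dirichlet m (a : nat) (b : nat -> nat) : R :=
  a`!%:R * \prod_(j < m) (b j)`!%:R / (a + \sum_(j < m) b j + m)`!%:R.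

Lemma col_mx_ord0 m (t : R) (y : 'cV[R]_m) : col_mx (t%:M : 'cV_1) y ord0 0 = t.
Proof.
rewrite (_ : ord0 = lshift m (ord0 : 'I_1)); last exact: val_inj.
by rewrite col_mxEu mxE eqxx mulr1n.
Qed.

Lemma col_mx_lift m (t : R) (y : 'cV[R]_m) j :
  col_mx (t%:M : 'cV_1) y (lift ord0 j) 0 = y j 0.
Proof.
rewrite (_ : lift ord0 j = rshift 1 j); last exact: val_inj.
by rewrite col_mxEd.
Qed.

Lemma corner_monom_col m (s t : R) a b (y : 'cV[R]_m) :
  corner_monom s a b (col_mx (t%:M : 'cV_1) y : 'cV_m.+1) =
  t ^+ b 0%N * corner_monom (s - t) a (b \o succn) y.
Proof.
rewrite /corner_monom !big_ord_recl col_mx_ord0.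
under eq_bigr => j _ do rewrite col_mx_lift.
under [X in _ * (_ * X)]eq_bigr => j _ do rewrite col_mx_lift.
by rewrite opprD addrA mulrCA.
Qed.

(** The entries of [T] are a coefficient, the exponent [a] and the exponents [b]. Lists let slicing
    act termwise, and exponents indexed by [nat] make it a mere shift. *)
Definition corner_poly m (s : R) (T : seq (R * nat * (nat -> nat))) (y : 'cV[R]_m) :=
  \sum_(k <- T) k.1.1 * corner_monom s k.1.2 k.2 y.

Definition corner_slice (t : R) (T : seq (R * nat * (nat -> nat))) :=
  [seq (k.1.1 * t ^+ k.2 0%N, k.1.2, k.2 \o succn) | k <- T].

Lemma corner_poly_col m s t T (y : 'cV[R]_m) :
  corner_poly s T (col_mx (t%:M : 'cV_1) y : 'cV_m.+1) = corner_poly (s - t) (corner_slice t T) y.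
Proof.
rewrite /corner_poly big_map; apply: eq_bigr => k _ /=.
by rewrite corner_monom_col mulrA.
Qed.

Definition corner_value m s (T : seq (R * nat * (nat -> nat))) : R :=
  \sum_(k <- T) k.1.1 * dirichlet m k.1.2 k.2 *
     s ^+ (k.1.2 + \sum_(j < m) k.2 j + m).

Lemma corner_value_slice m s T : exists G : {poly R}, forall t,
  corner_value m (s - t) (corner_slice t T) = G.[t].
Proof.
exists (\sum_(k <- T) (k.1.1 * dirichlet m k.1.2 (k.2 \o succn)) *:
  ('X ^+ k.2 0%N * (s%:P - 'X) ^+ (k.1.2 + \sum_(j < m) k.2 j.+1 + m))) => t.
rewrite /corner_value big_map horner_sum; apply: eq_bigr => k _ /=.
rewrite hornerZ hornerM hornerXn horner_exp hornerD hornerN hornerX hornerC; ring.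
Qed.

(** The induction step of Dirichlet's formula: each term of the slice contributes one Beta
    integral. *)
Lemma corner_value_int m s T : 0 <= s ->
  Rintegral (@lebesgue_measure R) [set` `[0, s]]
    (fun t => corner_value m (s - t) (corner_slice t T)) = corner_value m.+1 s T.
Proof.
move=> s0.
have [Q hQ1 hQ2] : exists2 Q : {poly R},
    forall t, Q^`().[t] = corner_value m (s - t) (corner_slice t T) &
    Q.[s] - Q.[0] = corner_value m.+1 s T.
  elim: T => [|k T [Q hQ1 hQ2]].
    by exists 0 => [t|]; rewrite /corner_value /= ?big_nil ?deriv0 !horner0 ?subrr.
  set N := (k.1.2 + \sum_(j < m) k.2 j.+1 + m)%N.
  have [B hB1 hB2] := beta_antideriv s (k.2 0%N) N.
  exists ((k.1.1 * dirichlet m k.1.2 (k.2 \o succn)) *: B + Q) => [t|].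
    rewrite derivD derivZ hornerD hornerZ hQ1 hB1 /corner_value /= big_cons /= -/N.
    congr (_ + _); rewrite hornerM hornerXn horner_exp hornerD hornerN hornerX hornerC.
    ring.
  rewrite !hornerD !hornerZ opprD addrACA -mulrBr hB2 hQ2 /corner_value big_cons.
  congr (_ + _).
  rewrite /dirichlet !big_ord_recl /=.
  have -> : (k.1.2 + (k.2 0 + \sum_(i < m) k.2 (bump 0 i)) + m.+1 = (k.2 0 + N).+1)%N.
    by rewrite /N; under eq_bigr do rewrite /bump /= add1n; lia.
  under [X in _ = _ * (_ * (_ * X) / _) * _]eq_bigr do rewrite /bump /= add1n.
  rewrite -/N; have fz n : n`!%:R != 0 :> R by rewrite pnatr_eq0 -lt0n fact_gt0.
  move: (fz N) (fz (k.2 0%N + N).+1) => f1 f2.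
  by field; apply/andP.
under [LHS]eq_Rintegral => t _ do rewrite -hQ1.
by rewrite Rintegral_deriv_poly.
Qed.

Lemma corner_int_poly m s T (f : 'cV[R]_m -> R) : 0 <= s ->
  (forall y, f y = corner_poly s T y) -> corner_int s f = corner_value m s T.
Proof.
elim: m s T f => [|m IH] s T f s0 hf.
  rewrite /= hf; apply: eq_bigr => k _.
  rewrite /corner_monom /dirichlet !big_ord0 !addn0 subr0 !mulr1 mulfV ?mulr1 //.
rewrite -corner_value_int //=; apply: eq_Rintegral => t.
rewrite inE /= in_itv /= => /andP [t0 ts].
by apply: IH => [|y]; rewrite ?subr_ge0 // hf corner_poly_col.
Qed.

Lemma corner_int_ge0 m s (f : 'cV[R]_m -> R) : 0 <= s ->
  (forall y : 'cV[R]_m, (forall j, 0 <= y j 0) -> \sum_j y j 0 <= s -> 0 <= f y) ->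
  0 <= corner_int s f.
Proof.
elim: m s f => [|m IH] s f s0 hf.
  by apply: hf => [[]//|]; rewrite big_ord0.
apply: Rintegral_ge0 => t /=; rewrite in_itv /= => /andP [t0 ts].
apply: IH => [|y y0 ys]; first by rewrite subr_ge0.
apply: hf => [j|].
  by case: (unliftP ord0 j) => [j' ->|->]; rewrite ?col_mx_lift ?col_mx_ord0.
rewrite big_ord_recl col_mx_ord0.
by under eq_bigr do rewrite col_mx_lift; rewrite addrC -lerBrDr.
Qed.

(** The integral over a slice is a nonnegative polynomial in its position [t]; as its own integral
    is zero it vanishes for every [t], not merely almost every one, and induction applies to each
    slice. *)
Lemma corner_int_eq0 m s T (f : 'cV[R]_m -> R) : 0 < s ->
  (forall y, f y = corner_poly s T y) ->
  (forall y : 'cV[R]_m, (forall j, 0 <= y j 0) -> \sum_j y j 0 <= s -> 0 <= f y) ->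
  corner_int s f = 0 ->
  forall y : 'cV[R]_m, (forall j, 0 < y j 0) -> \sum_j y j 0 < s -> f y = 0.
Proof.
elim: m s T f => [|m IH] s T f s0 hf f0 hI y y0 ys.
  rewrite -hI /=; congr f; apply/matrixP; case=> //.
have hslice t (z : 'cV[R]_m) : 0 <= t -> t <= s -> (forall j, 0 <= z j 0) ->
    \sum_j z j 0 <= s - t -> 0 <= f (col_mx (t%:M : 'cV_1) z).
  move=> t0 ts z0 zs; apply: f0 => [j|].
    by case: (unliftP ord0 j) => [j' ->|->]; rewrite ?col_mx_lift ?col_mx_ord0.
  rewrite big_ord_recl col_mx_ord0.
  by under eq_bigr do rewrite col_mx_lift; rewrite addrC -lerBrDr.
have [G hG] := corner_value_slice m s T.
have hGi t : 0 <= t -> t <= s ->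
    corner_int (s - t) (fun z : 'cV[R]_m => f (col_mx (t%:M : 'cV_1) z)) = G.[t].
  move=> t0 ts; rewrite -hG; apply: corner_int_poly => [|z]; first by rewrite subr_ge0.
  by rewrite hf corner_poly_col.
have G0 : G = 0.
  apply: (poly_integral_eq0 s0) => [t t0 ts|].
    rewrite -hGi //; apply: corner_int_ge0 => [|z z0 zs]; first by rewrite subr_ge0.
    exact: hslice.
  rewrite -[RHS]hI /=; apply: eq_Rintegral => t.
  by rewrite inE /= in_itv /= => /andP [t0 ts]; rewrite hGi.
pose t := y ord0 0; pose z : 'cV[R]_m := \col_j y (lift ord0 j) 0.
have ey : y = (col_mx (t%:M : 'cV_1) z : 'cV_m.+1).
  apply/matrixP => j j'; rewrite (ord1 j').
  by case: (unliftP ord0 j) => [j'' ->|->]; rewrite ?col_mx_lift ?col_mx_ord0 ?mxE.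
have zs : \sum_j z j 0 < s - t.
  rewrite ltrBrDl; apply: le_lt_trans ys; rewrite [leRHS]big_ord_recl.
  by under eq_bigr do rewrite mxE.
have z0 j : 0 < z j 0 by rewrite mxE.
have t0 : 0 < t by apply: y0.
have ts : t < s.
  by rewrite -subr_gt0; apply: le_lt_trans zs; apply: sumr_ge0 => j _; apply: ltW.
rewrite ey.
apply: (IH (s - t) (corner_slice t T) (fun z => f (col_mx (t%:M : 'cV_1) z))) => //.
- by rewrite subr_gt0.
- by move=> w; rewrite hf corner_poly_col.
- by move=> w w0 ws; apply: hslice => //; apply: ltW.
- by rewrite hGi ?G0 ?horner0 //; apply: ltW.
Qed.

End Corner.

(** * Integration in barycentric coordinates *)

Section BaryInt.
Variables (R : realType) (n : nat).
Implicit Types (A : {set 'I_n}) (G : {mpoly R[n]}).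

(* Normalised integral of a monomial in barycentric coordinates over the
   subsimplex with vertex set [A], by Dirichlet's formula; monomials involving a
   vertex outside [A] vanish there. *)
Definition msupp_in A (m : 'X_{1..n}) := [forall i, (i \notin A) ==> (m i == 0%N)].

Definition mono_int A (m : 'X_{1..n}) : R :=
  if msupp_in A m then (\prod_i (m i)`!)%:R / (mdeg m + #|A|.-1)`!%:R else 0.

Definition bary_int A G : R := \sum_(m <- msupp G) G@_m * mono_int A m.

Lemma bary_intwE A G k : (msize G <= k)%N ->
  bary_int A G = \sum_(m : 'X_{1..n < k}) G@_m * mono_int A m.
Proof.
move=> lt_pk; rewrite /bary_int (big_mksub 'X_{1..n < k}) ?msupp_uniq //=; first last.
  by move=> x /msize_mdeg_lt /leq_trans; apply.
by rewrite big_rmcond //= => i /memN_msupp_eq0 ->; rewrite mul0r.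
Qed.

Lemma bary_int_is_linear A : linear_for *%R (bary_int A).
Proof.
move=> c p q; pose k := maxn (msize p) (msize q).
rewrite !(@bary_intwE A _ k) ?leq_maxl ?leq_maxr //; last first.
  by rewrite msizeD_leq ?msizeZ_leq ?leq_maxl ?leq_maxr.
rewrite mulr_sumr -big_split /=; apply: eq_bigr => m _.
by rewrite mcoeffD mcoeffZ mulrDl mulrA.
Qed.

HB.instance Definition _ A :=
  GRing.isLinear.Build R {mpoly R[n]} R *%R (bary_int A) (bary_int_is_linear A).

Lemma bary_intX A m : bary_int A 'X_[m] = mono_int A m.
Proof. by rewrite /bary_int msuppX big_seq1 mcoeffX eqxx mul1r. Qed.

(* The derivative in the direction of one vertex differs from minus the integral
   over the opposite face by a quantity that does not depend on the vertex. *)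
Lemma mono_int_deriv A i m : i \in A -> (1 < #|A|)%N ->
  bary_int A 'X_[m]^`M(i) + bary_int (A :\ i) 'X_[m] =
  if msupp_in A m then (\prod_i (m i)`!)%:R / (mdeg m + #|A|.-2)`!%:R else 0.
Proof.
move=> iA hA; rewrite mderivX linearZ /= !bary_intX.
have cA : #|A| = #|A :\ i|.+1 by rewrite (cardsD1 i) iA.
case: (posnP (m i)) => [mi0|mi0].
  rewrite mi0 mul0r add0r /mono_int cA /=.
  have -> // : msupp_in (A :\ i) m = msupp_in A m.
  apply: eq_forallb => j; rewrite !inE negb_and negbK.
  by case: eqVneq => [->|] //=; rewrite mi0 eqxx implybT.
have em : m = (U_(i) + (m - U_(i)))%MM by rewrite addmC submK // lep1mP -lt0n.
have -> : mono_int (A :\ i) m = 0.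
  rewrite /mono_int ifN //; apply/forallP => /(_ i).
  by rewrite !inE eqxx /= => /eqP h; rewrite h in mi0.
rewrite addr0 /mono_int.
have -> : msupp_in A (m - U_(i))%MM = msupp_in A m.
  apply: eq_forallb => j; rewrite mnmBE mnm1E.
  by case: (eqVneq i j) => [<-|_]; rewrite ?iA /= ?subn0.
case: ifP => _; last by rewrite mulr0.
have -> : (mdeg (m - U_(i))%MM + #|A|.-1 = mdeg m + #|A|.-2)%N.
  by rewrite {2}em mdegD mdeg1; lia.
rewrite mulrA -natrM; congr (_%:R / _).
rewrite (bigD1 i) //= [RHS](bigD1 i) //= mulnA; congr (_ * _)%N.
  rewrite mnmBE mnm1E eqxx /= subn1; case: (m i) mi0 => // a _.
apply: eq_bigr => j ji; rewrite mnmBE mnm1E eq_sym (negPf ji) subn0 //.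
Qed.

Lemma linear_mpoly_ext (f g : {mpoly R[n]} -> R) :
  linear_for *%R f -> linear_for *%R g -> (forall m, f 'X_[m] = g 'X_[m]) -> f =1 g.
Proof.
move=> lf lg h G.
have f0 (u : {mpoly R[n]} -> R) : linear_for *%R u -> u 0 = 0.
  by move=> lu; have /eqP := lu 1 0 0; rewrite scaler0 addr0 mul1r -subr_eq0 opprD addNKr oppr_eq0 => /eqP.
rewrite [G]mpolyE; elim: (msupp G) => [|m s IH]; first by rewrite big_nil !f0.
by rewrite big_cons lf lg IH h.
Qed.

(** Stokes' formula for the direction of an edge, which is tangent to all facets but the two
    opposite to its end points. *)
Lemma bary_int_stokes A i j G : i \in A -> j \in A -> (1 < #|A|)%N ->
  bary_int A (G^`M(i) - G^`M(j)) = bary_int (A :\ j) G - bary_int (A :\ i) G.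
Proof.
move=> iA jA hA; apply/eqP; rewrite raddfB /= subr_eq addrAC -subr_eq opprK.
apply/eqP; move: G.
apply: linear_mpoly_ext => [c p q|c p q|m].
- by rewrite mderivD mderivZ !linearD !linearZ /=; ring.
- by rewrite mderivD mderivZ !linearD !linearZ /=; ring.
- by rewrite mono_int_deriv // addrC mono_int_deriv.
Qed.

Section Corner.
Variables (l : nat) (sigma : 'I_l.+1 -> 'I_n).
Hypothesis sigma_inj : injective sigma.

Definition corner_coord (y : 'cV[R]_l) (j : 'I_l.+1) : R :=
  if unlift ord0 j is Some j' then y j' 0 else 1 - \sum_i y i 0.

Definition corner_pt (y : 'cV[R]_l) : 'cV[R]_n :=
  \col_i \sum_(j | sigma j == i) corner_coord y j.

Lemma corner_pt_in y j : corner_pt y (sigma j) 0 = corner_coord y j.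
Proof.
by rewrite mxE (bigD1 j) //= big1 ?addr0 // => j' /andP [/eqP /sigma_inj ->]; rewrite eqxx.
Qed.

Lemma corner_pt_out y i : i \notin sigma @: setT -> corner_pt y i 0 = 0.
Proof.
move=> hi; rewrite mxE big1 // => j /eqP e; move: hi; rewrite -e.
by rewrite imset_f // inE.
Qed.

Lemma sum_corner_pt y : \sum_i corner_pt y i 0 = 1.
Proof.
under eq_bigr do rewrite mxE.
rewrite (exchange_big_dep predT) //=.
under eq_bigr => j _ do under eq_bigl => i do rewrite eq_sym.
under eq_bigr => j _ do rewrite big_pred1_eq.
rewrite big_ord_recl {1}/corner_coord unlift_none.
under [X in _ + X]eq_bigr do rewrite /corner_coord liftK.
by rewrite subrK.
Qed.

Lemma corner_coordK (la : 'I_n -> R) :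
  (forall i, i \notin sigma @: setT -> la i = 0) -> \sum_i la i = 1 ->
  corner_pt (\col_j la (sigma (lift ord0 j))) = \col_i la i.
Proof.
move=> l0 l1; apply/matrixP => i j; rewrite (ord1 j) [RHS]mxE.
have [/imsetP [r _ ->]|ni] := boolP (i \in sigma @: setT); last by rewrite corner_pt_out // l0.
rewrite corner_pt_in /corner_coord; case: unliftP => [r' ->|->]; first by rewrite mxE.
under eq_bigr do rewrite mxE.
apply/eqP; rewrite subr_eq eq_sym -l1 -(big_ord_recl _ (fun j => la (sigma j))) (bigID (mem (sigma @: setT))) /=.
rewrite [X in _ + X]big1 ?addr0 ?big_imset //=; last by move=> x y _ _; apply: sigma_inj.
by apply/eqP; apply: eq_bigl => x; rewrite inE.
Qed.

Lemma card_corner : #|sigma @: setT| = l.+1.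
Proof. by rewrite card_imset // cardsT card_ord. Qed.

Lemma corner_pt_poly (G : {mpoly R[n]}) :
  exists2 T, forall y, peval (corner_pt y) G = corner_poly 1 T y &
    corner_value l 1 T = bary_int (sigma @: setT) G.
Proof.
pose A := sigma @: setT.
(* A monomial with an exponent outside [A] vanishes at every [corner_pt]; it gets coefficient zero,
   in agreement with [mono_int]. *)
pose T := [seq (if msupp_in A m then G@_m else 0, m (sigma ord0),
  fun j => m (sigma (inord j.+1))) | m <- msupp G].
have eS (m : 'X_{1..n}) (j : 'I_l) : m (sigma (inord j.+1)) = m (sigma (lift ord0 j)).
  by congr (m (sigma _)); apply/val_inj; rewrite /= inordK // ltnS.
have hA (m : 'X_{1..n}) i : msupp_in A m -> i \notin A -> m i = 0%N.
  by move=> /forallP /(_ i) /implyP h /h /eqP.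
exists T => [y|].
  rewrite /peval mevalE /corner_poly /T [RHS]big_map; apply: eq_bigr => m _ /=.
  case: ifP => hm; last first.
    rewrite mul0r; move: hm => /negbT; rewrite negb_forall => /existsP [i].
    rewrite negb_imply => /andP [iA mi]; rewrite (bigD1 i) //=.
    by rewrite corner_pt_out // expr0n (negPf mi) mul0r mulr0.
  congr (_ * _); rewrite (bigID (mem A)) /= [X in _ * X]big1 ?mulr1; last first.
    by move=> i iA; rewrite hA.
  rewrite big_imset /=; last by move=> x z _ _; apply: sigma_inj.
  rewrite (eq_bigl xpredT) => [|x]; last by rewrite inE.
  rewrite big_ord_recl corner_pt_in /corner_coord unlift_none /corner_monom.
  congr (_ * _); apply: eq_bigr => j _.
  by rewrite corner_pt_in /corner_coord liftK eS.
rewrite /corner_value /bary_int /T [LHS]big_map; apply: eq_bigr => m _ /=.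
rewrite expr1n mulr1 /mono_int -/A; case: ifP => hm; last by rewrite mul0r mulr0.
congr (_ * _); rewrite /dirichlet /A card_corner /= -/A.
have -> : mdeg m = (m (sigma ord0) + \sum_(j < l) m (sigma (inord j.+1)))%N.
  rewrite mdegE (bigID (mem A)) /= [X in (_ + X)%N]big1 ?addn0; last by move=> i; apply: hA.
  rewrite big_imset /=; last by move=> x z _ _; apply: sigma_inj.
  rewrite (eq_bigl xpredT) => [|x]; last by rewrite inE.
  by rewrite big_ord_recl; congr (_ + _)%N; apply: eq_bigr => j _; rewrite eS.
congr (_ / _); rewrite -natr_prod -natrM; congr (_%:R).
rewrite [RHS](bigID (mem A)) /= [X in _ = (_ * X)%N]big1 ?muln1; last first.
  by move=> i iA; rewrite hA.
rewrite [RHS]big_imset /=; last by move=> x z _ _; apply: sigma_inj.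
rewrite [RHS](eq_bigl xpredT) => [|x]; last by rewrite inE.
by rewrite big_ord_recl; congr (_ * _)%N; apply: eq_bigr => j _; rewrite eS.
Qed.

Lemma corner_int_bary (G : {mpoly R[n]}) h :
  (forall y, h y = peval (corner_pt y) G) -> corner_int 1 h = bary_int (sigma @: setT) G.
Proof.
move=> hh; have [T hT <-] := corner_pt_poly G.
by apply: corner_int_poly => // y; rewrite hh.
Qed.

End Corner.

Lemma enum_param A l : #|A| = l.+1 ->
  exists2 sigma : 'I_l.+1 -> 'I_n, injective sigma & sigma @: setT = A.
Proof.
move=> h; exists (fun j => enum_val (cast_ord (esym h) j)).
  by move=> i j /enum_val_inj /cast_ord_inj.
apply/setP => i; apply/imsetP/idP => [[j _ ->]|iA]; first exact: enum_valP.
by exists (cast_ord h (enum_rank_in iA i)); rewrite ?cast_ordK ?enum_rankK_in.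
Qed.

(** [bary_int] is a formal sum over coefficients; realising it as an integral shows that it depends
    only on values on the hull of [A]. *)
Lemma bary_int_vanish A G : (0 < #|A|)%N ->
  (forall la : 'I_n -> R, (forall i, i \notin A -> la i = 0) -> \sum_i la i = 1 ->
     peval (\col_i la i) G = 0) -> bary_int A G = 0.
Proof.
move=> cA hG; have [sigma si e] := @enum_param A #|A|.-1 (esym (prednK cA)).
rewrite -e -(@corner_int_bary _ _ si G (fun=> 0)) => [|y].
  rewrite (@corner_int_poly R _ 1 [::]) ?ler01 // ?/corner_value ?big_nil // => y.
  by rewrite /corner_poly big_nil.
rewrite -(hG (fun i => corner_pt sigma y i 0)) //.
- by congr peval; apply/matrixP => i j; rewrite (ord1 j) mxE.
- by move=> i iA; apply: corner_pt_out; rewrite e.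
- exact: sum_corner_pt.
Qed.

Lemma bary_int_eq0 A G : (0 < #|A|)%N ->
  (forall la : 'I_n -> R, (forall i, i \notin A -> la i = 0) -> \sum_i la i = 1 ->
     (forall i, 0 <= la i) -> 0 <= peval (\col_i la i) G) -> bary_int A G = 0 ->
  forall la : 'I_n -> R, (forall i, i \notin A -> la i = 0) -> \sum_i la i = 1 ->
     (forall i, i \in A -> 0 < la i) -> peval (\col_i la i) G = 0.
Proof.
move=> cA hG; have [sigma si e] := @enum_param A #|A|.-1 (esym (prednK cA)).
rewrite -e => hI la la0 la1 lap.
rewrite -(corner_coordK si la0 la1).
have [T hT hV] := corner_pt_poly si G.
have inA j : sigma j \in sigma @: setT by rewrite imset_f // inE.
apply: (@corner_int_eq0 R _ 1 T (fun y => peval (corner_pt sigma y) G)) => //.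
- move=> y y0 ys; have -> : corner_pt sigma y = \col_i (fun i => corner_pt sigma y i 0) i.
    by apply/matrixP => i j; rewrite (ord1 j) [RHS]mxE.
  apply: hG => [i iA||i]; first by apply: corner_pt_out; rewrite e.
    exact: sum_corner_pt.
  have [/imsetP [r _ ->]|ni] := boolP (i \in sigma @: setT); last by rewrite corner_pt_out.
  rewrite corner_pt_in // /corner_coord; case: unliftP => [r' _|_] //.
  by rewrite subr_ge0.
- by rewrite (corner_int_bary si (G := G)).
- by move=> j; rewrite mxE; apply: lap.
- under eq_bigr do rewrite mxE.
  rewrite -la1 (bigID (mem (sigma @: setT))) /= [X in _ < _ + X]big1 ?addr0 => [|i]; last exact: la0.
  rewrite big_imset /=; last by move=> x z _ _; apply: si.
  rewrite [ltRHS](eq_bigl xpredT) => [|x]; last by rewrite inE.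
  by rewrite [ltRHS]big_ord_recl ltrDr lap.
Qed.

End BaryInt.

(** * Unisolvence on a simplex *)

Lemma dotE (A : pzSemiRingType) n (u v : 'cV[A]_n) : dot u v = \sum_i u i 0 * v i 0.
Proof. by rewrite /dot mxE; apply: eq_bigr => i _; rewrite mxE. Qed.

Lemma dotC (A : comPzRingType) n (u v : 'cV[A]_n) : dot u v = dot v u.
Proof. by rewrite !dotE; apply: eq_bigr => i _; rewrite mulrC. Qed.

Lemma dotDr (A : pzRingType) n (u v w : 'cV[A]_n) : dot u (v + w) = dot u v + dot u w.
Proof. by rewrite /dot mulmxDr mxE. Qed.

Lemma dotBr (A : pzRingType) n (u v w : 'cV[A]_n) : dot u (v - w) = dot u v - dot u w.
Proof. by rewrite /dot mulmxBr !mxE. Qed.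

Lemma dotZr (A : comPzRingType) n c (u v : 'cV[A]_n) : dot u (c *: v) = c * dot u v.
Proof. by rewrite /dot -scalemxAr mxE. Qed.

Lemma dotZl (A : pzRingType) n c (u v : 'cV[A]_n) : dot (c *: u) v = c * dot u v.
Proof. by rewrite !dotE mulr_sumr; apply: eq_bigr => i _; rewrite mxE mulrA. Qed.

Lemma dot_sumr (A : pzRingType) n (I : Type) (r : seq I) (P : pred I) (u : 'cV[A]_n)
  (F : I -> 'cV[A]_n) : dot u (\sum_(i <- r | P i) F i) = \sum_(i <- r | P i) dot u (F i).
Proof. by rewrite /dot mulmx_sumr summxE. Qed.

Lemma dot_suml (A : pzRingType) n (I : Type) (r : seq I) (P : pred I) (u : 'cV[A]_n)
  (F : I -> 'cV[A]_n) : dot (\sum_(i <- r | P i) F i) u = \sum_(i <- r | P i) dot (F i) u.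
Proof. by rewrite /dot linear_sum /= mulmx_suml summxE. Qed.

Lemma dot_mulmx (A : comPzRingType) n m (M : 'M[A]_(n, m)) (u : 'cV[A]_n) (v : 'cV[A]_m) :
  dot u (M *m v) = dot (M^T *m u) v.
Proof. by rewrite /dot trmx_mul trmxK mulmxA. Qed.

Section Simplex.
(* [g i] is the gradient of the [i]-th barycentric coordinate [lam i]. *)
Variables (R : realType) (d : nat) (p g : 'I_d.+1 -> 'cV[R]_d).
Hypothesis hg : forall i j l, dot (g i) (p j - p l) = (i == j)%:R - (i == l)%:R.
Hypothesis hgs : \sum_i g i = 0.
Hypothesis hge : forall l v, v = \sum_i dot (g i) v *: (p i - p l).
Implicit Types (A : {set 'I_d.+1}) (f h : {mpoly R[d]}) (v w : 'cV[{mpoly R[d]}]_d).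
Implicit Types (la : 'I_d.+1 -> R).

Local Notation C := (constp d).

(** The barycentric parametrisation in [d + 1] free variables; the constraint that they sum to one
    is imposed only on evaluation. *)
Definition bary_poly : 'cV[{mpoly R[d.+1]}]_d := \sum_i 'X_i *: constp d.+1 (p i).

Definition face_int A f : R := bary_int A (psubst bary_poly f).

Definition bary la : 'cV[R]_d := \sum_i la i *: p i.

Definition affine_coord A la := (forall i, i \notin A -> la i = 0) /\ \sum_i la i = 1.

(** The coordinates may be negative: this is vanishing on the affine hull of the face. *)
Definition vanish A f := forall la, affine_coord A la -> peval (bary la) f = 0.

Lemma peval_bary_poly la f : peval (\col_i la i) (psubst bary_poly f) = peval (bary la) f.
Proof.
rewrite peval_psubst; congr peval; apply/matrixP => i j; rewrite (ord1 j) !mxE !summxE raddf_sum /=.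
by apply: eq_bigr => r _; rewrite !mxE rmorphM /= pevalXU pevalC mxE.
Qed.

Lemma face_int_is_linear A : linear_for *%R (face_int A).
Proof. by move=> c q r; rewrite /face_int rmorphD /= psubstZ linearD linearZ. Qed.

HB.instance Definition _ A :=
  GRing.isLinear.Build R {mpoly R[d]} R *%R (face_int A) (face_int_is_linear A).

Lemma face_int_vanish A f : (0 < #|A|)%N -> vanish A f -> face_int A f = 0.
Proof.
move=> cA hf; apply: bary_int_vanish => // la l0 l1.
by rewrite peval_bary_poly hf.
Qed.

Lemma face_int_eq A f h : (0 < #|A|)%N -> vanish A (f - h) -> face_int A f = face_int A h.
Proof. by move=> cA /(face_int_vanish cA) /eqP; rewrite raddfB /= subr_eq0 => /eqP. Qed.

Lemma face_int_eq0 A f : (0 < #|A|)%N ->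
  (forall la, affine_coord A la -> (forall i, 0 <= la i) -> 0 <= peval (bary la) f) ->
  face_int A f = 0 ->
  forall la, affine_coord A la -> (forall i, i \in A -> 0 < la i) -> peval (bary la) f = 0.
Proof.
move=> cA hf hI la [l0 l1] lp; rewrite -peval_bary_poly.
apply: (bary_int_eq0 cA _ hI) => // mu m0 m1 mp; rewrite peval_bary_poly.
exact: hf.
Qed.

Lemma vanishD A f h : vanish A f -> vanish A h -> vanish A (f + h).
Proof. by move=> hf hh la hl; rewrite rmorphD /= hf ?hh ?addr0. Qed.

Lemma vanish0 A : vanish A 0.
Proof. by move=> la _; rewrite rmorph0. Qed.

Lemma vanishMl A f h : vanish A f -> vanish A (h * f).
Proof. by move=> hf la hl; rewrite rmorphM /= hf ?mulr0. Qed.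

Lemma vanishMr A f h : vanish A f -> vanish A (f * h).
Proof. by rewrite mulrC; apply: vanishMl. Qed.

Lemma vanishN A f : vanish A f -> vanish A (- f).
Proof. by move=> hf la hl; rewrite rmorphN /= hf ?oppr0. Qed.

Lemma vanishB A f h : vanish A f -> vanish A h -> vanish A (f - h).
Proof. by move=> hf hh; apply: vanishD => //; apply: vanishN. Qed.

Lemma vanishS A (B : {set 'I_d.+1}) f : A \subset B -> vanish B f -> vanish A f.
Proof.
move=> sAB hf la [l0 l1]; apply: hf; split=> // i iB; apply: l0.
by apply: contra iB; apply: subsetP.
Qed.

Lemma vanish_sum A (I : Type) (r : seq I) (P : pred I) (F : I -> {mpoly R[d]}) :
  (forall i, P i -> vanish A (F i)) -> vanish A (\sum_(i <- r | P i) F i).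
Proof. by move=> hF; elim/big_rec: _ => [|i x Pi hx]; [apply: vanish0 | apply: vanishD; auto]. Qed.

(* Restrict [f] to the line through the barycenter and a given point. *)
Lemma vanish_interior A f : (0 < #|A|)%N ->
  (forall la, affine_coord A la -> (forall i, i \in A -> 0 < la i) -> peval (bary la) f = 0) ->
  vanish A f.
Proof.
move=> cA hf la [l0 l1].
pose mu i : R := if i \in A then #|A|%:R^-1 else 0.
have cA0 : 0 < #|A|%:R :> R by rewrite ltr0n.
have m1 : \sum_i mu i = 1.
  rewrite -big_mkcond /= sumr_const -[RHS](mulfV (lt0r_neq0 cA0)) mulr_natl.
  by [].
have [G hG] := peval_line (bary mu) (bary la - bary mu) f.
(* [M] bounds all [- la i], so for [s < e] every coordinate in [A] of the point at parameter [s]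
   exceeds [1/#|A| - s (M + 1/#|A|) > 0]. *)
pose M := 1 + \sum_i `|la i|.
have M0 : 0 < M by rewrite ltr_wpDr // sumr_ge0.
pose e := #|A|%:R^-1 / (M + #|A|%:R^-1).
have iA0 : 0 < #|A|%:R^-1 :> R by rewrite invr_gt0.
have MA0 : 0 < M + #|A|%:R^-1 by rewrite addr_gt0.
have e0 : 0 < e by rewrite divr_gt0.
have lb i : - M < la i.
  rewrite ltrNl; apply: le_lt_trans (ler_norm _) _; rewrite normrN /M (bigD1 i) //=.
  rewrite addrCA ltrDl; apply: ltr_wpDr => //; exact: sumr_ge0.
have G0 : G = 0.
  apply: (poly_eq0_near0 e0) => s s0 se; rewrite (hG s).1.
  have -> : bary mu + s *: (bary la - bary mu) = bary (fun i => mu i + s * (la i - mu i)).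
    rewrite /bary -sumrB scaler_sumr -big_split /=; apply: eq_bigr => i _.
    by rewrite scalerDl -scalerBl scalerA.
  apply: hf => [|i iA].
    split=> [i iA|]; first by rewrite l0 // /mu (negPf iA) subrr mulr0 addr0.
    by rewrite big_split /= -mulr_sumr sumrB l1 m1 subrr mulr0 addr0.
  rewrite /mu iA; have : s * (M + #|A|%:R^-1) < #|A|%:R^-1.
    by rewrite -ltr_pdivlMr.
  have : s * (- M) < s * la i by rewrite ltr_pM2l.
  lra.
have := (hG 1).1; rewrite G0 horner0 scale1r addrC subrK => <- //.
Qed.

Lemma face_int_sqr A f : (0 < #|A|)%N -> face_int A (f * f) = 0 -> vanish A f.
Proof.
move=> cA hI; apply: vanish_interior => // la hl lp.
apply/eqP; rewrite -sqrf_eq0 expr2 -rmorphM; apply/eqP.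
apply: (face_int_eq0 cA _ hI) => // mu _ _.
by rewrite rmorphM /= -expr2 sqr_ge0.
Qed.

Definition dird (z : 'cV[R]_d) f : {mpoly R[d]} := \sum_i z i 0 *: f^`M(i).

Lemma mderiv_bary i f : (psubst bary_poly f)^`M(i) = psubst bary_poly (dird (p i) f).
Proof.
rewrite mderiv_psubst raddf_sum /=; apply: eq_bigr => r _.
rewrite psubstZ -mul_mpolyC; congr (_ * _).
rewrite summxE raddf_sum (bigD1 i) //= big1 ?addr0 => [|j ji].
  by rewrite !mxE mulrC mderiv_mulC mderivXU eqxx mulr1.
by rewrite !mxE mulrC mderiv_mulC mderivXU (negPf ji) mulr0.
Qed.

Lemma face_int_stokes A i j f : i \in A -> j \in A -> (1 < #|A|)%N ->
  face_int A (dird (p i - p j) f) = face_int (A :\ j) f - face_int (A :\ i) f.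
Proof.
move=> iA jA cA; rewrite /face_int -bary_int_stokes //; congr bary_int.
rewrite !mderiv_bary -rmorphB; congr psubst; rewrite -sumrB; apply: eq_bigr => r _.
by rewrite !mxE scalerBl.
Qed.

Definition divv w : {mpoly R[d]} := \sum_i (w i 0)^`M(i).

Lemma dot_constpE (u : 'cV[R]_d) w : dot (C u) w = \sum_r u r 0 *: w r 0.
Proof. by rewrite dotE; apply: eq_bigr => r _; rewrite mxE mul_mpolyC. Qed.

Lemma expand_field l w : w = \sum_i dot (C (g i)) w *: C (p i - p l).
Proof.
apply/matrixP => r j; rewrite (ord1 j) summxE.
have e s : (delta_mx s 0 : 'cV[R]_d) r 0 = \sum_i g i s 0 * (p i - p l) r 0.
  rewrite {1}[delta_mx s 0](hge l) summxE; apply: eq_bigr => i _; rewrite mxE; congr (_ * _).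
  rewrite dotE (bigD1 s) //= big1 ?addr0 => [|t ts]; first by rewrite mxE !eqxx mulr1.
  by rewrite mxE (negPf ts) mulr0.
under eq_bigr => i _ do rewrite mxE dot_constpE mulr_suml.
rewrite exchange_big /= (bigD1 r) //= [X in _ + X]big1 ?addr0 => [|s sr].
  under eq_bigr => i _ do rewrite -scalerAl mulrC mxE mul_mpolyC scalerA.
  by rewrite -scaler_suml -e mxE !eqxx scale1r.
under eq_bigr => i _ do rewrite -scalerAl mulrC mxE mul_mpolyC scalerA.
by rewrite -scaler_suml -e mxE eq_sym (negPf sr) scale0r.
Qed.

Lemma sum_dot_g w : \sum_i dot (C (g i)) w = 0.
Proof.
under eq_bigr do rewrite dot_constpE.
rewrite exchange_big big1 //= => r _; rewrite -scaler_suml -summxE hgs.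
by rewrite mxE scale0r.
Qed.

Lemma divv_expand l w : divv w = \sum_i dird (p i - p l) (dot (C (g i)) w).
Proof.
rewrite {1}[w](expand_field l) /divv.
under eq_bigr => r _ do rewrite summxE raddf_sum /=.
rewrite exchange_big /=; apply: eq_bigr => i _; apply: eq_bigr => r _.
by rewrite mxE mulrC mxE mderiv_mulC mul_mpolyC.
Qed.

Lemma dird0 z : dird z 0 = 0.
Proof. by rewrite /dird big1 // => r _; rewrite mderiv0 scaler0. Qed.

(** The divergence theorem for a field tangent to [A]. Expanding [w] along the edges at a vertex [l]
    leaves two facet terms per edge; those on the facet opposite to [l] recombine by [hgs]. With
    normalised functionals, [g j] itself plays the part of the conormal. *)
Lemma face_int_div A w : (1 < #|A|)%N -> (forall j, j \notin A -> dot (C (g j)) w = 0) ->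
  face_int A (divv w) = - \sum_(j in A) face_int (A :\ j) (dot (C (g j)) w).
Proof.
move=> cA hw; have [l lA] : exists l, l \in A by apply/card_gt0P/ltnW.
rewrite (divv_expand l) raddf_sum /= (bigID (mem A)) /= [X in _ + X]big1 ?addr0; last first.
  by move=> j jA; rewrite hw // dird0 raddf0.
under eq_bigr => j jA do rewrite face_int_stokes //.
rewrite sumrB -raddf_sum /=.
have := sum_dot_g w; rewrite (bigID (mem A)) /= [X in _ + X]big1 ?addr0 => [->|j jA]; last exact: hw.
by rewrite raddf0 sub0r.
Qed.

Lemma divvZ f w : divv (f *: w) = f * divv w + dot w (grad f).
Proof.
rewrite /divv dotE mulr_sumr -big_split /=; apply: eq_bigr => i _.
by rewrite !mxE mderivM addrC [f^`M(i) * _]mulrC.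
Qed.

Definition lam i : {mpoly R[d]} := dot (C (g i)) (coordp R d) +
  ((i == ord0)%:R - dot (g i) (p ord0))%:MP.

Lemma peval_lam i x : peval x (lam i) = dot (g i) (x - p ord0) + (i == ord0)%:R.
Proof.
rewrite rmorphD /= pevalC dotBr [RHS]addrAC -addrA; congr (_ + _).
rewrite !dotE raddf_sum /=; apply: eq_bigr => r _.
by rewrite rmorphM /= !mxE pevalC pevalXU.
Qed.

Lemma bary_sub l la : \sum_i la i = 1 -> bary la - p l = \sum_i la i *: (p i - p l).
Proof.
move=> l1; under [RHS]eq_bigr do rewrite scalerBr.
by rewrite sumrB -scaler_suml l1 scale1r.
Qed.

Lemma peval_lam_bary i la : \sum_i la i = 1 -> peval (bary la) (lam i) = la i.
Proof.
move=> l1; rewrite peval_lam bary_sub // dot_sumr.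
under eq_bigr => j _ do rewrite dotZr hg mulrBr.
rewrite sumrB -mulr_suml l1 mul1r subrK (bigD1 i) //= eqxx mulr1 big1 ?addr0 // => j ji.
by rewrite eq_sym (negPf ji) mulr0.
Qed.

Lemma bary_lam x : bary (fun i => peval x (lam i)) = x /\ \sum_i peval x (lam i) = 1.
Proof.
have s1 : \sum_i peval x (lam i) = 1.
  under eq_bigr do rewrite peval_lam; rewrite big_split /= -dot_suml hgs.
  rewrite dotE big1 ?add0r => [|i _]; last by rewrite mxE mul0r.
  by rewrite (bigD1 ord0) //= big1 ?addr0 // => i /negPf ->.
split=> //; apply/eqP; rewrite -(subr_eq0 _ x) -[_ - x](subrKA (p ord0)) bary_sub //.
rewrite -opprB subr_eq0; apply/eqP; rewrite [RHS](hge ord0); apply: eq_bigr => i _.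
case: (eqVneq i ord0) => [->|i0]; first by rewrite subrr !scaler0.
by rewrite peval_lam (negPf i0) addr0.
Qed.

Lemma vanish_setT f : vanish setT f -> f = 0.
Proof.
move=> hf; apply: peval_inj0 => x; have [e s1] := bary_lam x.
by rewrite -e; apply: hf; split=> // i; rewrite inE.
Qed.

Lemma msize_lam i : (msize (lam i) <= 2)%N.
Proof.
apply: msizeD_leq; last by rewrite msizeC; case: (_ != _).
rewrite dot_constpE; apply: msize_sum_leq => r _; apply: msizeZ_leq.
by rewrite mxE msizeX mdeg1.
Qed.

(* The projection of [A] onto its facet [A :\ j] along the edge [p j - p m]
   displaces points by multiples of [lam j]. *)
Lemma vanish_divide A j f k : (1 < #|A|)%N -> j \in A -> vanish (A :\ j) f ->
  (msize f <= k.+1)%N -> exists2 r, (msize r <= k)%N & vanish A (f - lam j * r).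
Proof.
move=> cA jA hf fk.
have [m] : exists m, m \in A :\ j by apply/card_gt0P; move: cA; rewrite (cardsD1 j) jA.
rewrite !inE => /andP [mj mA].
have [r hr e] := psubst_shift (p j - p m) (msize_lam j) fk.
exists r => // la [l0 l1]; rewrite -e subKr peval_psubst.
(* The barycentric coordinates of the projected point: the weight of [j] is transferred to [m]. *)
pose mu i := if i == j then 0 else if i == m then la m + la j else la i.
have -> : mxeval (bary la) (\col_i ('X_i - (p j - p m) i 0 *: lam j)) = bary mu.
  have -> : bary mu = bary la - la j *: (p j - p m).
    rewrite /bary (bigD1 j) //= (bigD1 m) //= [in RHS](bigD1 j) //= [in RHS](bigD1 m) //=.
    have -> : \sum_(i | (i != j) && (i != m)) mu i *: p i =
        \sum_(i | (i != j) && (i != m)) la i *: p i.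
      by apply: eq_bigr => i /andP [ij im]; rewrite /mu (negPf ij) (negPf im).
    rewrite /mu eqxx (negPf mj) eqxx scale0r add0r.
    by move: (\sum_(_ | _) _) => S; apply/matrixP => a b; rewrite !mxE; ring.
  apply/matrixP => i i'; rewrite (ord1 i') !mxE rmorphB /= pevalZ pevalXU peval_lam_bary //.
  by rewrite mulrC.
apply: hf; split=> [i|].
  rewrite !inE negb_and negbK /mu; case: eqVneq => //= ij iA.
  by case: eqVneq => [e'|_]; [move: iA; rewrite e' mA | apply: l0].
rewrite -l1 (bigD1 j) //= (bigD1 m) //= [RHS](bigD1 j) //= [in RHS](bigD1 m) //=.
have -> : \sum_(i | (i != j) && (i != m)) mu i = \sum_(i | (i != j) && (i != m)) la i.
  by apply: eq_bigr => i /andP [ij im]; rewrite /mu (negPf ij) (negPf im).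
by rewrite /mu eqxx (negPf mj) eqxx; ring.
Qed.

(** * Tangential fields in intrinsic coordinates and the BDM argument *)

Section Chart.
Variables (A : {set 'I_d.+1}) (l : nat) (c : chart R l d).
Hypothesis frmK : (frm c)^T *m frm c = 1%:M.
Hypothesis frm_on : forall j, j \in A -> exists y : 'cV_l, p j = org c + frm c *m y.

Definition coord_poly : 'cV[{mpoly R[d]}]_l := C (frm c)^T *m (coordp R d - C (org c)).
Definition param_poly : 'cV[{mpoly R[l]}]_d := constp l (org c) + constp l (frm c) *m coordp R l.

(* The field on [A] whose intrinsic components are [q], and conversely. *)
Definition push (q : 'cV[{mpoly R[l]}]_l) : 'cV[{mpoly R[d]}]_d :=
  C (frm c) *m map_mx (psubst coord_poly) q.
Definition pull v : 'cV[{mpoly R[l]}]_l :=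
  constp l (frm c)^T *m map_mx (psubst param_poly) v.

Lemma mxeval_constp n m m' x (M : 'M[R]_(m, m')) : mxeval x (constp n M) = M.
Proof. by apply/matrixP => i j; rewrite !mxE pevalC. Qed.

Lemma mxevalM n m1 m2 m3 x (M : 'M[{mpoly R[n]}]_(m1, m2)) (N : 'M_(m2, m3)) :
  mxeval x (M *m N) = mxeval x M *m mxeval x N.
Proof. exact: map_mxM. Qed.

Lemma mxeval_coord_poly x : mxeval x coord_poly = Defs.coord c x.
Proof.
rewrite mxevalM mxeval_constp; congr (_ *m _).
by rewrite [LHS]map_mxB -![map_mx _ _]/(mxeval x _) mxeval_constp mxeval_coordp.
Qed.

Lemma mxeval_param_poly y : mxeval y param_poly = org c + frm c *m y.
Proof.
by rewrite [LHS]map_mxD -![map_mx _ _]/(mxeval y _) mxevalM !mxeval_constp mxeval_coordp.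
Qed.

Lemma coordK la : affine_coord A la -> org c + frm c *m Defs.coord c (bary la) = bary la.
Proof.
move=> [l0 l1].
have [y ->] : exists y, bary la = org c + frm c *m y.
  have h i : exists y, i \in A -> p i = org c + frm c *m y.
    by have [/frm_on [y ->]|] := boolP (i \in A); [exists y | exists 0].
  have [Y hY] := fin_all_exists h; exists (\sum_i la i *: Y i).
  rewrite mulmx_sumr -[org c]scale1r -l1 scaler_suml -big_split /=.
  apply: eq_bigr => i _; have [iA|iA] := boolP (i \in A).
    by rewrite hY // scalerDr scalemxAr.
  by rewrite l0 // !scale0r mulmx0 addr0.
have -> // : Defs.coord c (org c + frm c *m y) = y.
by rewrite /Defs.coord [_ - org c]addrC addKr mulmxA frmK mul1mx.
Qed.

(** A field annihilated by the [g j] with [j] outside [A] is a combination of edges of [A], and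
    these lie in the range of the frame. *)
Lemma frm_tangent w : (forall j, j \notin A -> dot (C (g j)) w = 0) -> (0 < #|A|)%N ->
  C (frm c) *m (C (frm c)^T *m w) = w.
Proof.
move=> hw /card_gt0P [r rA]; rewrite {2}(expand_field r w) {1}(expand_field r w).
rewrite !mulmx_sumr; apply: eq_bigr => j _; rewrite -!scalemxAr.
have [jA|jA] := boolP (j \in A); last by rewrite hw ?scale0r.
congr (_ *: _); have [y e] := frm_on jA; have [y' e'] := frm_on rA.
have -> : p j - p r = frm c *m (y - y').
  by rewrite e e' opprD addrACA subrr add0r mulmxBr.
by rewrite /constp -!map_mxM /= (mulmxA (frm c)^T) frmK mul1mx.
Qed.

Lemma mxeval_psubst a b m m' x (phi : 'cV[{mpoly R[b]}]_a) (q : 'M_(m, m')) :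
  mxeval x (map_mx (psubst phi) q) = mxeval (mxeval x phi) q.
Proof. by apply/matrixP => i j; rewrite !mxE peval_psubst. Qed.

Lemma peval_dot n m x (u v : 'cV[{mpoly R[n]}]_m) :
  peval x (dot u v) = dot (mxeval x u) (mxeval x v).
Proof.
by rewrite !dotE raddf_sum; apply: eq_bigr => i _; rewrite /= rmorphM !mxE.
Qed.

Lemma mxeval_push x q : mxeval x (push q) = frm c *m mxeval (Defs.coord c x) q.
Proof. by rewrite mxevalM mxeval_constp mxeval_psubst mxeval_coord_poly. Qed.

Lemma mxeval_pull y v : mxeval y (pull v) = (frm c)^T *m mxeval (org c + frm c *m y) v.
Proof. by rewrite mxevalM mxeval_constp mxeval_psubst mxeval_param_poly. Qed.

(** Against a tangential field, an ambient test field may be replaced by its tangential restriction,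
    which is what intrinsic moments can see. *)
Lemma dot_push_pull w v : (0 < #|A|)%N -> (forall j, j \notin A -> dot (C (g j)) w = 0) ->
  vanish A (dot w v - dot w (push (pull v))).
Proof.
move=> cA hw la hl; rewrite rmorphB /=; apply/eqP; rewrite subr_eq0; apply/eqP.
rewrite !peval_dot mxeval_push mxeval_pull coordK //.
rewrite -{1}(frm_tangent hw cA) !mxevalM !mxeval_constp.
by rewrite -{1}[frm c]trmxK -!dot_mulmx.
Qed.

(** The left-hand side differentiates the extension of [s] that is constant in the normal
    directions, so only the intrinsic gradient remains. *)
Lemma grad_psubst_coord s : grad (psubst coord_poly s) = push (grad s).
Proof.
apply/matrixP => i j; rewrite !mxE mderiv_psubst; apply: eq_bigr => r _.
rewrite !mxE; congr (_ * _); rewrite raddf_sum /= (bigD1 i) //= big1 ?addr0 => [|t ti].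
  by rewrite !mxE mderiv_mulC mderivB mderivC subr0 mderivXU eqxx mulr1.
by rewrite !mxE mderiv_mulC mderivB mderivC subr0 mderivXU (negPf ti) mulr0.
Qed.

Lemma msize_pull v k : (forall i, (msize (v i 0%R) <= k)%N) ->
  forall i, (msize (pull v i 0%R) <= k)%N.
Proof.
move=> hv i; rewrite mxE; apply: msize_sum_leq => r _; rewrite !mxE mul_mpolyC.
apply: msizeZ_leq; apply: leq_trans (hv r); apply: msize_psubst => t.
rewrite !mxE; apply: msizeD_leq; first by rewrite msizeC; case: (_ != _).
apply: msize_sum_leq => a _; rewrite !mxE mul_mpolyC msizeZ_leq //.
by rewrite msizeX mdeg1.
Qed.

Lemma pushB q r : push (q - r) = push q - push r.
Proof. by rewrite /push map_mxB mulmxBr. Qed.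

(* Unisolvence of BDM-type moments: [w] is divergence free and orthogonal to
   gradients, hence to all fields of degree one less than [w]; the boundary
   condition makes each [dot (g j) w] a multiple of the barycentric coordinate
   [lam j], and the cofactors provide the test field. *)
Lemma bdm_unisolvent w k : (1 < #|A|)%N ->
  (forall i, (msize (w i 0%R) <= k.+3)%N) ->
  (forall j, j \notin A -> dot (C (g j)) w = 0) ->
  (forall j, j \in A -> vanish (A :\ j) (dot (C (g j)) w)) ->
  (forall q, ND k q -> face_int A (dot w (push q)) = 0) ->
  (forall i, vanish A (w i 0)) /\ vanish A (divv w).
Proof.
move=> cA hk wt wn hND; have cA0 := ltnW cA.
have cAj j : j \in A -> (0 < #|A :\ j|)%N by move=> jA; move: cA; rewrite (cardsD1 j) jA.
have green s : face_int A (s * divv w) + face_int A (dot w (grad s)) = 0.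
  rewrite -raddfD -divvZ /= face_int_div // => [|j jA]; last by rewrite dotZr wt ?mulr0.
  rewrite big1 ?oppr0 // => j jA; apply: face_int_vanish; first exact: cAj.
  by rewrite dotZr; apply/vanishMl/wn.
have low v : (forall i, (msize (v i 0%R) <= k.+1)%N) -> face_int A (dot w v) = 0.
  move=> hv; rewrite (face_int_eq cA0 (dot_push_pull v cA0 wt)); apply: hND.
  exists (pull v), 0; split; first exact: msize_pull.
  - by rewrite trmx0 oppr0.
  - by move=> i j; rewrite mxE; apply: dhomog0.
  - by rewrite mul0mx addr0.
have hdiv : (msize (divv w) <= k.+2)%N.
  by apply: msize_sum_leq => i _; apply: msize_mderiv.
(* The gradient of [divv w] has degree at most [k], so [divv w] may serve as the potential in
   Green's formula and has zero square integral. *)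
have div0 : vanish A (divv w).
  apply: face_int_sqr => //; have := green (divv w); rewrite low ?addr0 // => i.
  by rewrite mxE; apply: msize_mderiv.
have hgrad s : face_int A (dot w (grad s)) = 0.
  have := green s; rewrite face_int_vanish ?add0r //; exact: vanishMl.
(* A tangential field of degree [k + 1] is in [ND k] up to a gradient, and gradients are now
   orthogonal to [w]. *)
have mid v : (forall i, (msize (v i 0%R) <= k.+2)%N) -> face_int A (dot w v) = 0.
  move=> hv; rewrite (face_int_eq cA0 (dot_push_pull v cA0 wt)).
  have [s _ hs] := grad_ND_decomp (msize_pull hv).
  by have := hND _ hs; rewrite pushB dotBr raddfB /= -grad_psubst_coord hgrad subr0.
split=> //.
have hr j : exists r, j \in A -> (msize r <= k.+2)%N /\
    vanish A (dot (C (g j)) w - lam j * r).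
  have [jA|] := boolP (j \in A); last by exists 0.
  have hd : (msize (dot (C (g j)) w) <= k.+3)%N.
    by rewrite dot_constpE; apply: msize_sum_leq => i _; apply: msizeZ_leq.
  by have [r h1 h2] := vanish_divide cA jA (wn j jA) hd; exists r.
have [r {}hr] := fin_all_exists hr.
have I0 : face_int A (\sum_(j in A) lam j * r j * r j) = 0.
  rewrite -(@face_int_eq A (dot w (\sum_(j in A) r j *: C (g j)))) //.
    apply: mid => i; rewrite summxE; apply: msize_sum_leq => j jA.
    by rewrite !mxE mulrC mul_mpolyC msizeZ_leq // (hr j jA).1.
  rewrite dot_sumr -sumrB; apply: vanish_sum => j jA.
  have -> : dot w (r j *: C (g j)) - lam j * r j * r j = r j * (dot (C (g j)) w - lam j * r j).
    by rewrite dotZr (dotC w); ring.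
  by apply/vanishMl/(hr j jA).2.
have wg j : j \in A -> vanish A (dot (C (g j)) w).
  move=> jA; apply: vanish_interior => // la hl lp.
  have /eqP := (hr j jA).2 la hl; rewrite rmorphB subr_eq0 => /eqP ->.
  have sq0 i mu : affine_coord A mu -> (forall i, 0 <= mu i) ->
      0 <= peval (bary mu) (lam i * r i * r i).
    move=> [m0 m1] mp; rewrite !rmorphM /= -mulrA -expr2 mulr_ge0 ?sqr_ge0 //.
    by rewrite peval_lam_bary.
  have := face_int_eq0 cA0 _ I0 hl lp.
  have la_ge0 i : 0 <= la i.
    by have [/lp/ltW//|iA] := boolP (i \in A); rewrite hl.1.
  rewrite raddf_sum /= => /(_ _) h.
  have /psumr_eq0P : \sum_(i in A) peval (bary la) (lam i * r i * r i) = 0.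
    by apply: h => mu hmu mp; rewrite raddf_sum; apply: sumr_ge0 => i _; apply: sq0.
  move=> /(_ (fun i _ => sq0 i la hl la_ge0) j jA) /eqP.
  rewrite !rmorphM /= peval_lam_bary ?hl.2 // -mulrA mulf_eq0 (gt_eqF (lp j jA)) /=.
  by rewrite -expr2 sqrf_eq0 => /eqP ->; rewrite mulr0.
have [m mA] : exists m, m \in A by apply/card_gt0P.
move=> i; rewrite [w](expand_field m) summxE; apply: vanish_sum => j _.
rewrite mxE; apply: vanishMr; have [jA|jA] := boolP (j \in A); first exact: wg.
by rewrite wt //; apply: vanish0.
Qed.

End Chart.

(** * Symmetric matrix fields *)

Lemma frobE (B : comPzRingType) n (U V : 'M[B]_n) : frob U V = \tr (U *m V^T).
Proof.
by rewrite /frob /mxtrace; apply: eq_bigr => i _; rewrite mxE; apply: eq_bigr => j _; rewrite mxE.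
Qed.

Lemma frobDr (B : comPzRingType) n (U V W : 'M[B]_n) : frob U (V + W) = frob U V + frob U W.
Proof. by rewrite !frobE linearD /= mulmxDr mxtraceD. Qed.

Lemma frobZr (B : comPzRingType) n c (U V : 'M[B]_n) : frob U (c *: V) = c * frob U V.
Proof. by rewrite !frobE linearZ /= -scalemxAr mxtraceZ. Qed.

Lemma frob_dyad (t : 'M[{mpoly R[d]}]_d) (u v : 'cV_d) : frob t (u *m v^T) = dot u (t *m v).
Proof. by rewrite frobE trmx_mul trmxK mulmxA mxtrace_mulC /mxtrace big_ord1. Qed.

(** The entries of [t] in the redundant frame of the [g i]. Rows sum to zero, so the off-diagonal
    entries determine [t]. *)
Definition dual_entry (t : 'M[{mpoly R[d]}]_d) i j := dot (C (g i)) (t *m C (g j)).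

Lemma dual_entryC t i j : t^T = t -> dual_entry t i j = dual_entry t j i.
Proof. by move=> tT; rewrite /dual_entry dot_mulmx tT dotC. Qed.

Lemma field_eq0 w : (forall i, dot (C (g i)) w = 0) -> w = 0.
Proof.
by move=> hw; rewrite [w](expand_field ord0) big1 // => i _; rewrite hw scale0r.
Qed.

Lemma dual_entry_eq0 t : (forall i j, dual_entry t i j = 0) -> t = 0.
Proof.
move=> h; apply/matrixP => r s; rewrite [RHS]mxE.
have hr : (row r t)^T = 0.
  apply: field_eq0 => j; have /field_eq0 e : forall i, dual_entry t i j = 0 by [].
  have := congr1 (fun M : 'cV_d => M r 0) e; rewrite /= !mxE => <-.
  by rewrite dotE; apply: eq_bigr => i _; rewrite !mxE mulrC.
by have := congr1 (fun M : 'cV_d => M s 0) hr; rewrite !mxE.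
Qed.

Lemma sum_dual_entry t i : \sum_j dual_entry t i j = 0.
Proof.
rewrite /dual_entry -dot_sumr -mulmx_sumr.
have -> : \sum_j C (g j) = 0.
  apply/matrixP => r s; rewrite summxE [RHS]mxE.
  transitivity ((\sum_j g j r s)%:MP : {mpoly R[d]}).
    by rewrite raddf_sum; apply: eq_bigr => j _; rewrite mxE.
  by rewrite -summxE hgs mxE mpolyC0.
by rewrite mulmx0 /dot mulmx0 mxE.
Qed.

(* Each off-diagonal [dual_entry t i j] is [lam i * lam j * r i j] for some polynomial
   [r i j]; the test field is the sum of the [r i j] times symmetrised dyads. *)
Lemma sym_unisolvent (t : 'M[{mpoly R[d]}]_d) k : (0 < d)%N -> PS k.+2 t ->
  (forall i j, vanish (setT :\ i) (dual_entry t i j)) ->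
  (forall q, PS k q -> face_int setT (frob t q) = 0) -> t = 0.
Proof.
move=> d0 [tT tk] tn ht.
have cT : (1 < #|[set: 'I_d.+1]|)%N by rewrite cardsT card_ord.
have cTi i : (0 < #|[set: 'I_d.+1] :\ i|)%N.
  by move: cT; rewrite (cardsD1 i) inE.
have hr (ij : 'I_d.+1 * 'I_d.+1) : exists r, ij.1 != ij.2 -> (msize r <= k.+1)%N /\
    vanish setT (dual_entry t ij.1 ij.2 - lam ij.1 * lam ij.2 * r).
  case: ij => i j /=; case: (eqVneq i j) => [|ij]; first by exists 0.
  have hs : (msize (dual_entry t i j) <= k.+3)%N.
    rewrite /dual_entry dot_constpE; apply: msize_sum_leq => r _; apply: msizeZ_leq.
    by rewrite mxE; apply: msize_sum_leq => s _; rewrite mxE mulrC mul_mpolyC msizeZ_leq.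
  have [r hr1 hr2] := vanish_divide cT (in_setT i) (tn i j) hs.
  (* By symmetry the entry also vanishes on the face opposite to [j], and in the interior of that
     face [lam i] is positive, so the zero passes to the cofactor. *)
  have rj : vanish (setT :\ j) r.
    apply: vanish_interior => // la hl lp.
    have hlT : affine_coord setT la by split=> [m|]; [rewrite inE | exact: hl.2].
    have /eqP := hr2 la hlT; rewrite rmorphB /= dual_entryC // tn // sub0r oppr_eq0 rmorphM mulf_eq0.
    by rewrite /= peval_lam_bary ?hl.2 // gt_eqF ?lp ?inE ?ij //= => /eqP.
  have [r' hr1' hr2'] := vanish_divide cT (in_setT j) rj hr1.
  exists r' => _; split=> // la hl.
  have /eqP := hr2 la hl; have /eqP := hr2' la hl; rewrite !rmorphB !rmorphM /= !subr_eq0.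
  by move=> /eqP -> /eqP ->; rewrite mulrA subrr.
have [r {}hr] := fin_all_exists hr.
pose q := \sum_(ij | ij.1 != ij.2) r ij *: (C (g ij.1) *m (C (g ij.2))^T).
have qk i j : (msize (q i j) <= k.+1)%N.
  rewrite summxE; apply: msize_sum_leq => ij nij; rewrite mxE mulrC mxE big_ord1 !mxE -mulrA.
  by rewrite !mul_mpolyC !msizeZ_leq // (hr ij nij).1.
have hq : PS k (q + q^T).
  split=> [|i j]; first by rewrite linearD /= trmxK addrC.
  by rewrite mxE msizeD_leq // mxE.
have e : frob t (q + q^T) = 2 * \sum_(ij | ij.1 != ij.2) r ij * dual_entry t ij.1 ij.2.
  have frobq : frob t q = \sum_(ij | ij.1 != ij.2) r ij * dual_entry t ij.1 ij.2.
    rewrite frobE linear_sum /= mulmx_sumr raddf_sum /=; apply: eq_bigr => ij _.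
    by rewrite linearZ /= -scalemxAr linearZ /= -frobE frob_dyad.
  have frobqT : frob t q^T = frob t q.
    by rewrite !frobE -[RHS]mxtrace_tr trmx_mul trmxK tT mxtrace_mulC.
  by rewrite frobDr frobqT frobq mulr_natl mulr2n.
have I0 : face_int setT (\sum_(ij | ij.1 != ij.2) lam ij.1 * lam ij.2 * r ij * r ij) = 0.
  have := ht _ hq; rewrite e -mpolyC_nat mul_mpolyC linearZ /= => /eqP.
  rewrite mulf_eq0 pnatr_eq0 /= => /eqP <-; apply: face_int_eq; first exact: ltnW.
  rewrite -sumrB; apply: vanish_sum => ij nij.
  have -> : lam ij.1 * lam ij.2 * r ij * r ij - r ij * dual_entry t ij.1 ij.2 =
     - r ij * (dual_entry t ij.1 ij.2 - lam ij.1 * lam ij.2 * r ij) by ring.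
  by apply/vanishMl/(hr ij nij).2.
have hpos (ij : 'I_d.+1 * 'I_d.+1) la : affine_coord setT la -> (forall i, 0 <= la i) ->
    0 <= peval (bary la) (lam ij.1 * lam ij.2 * r ij * r ij).
  move=> [m0 m1] mp; rewrite !rmorphM /= -mulrA -expr2 mulr_ge0 ?sqr_ge0 //.
  by rewrite !peval_lam_bary // mulr_ge0.
have off i j : i != j -> dual_entry t i j = 0.
  move=> ij; apply: vanish_setT; apply: vanish_interior => [|la hl lp]; first exact: ltnW.
  have /eqP := (hr (i, j) ij).2 la hl; rewrite rmorphB subr_eq0 => /eqP ->.
  have la0 m : 0 <= la m by rewrite ltW // lp.
  have := face_int_eq0 (ltnW cT) _ I0 hl lp; rewrite raddf_sum /= => h.
  have /psumr_eq0P : \sum_(ij | ij.1 != ij.2)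
      peval (bary la) (lam ij.1 * lam ij.2 * r ij * r ij) = 0.
    by apply: h => mu hmu mp; rewrite raddf_sum; apply: sumr_ge0 => ij' _; apply: hpos.
  move=> /(_ (fun ij' _ => hpos ij' la hl la0) (i, j) ij) /eqP.
  rewrite !rmorphM /= !peval_lam_bary ?hl.2 // -mulrA mulf_eq0.
  rewrite mulf_eq0 (gt_eqF (lp i _)) ?(gt_eqF (lp j _)) ?inE //= -expr2 sqrf_eq0 => /eqP ->.
  by rewrite mulr0.
apply: dual_entry_eq0 => i j; case: (eqVneq i j) => [<-|]; last exact: off.
have := sum_dual_entry t i; rewrite (bigD1 i) //= big1 ?addr0 // => m mi.
by rewrite off // eq_sym.
Qed.

(** The product rule, where the symmetry of [t] replaces the gradient of [q] by its symmetric
    part. *)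
Lemma green_sym (t : 'M[{mpoly R[d]}]_d) q : t^T = t ->
  divv (t *m q) = dot (divm t) q + frob t (defm q).
Proof.
move=> tT; have tE i j : t j i = t i j by rewrite -{1}tT mxE.
have -> : frob t (defm q) = \sum_i \sum_j t j i * (q i 0)^`M(j).
  rewrite /frob; under eq_bigr => i _.
    under eq_bigr => j _ do rewrite mxE -scalerAr mulrDr scalerDr.
    rewrite big_split; over.
  rewrite big_split /= [X in _ + X]exchange_big -big_split /=; apply: eq_bigr => i _.
  rewrite -big_split /=; apply: eq_bigr => j _; rewrite (tE i j) -scalerDl.
  rewrite (_ : 2^-1 + 2^-1 = 1 :> R) ?scale1r //; by field.
rewrite /divv dotE -big_split /=.
under eq_bigr => j _ do rewrite mxE raddf_sum /=.
rewrite exchange_big; apply: eq_bigr => i _.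
rewrite mxE mulr_suml -big_split /=; apply: eq_bigr => j _.
by rewrite mderivM (tE i j).
Qed.

Lemma dot_constp (y z : 'cV[R]_d) : dot (C y) (C z) = (dot y z)%:MP.
Proof.
by rewrite !dotE raddf_sum /=; apply: eq_bigr => i _; rewrite !mxE mpolyCM.
Qed.

(** The tangential projector is constant, symmetric and idempotent. The surface term of [tr_2]
    thereby becomes the divergence of [tr_t], which the BDM lemma controls on the face. *)
Lemma surf_divE n w : dot n n = 1 -> surf_div n w = divv (C (tproj n) *m w).
Proof.
move=> n1; have [P PE] : {P : 'M[R]_d | P = tproj n} by exists (tproj n).
have PT : P^T = P by rewrite PE /tproj linearB /= trmx1 trmx_mul trmxK.
have PP : P *m P = P.
  rewrite PE /tproj mulmxBl mul1mx mulmxBr mulmx1 mulmxA -(mulmxA n).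
  have -> : n^T *m n = 1%:M by apply/matrixP => i j; rewrite !ord1 -n1 [RHS]mxE mulr1n.
  by rewrite mulmx1 subrr subr0.
rewrite /surf_div -PE.
have e : C P *m w = C P *m (C P *m w) by rewrite mulmxA /constp -map_mxM PP.
rewrite [in RHS]e.
rewrite /divv; under [RHS]eq_bigr => r _ do rewrite mxE raddf_sum /=.
rewrite [RHS]exchange_big /=; apply: eq_bigr => i _; rewrite mxE; apply: eq_bigr => r _.
have -> : (C P) i r = (C P) r i by rewrite !mxE -{1}PT mxE.
by rewrite [in RHS]mxE mderiv_mulC [in LHS]mxE [grad _ _ _]mxE.
Qed.

(** With the identity chart, the BDM lemma applies to [T] as its own face. *)
Lemma push_id q : push (Chart 0 1%:M : chart R d d) q = q.
Proof.
rewrite /push /coord_poly /= trmx1.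
have -> : C 1%:M *m (coordp R d - C (0 : 'cV_d)) = coordp R d.
  by rewrite /constp map_mx1 map_mx0 mul1mx subr0.
rewrite /constp map_mx1 mul1mx; apply/matrixP => i j; rewrite mxE.
by apply: peval_inj => x; rewrite peval_psubst mxeval_coordp.
Qed.

Lemma mul_tproj n w : C (tproj n) *m w = w - dot (C n) w *: C n.
Proof.
rewrite /tproj /constp map_mxB map_mx1 map_mxM mulmxBl mul1mx -mulmxA; congr (_ - _).
rewrite (_ : _ *m w = (dot (C n) w)%:M) ?mul_mx_scalar //.
by rewrite [LHS]mx11_scalar /dot /constp map_trmx.
Qed.

(** The degree in the theorem is [k + 3] here. The scalar moments (a), (b), (c) have become
    vanishing on affine hulls, with (a) rewritten through dual entries, and normals enter as nonzero
    multiples of the [g i]. *)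
Lemma dof_injective (t : 'M[{mpoly R[d]}]_d) k (n : 'I_d.+1 -> 'cV[R]_d) (a : 'I_d.+1 -> R)
    l (c : 'I_d.+1 -> chart R l d) :
  (1 < d)%N -> PS k.+3 t ->
  (forall i, n i = a i *: g i) -> (forall i, dot (n i) (n i) = 1) ->
  (forall i, (frm (c i))^T *m frm (c i) = 1%:M) ->
  (forall i j, j != i -> exists y : 'cV_l, p j = org (c i) + frm (c i) *m y) ->
  (forall i j, i != j -> vanish (setT :\ i :\ j) (dual_entry t i j)) ->
  (forall i, vanish (setT :\ i) (tr_nn (n i) t)) ->
  (forall i, vanish (setT :\ i) (tr_2 (n i) t)) ->
  (forall i q, ND k.+1 q -> face_int (setT :\ i) (dot (tr_t (n i) t) (push (c i) q)) = 0) ->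
  (forall q, ND k q -> face_int setT (frob t (defm q)) = 0) ->
  (forall q, PSker k.+1 q -> face_int setT (frob t q) = 0) ->
  t = 0.
Proof.
move=> d1 [tT tk] nE n1 hc1 hc2 he hnn h2 hnd hdef hker.
have cT : #|[set: 'I_d.+1]| = d.+1 by rewrite cardsT card_ord.
have cTi i : #|[set: 'I_d.+1] :\ i| = d.
  by have := cardsD1 i [set: 'I_d.+1]; rewrite cT inE add1n => -[].
have a0 i : a i != 0.
  apply/eqP => e; have := n1 i; rewrite nE e scale0r dotE big1.
    by move/esym/eqP; rewrite oner_eq0.
  by move=> r _; rewrite mxE mul0r.
have Cn i : C (n i) = (a i)%:MP *: C (g i).
  by apply/matrixP => r s; rewrite nE !mxE mpolyCM.
have Cg i : C (g i) = ((a i)^-1)%:MP *: C (n i).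
  by rewrite Cn scalerA -mpolyCM mulVf // mpolyC1 scale1r.
have diag i : vanish (setT :\ i) (dual_entry t i i).
  move=> la hl; have := hnn i la hl; rewrite /tr_nn Cn dotZl -scalemxAr dotZr !rmorphM /= !pevalC.
  by move/eqP; rewrite !mulf_eq0 (negPf (a0 i)) /= => /eqP.
(* Where the faces opposite to [i] and [j] meet, the first term vanishes by the condition from (a)
   and the second by (b). *)
have trtE i j : dot (C (g j)) (tr_t (n i) t) =
    (a i)%:MP * dual_entry t j i - (a i)%:MP * ((a i)%:MP * dual_entry t i i) * (dot (g j) (n i))%:MP.
  rewrite /tr_t mul_tproj dotBr dotZr dot_constp.
  by congr (_ - _ * _); rewrite /dual_entry Cn ?dotZl -?scalemxAr !dotZr.
have wt i j : j \notin [set: 'I_d.+1] :\ i -> dot (C (g j)) (tr_t (n i) t) = 0.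
  rewrite !inE andbT negbK => /eqP ->; rewrite {1}Cg dotZl /tr_t mul_tproj dotBr dotZr.
  by rewrite dot_constp n1 mulr1 subrr mulr0.
have tk4 i j : (msize (tr_t (n i) t j 0%R) <= k.+4)%N.
  rewrite /tr_t mxE; apply: msize_sum_leq => r _; rewrite mxE mul_mpolyC msizeZ_leq //.
  by rewrite mxE; apply: msize_sum_leq => s _; rewrite mxE mulrC mul_mpolyC msizeZ_leq.
have onF i : (forall r, vanish (setT :\ i) (tr_t (n i) t r 0)) /\
    vanish (setT :\ i) (divv (tr_t (n i) t)).
  apply: (@bdm_unisolvent _ l (c i)) => //.
  - by move=> j; rewrite !inE andbT; apply: hc2.
  - by rewrite cTi.
  - by move=> j; apply: wt.
  - move=> j; rewrite !inE andbT => ji; rewrite trtE; apply: vanishB.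
      by apply: vanishMl; rewrite dual_entryC //; apply: he; rewrite eq_sym.
    by apply/vanishMr/vanishMl/vanishMl; apply: vanishS (diag i); apply: subsetDl.
  - exact: hnd.
(* The tangential part and the normal-normal entry together recover all of [t n] on the face. *)
have tgF i j : vanish (setT :\ i) (dual_entry t i j).
  have -> : dual_entry t i j = ((a i)^-1)%:MP * (dot (C (g j)) (tr_t (n i) t) +
      (a i)%:MP * ((a i)%:MP * dual_entry t i i) * (dot (g j) (n i))%:MP).
    by rewrite trtE subrK mulrA -mpolyCM mulVf // mpolyC1 mul1r dual_entryC.
  apply: vanishMl; apply: vanishD.
    rewrite dot_constpE; apply: vanish_sum => r _; rewrite -mul_mpolyC.
    exact/vanishMl/(onF i).1.
  by apply/vanishMr/vanishMl/vanishMl/diag.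
have green q : face_int setT (dot (divm t) q) + face_int setT (frob t (defm q)) = 0.
  rewrite -raddfD -green_sym //= face_int_div ?cT ?ltnS ?(ltnW d1) // => [|j]; last by rewrite inE.
  rewrite big1 ?oppr0 // => i _; apply: face_int_vanish; first by rewrite cTi (ltnW d1).
  rewrite dot_mulmx tT dotC dotE; apply: vanish_sum => r _; apply: vanishMl.
  rewrite [t *m _](expand_field ord0) summxE; apply: vanish_sum => s _.
  have tgs : vanish (setT :\ i) (dual_entry t s i) by rewrite dual_entryC.
  by rewrite mxE; exact: vanishMr tgs.
have div0 : divm t = 0.
  have [] := @bdm_unisolvent [set: 'I_d.+1] d (Chart 0 1%:M) _ _ (divm t) k.
  - by rewrite /= trmx1 mulmx1.
  - by move=> j _; exists (p j); rewrite /= mul1mx add0r.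
  - by rewrite cT ltnS ltnW.
  - by move=> i; rewrite mxE; apply: msize_sum_leq => j _; apply: msize_mderiv.
  - by move=> j; rewrite inE.
  - move=> i _ la hl; have := h2 i la hl; rewrite /tr_2 rmorphD /= surf_divE // -/(tr_t _ _).
    rewrite (onF i).2 // addr0 Cn dotZl rmorphM /= pevalC => /eqP.
    by rewrite mulf_eq0 (negPf (a0 i)) => /eqP.
  - move=> q hq; rewrite push_id; have := green q; rewrite hdef // addr0; exact.
  move=> h _; apply/matrixP => i j; rewrite (ord1 j) [RHS]mxE.
  exact/vanish_setT/h.
have hdef' q : face_int setT (frob t (defm q)) = 0.
  by have := green q; rewrite div0 {1}/dot trmx0 mul0mx mxE raddf0 add0r.
apply: (@sym_unisolvent _ k.+1) => //; first exact: ltnW.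
move=> q /PS_defm_decomp [v _ hv].
have := hker _ hv; have -> : frob t (q - defm v) = frob t q - frob t (defm v).
  by rewrite !frobE linearB /= mulmxBr raddfB.
by rewrite raddfB /= hdef' subr0.
Qed.

End Simplex.

(** The rows of the inverse edge matrix are the gradients for the vertices other than [ord0]; that
    for [ord0] is minus their sum. *)
Lemma dual_frame (R : realType) d (p : 'I_d.+1 -> 'cV[R]_d) : nondeg_simplex p ->
  exists g : 'I_d.+1 -> 'cV[R]_d,
  [/\ forall i j l, dot (g i) (p j - p l) = (i == j)%:R - (i == l)%:R, \sum_i g i = 0 &
      forall l v, v = \sum_i dot (g i) v *: (p i - p l)].
Proof.
move=> hp; have uE : edges p \in unitmx by rewrite -row_full_unit /row_full; apply/eqP.
pose h j : 'cV[R]_d := (row j (invmx (edges p)))^T.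
have hh j v : dot (h j) v = (invmx (edges p) *m v) j 0.
  by rewrite dotE mxE; apply: eq_bigr => i _; rewrite !mxE.
have he j j' : dot (h j) (p (lift ord0 j') - p ord0) = (j == j')%:R.
  have -> : p (lift ord0 j') - p ord0 = edges p *m delta_mx j' 0.
    by rewrite -colE; apply/matrixP => a b; rewrite (ord1 b) !mxE.
  by rewrite hh mulKmx // mxE eqxx andbT.
pose g i := if unlift ord0 i is Some j then h j else - \sum_j h j.
have g0 : g ord0 = - \sum_j h j by rewrite /g unlift_none.
have gl j : g (lift ord0 j) = h j by rewrite /g liftK.
have gs : \sum_i g i = 0.
  by rewrite big_ord_recl g0; under [X in _ + X]eq_bigr do rewrite gl; rewrite addNr.
have hg0 i j : dot (g i) (p j - p ord0) = (i == j)%:R - (i == ord0)%:R.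
  have dN (u v : 'cV[R]_d) : dot (- u) v = - dot u v.
    by rewrite !dotE -sumrN; apply: eq_bigr => r _; rewrite mxE mulNr.
  case: (unliftP ord0 j) => [j' ->|->]; last first.
    by rewrite !subrr dotE big1 // => r _; rewrite mxE mulr0.
  case: (unliftP ord0 i) => [i' ->|->].
    by rewrite gl he (inj_eq lift_inj) [lift _ _ == _]eq_sym (negPf (neq_lift _ _)) subr0.
  rewrite g0 dN dot_suml (bigD1 j') //= he eqxx big1 ?addr0 => [|r rj].
    by rewrite sub0r.
  by rewrite he (negPf rj).
exists g; split=> // [i j l|l v].
  have -> : p j - p l = (p j - p ord0) - (p l - p ord0) by rewrite opprB addrA subrK.
  by rewrite dotBr !hg0; ring.
have -> : \sum_i dot (g i) v *: (p i - p l) = \sum_i dot (g i) v *: (p i - p ord0).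
  have -> : \sum_i dot (g i) v *: (p i - p l) =
      \sum_i dot (g i) v *: (p i - p ord0) - \sum_i dot (g i) v *: (p l - p ord0).
    rewrite -sumrB; apply: eq_bigr => i _; rewrite -scalerBr; congr (_ *: _).
    by rewrite opprB addrA subrK.
  rewrite -scaler_suml -dot_suml gs (_ : dot 0 v = 0) ?scale0r ?subr0 //.
  by rewrite dotE big1 // => i _; rewrite mxE mul0r.
rewrite big_ord_recl subrr scaler0 add0r.
rewrite -{1}(mulKVmx uE v); apply/matrixP => a b; rewrite (ord1 b) mxE summxE.
by apply: eq_bigr => j _; rewrite gl hh !mxE mulrC.
Qed.

(** * From moments to algebraic functionals *)

Section Functionals.
Variables (R : realType) (d : nat) (p g : 'I_d.+1 -> 'cV[R]_d).
Hypothesis hg : forall i j l, dot (g i) (p j - p l) = (i == j)%:R - (i == l)%:R.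
Hypothesis hgs : \sum_i g i = 0.
Hypothesis hge : forall l v, v = \sum_i dot (g i) v *: (p i - p l).
Implicit Types (A : {set 'I_d.+1}) (f : {mpoly R[d]}).

Lemma edges_corner l (sigma : 'I_l.+1 -> 'I_d.+1) y : injective sigma ->
  p (sigma ord0) + edges (fun j => p (sigma j)) *m y =
  bary p (fun i => corner_pt sigma y i 0).
Proof.
move=> si; have := bary_sub p (sigma ord0) (sum_corner_pt sigma y) => /eqP.
rewrite subr_eq addrC => /eqP ->; congr (_ + _).
rewrite (bigID (mem (sigma @: setT))) /= [X in _ = _ + X]big1 ?addr0; last first.
  by move=> i iA; rewrite (corner_pt_out y iA) scale0r.
rewrite big_imset /=; last by move=> x z _ _; apply: si.
rewrite [RHS](eq_bigl xpredT) => [|x]; last by rewrite inE.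
rewrite big_ord_recl subrr scaler0 add0r.
apply/matrixP => a b; rewrite (ord1 b) mxE summxE; apply: eq_bigr => j _.
by rewrite corner_pt_in // /corner_coord liftK !mxE mulrC.
Qed.

Lemma simplex_int_face l (sigma : 'I_l.+1 -> 'I_d.+1) f (h : 'cV[R]_d -> R) :
  injective sigma ->
  (forall la, affine_coord (sigma @: setT) la -> h (bary p la) = peval (bary p la) f) ->
  let v := fun j => p (sigma j) in
  simplex_int v h = Num.sqrt (\det ((edges v)^T *m edges v)) * face_int p (sigma @: setT) f.
Proof.
move=> si hh v; congr (_ * _); apply: (corner_int_bary si) => y.
rewrite edges_corner // hh; last first.
  by split=> [i|]; [apply: corner_pt_out | apply: sum_corner_pt].
rewrite -(peval_bary_poly p); congr peval; apply/matrixP => i j.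
by rewrite (ord1 j) !mxE.
Qed.

(** The edges factor through the orthonormal frame as [frm c *m Y], so the Gram determinant is the
    square of [\det Y]; pairing with the [g i] shows that [Y] has trivial kernel. *)
Lemma gram_gt0 l (sigma : 'I_l.+1 -> 'I_d.+1) (c : chart R l d) : injective sigma ->
  let v := fun j => p (sigma j) in is_chart v c ->
  0 < \det ((edges v)^T *m edges v).
Proof.
move=> si v [frmK hv].
have [y hy] := fin_all_exists hv.
pose Y : 'M[R]_l := \matrix_(i, j) (y (lift ord0 j) i 0 - y ord0 i 0).
have eY : edges v = frm c *m Y.
  apply/matrixP => i j; rewrite !mxE !hy.
  have -> : \sum_j0 frm c i j0 * Y j0 j = (frm c *m (y (lift ord0 j) - y ord0)) i 0.
    by rewrite mxE; apply: eq_bigr => r _; rewrite !mxE.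
  by rewrite mulmxBr !mxE opprD addrACA subrr add0r.
have Y0 : \det Y != 0.
  rewrite -det_tr; apply/det0P => -[z z0 hz].
  have hz' : edges v *m z^T = 0.
    by rewrite eY -mulmxA -[Y]trmxK -trmx_mul hz trmx0 mulmx0.
  move/negP: z0; apply; apply/eqP/matrixP => a j; rewrite (ord1 a) [RHS]mxE.
  have := congr1 (dot (g (sigma (lift ord0 j)))) hz'.
  have -> : edges v *m z^T = \sum_r z 0 r *: (p (sigma (lift ord0 r)) - p (sigma ord0)).
    apply/matrixP => i b; rewrite (ord1 b) mxE summxE; apply: eq_bigr => r _.
    by rewrite !mxE mulrC.
  rewrite dot_sumr (bigD1 j) //= big1 ?addr0 => [|r rj].
    rewrite dotZr hg eqxx (inj_eq si) eq_sym (negPf (neq_lift _ _)) subr0 mulr1 => ->.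
    by rewrite dotE big1 // => r _; rewrite mxE mulr0.
  rewrite dotZr hg !(inj_eq si) (inj_eq lift_inj) eq_sym (negPf rj).
  by rewrite eq_sym (negPf (neq_lift _ _)) subrr mulr0.
rewrite eY trmx_mul mulmxA -(mulmxA Y^T) frmK mulmx1 det_mulmx det_tr.
by rewrite -expr2 exprn_even_gt0.
Qed.

(** [L] is linear over the reals only, that is over constant polynomials, hence the separate
    hypotheses in place of a linear map. *)
Lemma lin_basis_mod (m : nat) (V : lmodType (mpoly m R)) (S S0 : V -> Prop) b (L : V -> R) :
  basis_mod S S0 b -> (forall u v, L (u + v) = L u + L v) ->
  (forall c v, L (c%:MP *: v) = c * L v) -> (forall q, S0 q -> L q = 0) ->
  (forall q, q \in b -> L q = 0) -> forall q, S q -> L q = 0.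
Proof.
move=> [_ _ hb] LD LZ L0 Lb q /hb [c /L0].
have e : q = (q - \sum_i (c i)%:MP *: b`_i) + \sum_i (c i)%:MP *: b`_i by rewrite subrK.
move=> h0; rewrite e LD h0 add0r {e h0}.
have Lz : L 0 = 0 by rewrite -(scale0r 0) -mpolyC0 LZ mul0r.
elim/big_rec: _ => // i y _ IH; rewrite LD IH LZ Lb ?mulr0 ?addr0 //.
exact: mem_nth.
Qed.

Section Subsimplex.
Variables (l : nat) (D : Delta d l) (c : chart R l d).
Hypothesis hc : is_chart (vert p D) c.

Lemma vset_param : exists sigma : 'I_l.+1 -> 'I_d.+1,
  [/\ injective sigma, sigma @: setT = vset D & vert p D = fun j => p (sigma j)].
Proof.
exists (fun j => enum_val (cast_ord (esym (eqP (svalP D))) j)); split=> //.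
  by move=> i j /enum_val_inj /cast_ord_inj.
apply/setP => i; apply/imsetP/idP => [[j _ ->]|iA]; first exact: enum_valP.
by exists (cast_ord (eqP (svalP D)) (enum_rank_in iA i)); rewrite ?cast_ordK ?enum_rankK_in.
Qed.

Lemma chart_on j : j \in vset D -> exists y : 'cV_l, p j = org c + frm c *m y.
Proof.
have [sigma [_ <- e]] := vset_param => /imsetP [r _ ->].
by have := hc.2 r; rewrite e.
Qed.

Lemma card_vset : #|vset D| = l.+1. Proof. exact/eqP/(svalP D). Qed.

Lemma simplex_int_vert f h :
  (forall la, affine_coord (vset D) la -> h (bary p la) = peval (bary p la) f) ->
  (simplex_int (vert p D) h = 0 <-> face_int p (vset D) f = 0).
Proof.
move=> hh; have [sigma [si e ev]] := vset_param; move: hc; rewrite ev => hc'.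
rewrite (@simplex_int_face _ sigma f) // ?e //.
have := gram_gt0 si hc'; rewrite -sqrtr_gt0 => /lt0r_neq0 nz.
by split=> [/eqP|->]; rewrite ?mulr0 // mulf_eq0 (negPf nz) => /eqP.
Qed.

Lemma pair_face_eq0 f q : pair_face p D c f q = 0 <->
  face_int p (vset D) (f * psubst (coord_poly c) q) = 0.
Proof.
apply: simplex_int_vert => la _.
by rewrite rmorphM /= peval_psubst mxeval_coord_poly.
Qed.

Lemma pair_face_vec_eq0 w q : pair_face_vec p D c w q = 0 <->
  face_int p (vset D) (dot w (push c q)) = 0.
Proof.
apply: simplex_int_vert => la _.
by rewrite peval_dot mxeval_push.
Qed.

(** Read in the chart, [f] is itself an admissible test function, and this makes the integral of its
    square vanish. *)
Lemma pair_face_unisolvent k b f : is_basis (@P_ R l k) b -> (msize f <= k.+1)%N ->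
  (forall q, q \in b -> pair_face p D c f q = 0) -> vanish p (vset D) f.
Proof.
move=> hb hf h.
have cD : (0 < #|vset D|)%N by rewrite card_vset.
pose L (q : (mpoly l R)^o) := face_int p (vset D) (f * psubst (coord_poly c) q).
have hL : forall q, P_ k q -> L q = 0.
  apply: (lin_basis_mod hb) => [u v|a v|q ->|q /h /pair_face_eq0 //].
  - by rewrite /L rmorphD mulrDr raddfD.
  - by rewrite /L rmorphM /= psubstC mulrCA mul_mpolyC linearZ.
  - by rewrite /L rmorph0 mulr0 raddf0.
apply: face_int_sqr => //.
rewrite -(@face_int_eq _ _ p _ (f * psubst (coord_poly c) (psubst (param_poly c) f))) //.
  apply: hL; rewrite /P_; apply: leq_trans hf; apply: msize_psubst => i.
  rewrite !mxE; apply: msizeD_leq; first by rewrite msizeC; case: (_ != _).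
  apply: msize_sum_leq => a _; rewrite !mxE mul_mpolyC msizeZ_leq //.
  by rewrite msizeX mdeg1.
rewrite -mulrBr => la hl; rewrite rmorphM rmorphB /= !peval_psubst mxeval_coord_poly.
by rewrite mxeval_param_poly (@coordK _ _ p (vset D)) ?subrr ?mulr0 //; [exact: hc.1 | exact: chart_on].
Qed.

Lemma pair_face_vec_ND k b w : is_basis (@ND R l k) b ->
  (forall q, q \in b -> pair_face_vec p D c w q = 0) ->
  forall q, ND k q -> face_int p (vset D) (dot w (push c q)) = 0.
Proof.
move=> hb h; apply: (lin_basis_mod hb) => [u v|a v|q ->|q /h /pair_face_vec_eq0 //].
- by rewrite /push map_mxD mulmxDr dotDr raddfD.
- have -> : push c (a%:MP *: v) = a%:MP *: push c v.
    rewrite /push scalemxAr; congr (_ *m _); apply/matrixP => i j; rewrite !mxE rmorphM /=.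
    by rewrite psubstC.
  by rewrite dotZr mul_mpolyC linearZ.
- by rewrite /push map_mx0 mulmx0 dotE big1 ?raddf0 // => i _; rewrite mxE mulr0.
Qed.

End Subsimplex.

Lemma pair_mx_eq0 t q : pair_mx p t q = 0 <-> face_int p setT (frob t q) = 0.
Proof.
rewrite /pair_mx (@simplex_int_face _ id (frob t q)) // => [|la _]; last first.
  rewrite /frob raddf_sum; apply: eq_bigr => i _; rewrite raddf_sum; apply: eq_bigr => j _.
  by rewrite /= rmorphM !mxE.
have -> : id @: [set: 'I_d.+1] = setT by rewrite imset_id.
have hc : is_chart p (Chart 0 1%:M : chart R d d).
  by split=> [|i]; [rewrite /= trmx1 mulmx1 | exists (p i); rewrite /= mul1mx add0r].
have := @gram_gt0 _ id _ (fun _ _ => id) hc; rewrite -sqrtr_gt0 => /lt0r_neq0 nz.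
by split=> [/eqP|->]; rewrite ?mulr0 // mulf_eq0 (negPf nz) => /eqP.
Qed.

End Functionals.

(** * Normals *)

Section Normals.
Variables (R : realType) (d : nat) (p g : 'I_d.+1 -> 'cV[R]_d).
Hypothesis hg : forall i j l, dot (g i) (p j - p l) = (i == j)%:R - (i == l)%:R.
Hypothesis hgs : \sum_i g i = 0.
Hypothesis hge : forall l v, v = \sum_i dot (g i) v *: (p i - p l).

Lemma constpZ a b (x : R) (M : 'M[R]_(a, b)) : constp d (x *: M) = x%:MP *: constp d M.
Proof. by apply/matrixP => i j; rewrite !mxE mpolyCM. Qed.

Lemma constpD a b (M N : 'M[R]_(a, b)) : constp d (M + N) = constp d M + constp d N.
Proof. by apply/matrixP => i j; rewrite !mxE mpolyCD. Qed.

Lemma dual_expand l n : n = \sum_i dot n (p i - p l) *: g i.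
Proof.
apply/matrixP => r b; rewrite (ord1 b) summxE.
have -> : n r 0 = dot n (delta_mx r 0).
  rewrite dotE (bigD1 r) //= big1 ?addr0 => [|s sr]; first by rewrite mxE !eqxx mulr1.
  by rewrite mxE (negPf sr) mulr0.
rewrite [delta_mx r 0](hge l) dot_sumr; apply: eq_bigr => i _.
rewrite dotZr mxE mulrC; congr (_ * _).
rewrite dotE (bigD1 r) //= big1 ?addr0 => [|s sr]; first by rewrite mxE !eqxx mulr1.
by rewrite mxE (negPf sr) mulr0.
Qed.

Lemma dot_ge0 (n : 'cV[R]_d) : 0 <= dot n n.
Proof. by rewrite dotE sumr_ge0 // => i _; rewrite -expr2 sqr_ge0. Qed.

Lemma dot_gt0 (n v : 'cV[R]_d) : dot n v != 0 -> 0 < dot n n.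
Proof.
move=> h; rewrite lt_neqAle dot_ge0 andbT eq_sym; apply: contra h => /eqP.
rewrite !dotE => /psumr_eq0P h0.
rewrite big1 // => i _; have /eqP := h0 (fun i _ => sqr_ge0 (n i 0)) i isT.
by rewrite mulf_eq0 orbb => /eqP ->; rewrite mul0r.
Qed.

(* The outer normal is the normalisation of any [- h] with [h] tangent to [B],
   constant on [A] and increasing away from it. *)
Lemma outer_normal_exists (A B : {set 'I_d.+1}) (h : 'cV[R]_d) : dot h h != 0 ->
  (forall i, i \notin B -> dot (g i) h = 0) ->
  (forall i j, i \in A -> j \in A -> dot h (p j - p i) = 0) ->
  (forall i j, i \in A -> j \in B -> j \notin A -> 0 < dot h (p j - p i)) ->
  is_outer_normal p B A (outer_normal p B A).
Proof.
move=> h0 hB hA hAB; apply: classical_sets.xgetPex.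
have hh : 0 < dot h h by apply: dot_gt0 h0.
pose s := Num.sqrt (dot h h); have s0 : 0 < s by rewrite sqrtr_gt0.
exists (- s^-1 *: h); split.
(* The weights [dot (g i) h] vanish off [B] and sum to zero, so the base vertex in the expansion of
   [h] drops out. *)
- exists (fun i => - s^-1 * dot (g i) h); split.
    rewrite -mulr_sumr; have : \sum_i dot (g i) h = 0.
      by rewrite -dot_suml hgs dotE big1 // => i _; rewrite mxE mul0r.
    by rewrite (bigID (mem B)) /= [X in _ + X]big1 // addr0 => ->; rewrite mulr0.
  under eq_bigr do rewrite -scalerA; rewrite -scaler_sumr; congr (_ *: _).
  have := bary_sub p ord0; rewrite {1}[h](hge ord0).
  under eq_bigr do rewrite scalerBr; rewrite sumrB -scaler_suml -dot_suml hgs => _.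
  rewrite (_ : dot 0 h = 0) ?scale0r ?subr0; last by rewrite dotE big1 // => i _; rewrite mxE mul0r.
  by rewrite (bigID (mem B)) /= [X in _ + X]big1 ?addr0 // => i iB; rewrite hB ?scale0r.
- rewrite dotZl dotZr -[dot h h]sqr_sqrtr ?ltW // -/s; field; exact: lt0r_neq0.
- by move=> i j iA jA; rewrite dotZl hA ?mulr0.
- by move=> i j iA jB jA; rewrite dotZl mulNr oppr_lt0 mulr_gt0 ?invr_gt0 // hAB.
Qed.

Lemma dot_g_self i : (0 < d)%N -> 0 < dot (g i) (g i).
Proof.
move=> d0; have [l li] : exists l : 'I_d.+1, l != i.
  have : (0 < #|[set: 'I_d.+1] :\ i|)%N.
    by have := cardsD1 i [set: 'I_d.+1]; rewrite cardsT card_ord inE add1n => -[<-].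
  by case/card_gt0P => l; rewrite !inE andbT; exists l.
apply: (@dot_gt0 _ (p i - p l)); rewrite hg eqxx [i == l]eq_sym (negPf li) subr0.
exact: oner_neq0.
Qed.

(** The normal is orthogonal to the edges of the face, so its dual expansion reduces to [g i], with
    a coefficient that is negative because the normal points outward. *)
Lemma face_normalP (F : Delta d (d - 1)) i : (0 < d)%N -> vset F = setT :\ i ->
  exists2 a, a < 0 & face_normal p F = a *: g i /\ dot (face_normal p F) (face_normal p F) = 1.
Proof.
move=> d0 eF.
have [_ n1 nA nAB] : is_outer_normal p setT (vset F) (face_normal p F).
  apply: (@outer_normal_exists _ _ (g i)).
  - by rewrite lt0r_neq0 // dot_g_self.
  - by move=> r; rewrite inE.
  - by move=> r s; rewrite eF !inE !andbT hg ![i == _]eq_sym => /negPf -> /negPf ->; rewrite subrr.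
  - move=> r s; rewrite eF !inE !andbT negbK hg ![i == _]eq_sym => /negPf -> _ ->.
    by rewrite subr0 ltr01.
have [l lF] : exists l, l \in vset F by apply/card_gt0P; rewrite card_vset.
exists (dot (face_normal p F) (p i - p l)).
  by apply: nAB; rewrite ?inE // eF !inE eqxx.
split=> //; rewrite {1}[face_normal p F](dual_expand l) (bigD1 i) //= big1 ?addr0 // => r ri.
by rewrite nA ?scale0r // eF !inE ri.
Qed.

(** The coefficient of [g i] is left open: in [tr_e] it multiplies [dual_entry g t i i], which (b)
    makes vanish on [e]. *)
Lemma face_conormalP (F : Delta d (d - 1)) (e : Delta d (d - 2)) i j : (1 < d)%N ->
  i != j -> vset F = setT :\ i -> vset e = setT :\ i :\ j ->
  exists a, exists2 b, b < 0 & face_conormal p F e = a *: g i + b *: g j.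
Proof.
(* [h] is [g j] made orthogonal to [g i], hence tangent to the face opposite to [i]. *)
move=> d1 ij eF ee; pose h := g j - (dot (g i) (g j) / dot (g i) (g i)) *: g i.
have gii : 0 < dot (g i) (g i) by rewrite dot_g_self // ltnW.
have [l le] : exists l, l \in vset e by apply/card_gt0P; rewrite card_vset.
have hpp r s : r != i -> s != i -> dot h (p r - p s) = (j == r)%:R - (j == s)%:R.
  move=> ri si; rewrite dotC dotBr dotZr !(dotC (p r - p s)) !hg.
  by rewrite [i == r]eq_sym [i == s]eq_sym (negPf ri) (negPf si) subrr mulr0 subr0.
have ine r : r \in vset e -> r != i /\ r != j.
  by rewrite ee !inE andbT => /andP [].
have [_ n1 nA nAB] : is_outer_normal p (vset F) (vset e) (face_conormal p F e).
  apply: (@outer_normal_exists _ _ h).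
  - have [li lj] := ine _ le.
    apply/lt0r_neq0/(@dot_gt0 _ (p j - p l)); rewrite hpp //; last by rewrite eq_sym.
    by rewrite eqxx [j == l]eq_sym (negPf lj) subr0 oner_neq0.
  - move=> r; rewrite eF !inE andbT negbK => /eqP ->; rewrite dotBr dotZr divfK ?subrr //.
    exact: lt0r_neq0.
  - move=> r s /ine [ri rj] /ine [si sj]; rewrite hpp // ![j == _]eq_sym.
    by rewrite (negPf rj) (negPf sj) subrr.
  - move=> r s /ine [ri rj]; rewrite eF ee !inE !andbT => si; rewrite si /= andbT negbK => sj.
    by rewrite hpp // [j == s]eq_sym sj [j == r]eq_sym (negPf rj) subr0 ltr01.
exists (dot (face_conormal p F e) (p i - p l)), (dot (face_conormal p F e) (p j - p l)).
  by apply: nAB; rewrite // ?eF ?ee !inE ?eqxx // eq_sym ij.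
rewrite {1}[face_conormal p F e](dual_expand l) (bigD1 i) //= (bigD1 j) 1?eq_sym //=.
rewrite big1 ?addr0 // => r /andP [ri rj].
by rewrite nA ?scale0r // ee !inE ri rj.
Qed.

Lemma DeltaF_ex i : (0 < d)%N -> exists F : Delta d (d - 1), vset F = setT :\ i.
Proof.
move=> d0; have h : #|[set: 'I_d.+1] :\ i| == (d - 1).+1.
  have := cardsD1 i [set: 'I_d.+1]; rewrite cardsT card_ord inE add1n => -[e].
  by rewrite -e subn1 prednK.
by exists (exist (fun A : {set 'I_d.+1} => #|A| == (d - 1).+1) _ h).
Qed.

Lemma Deltae_ex i j : (1 < d)%N -> i != j ->
  exists e : Delta d (d - 2), vset e = setT :\ i :\ j.
Proof.
move=> d1 ij; have h : #|[set: 'I_d.+1] :\ i :\ j| == (d - 2).+1.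
  have := cardsD1 i [set: 'I_d.+1]; rewrite cardsT card_ord inE add1n => -[].
  have := cardsD1 j ([set: 'I_d.+1] :\ i); rewrite !inE eq_sym ij /= add1n => -> e.
  by move: #|_| e => x e; apply/eqP; lia.
by exists (exist (fun A : {set 'I_d.+1} => #|A| == (d - 2).+1) _ h).
Qed.

Lemma DeltaF_form (F : Delta d (d - 1)) : (0 < d)%N -> exists i, vset F = setT :\ i.
Proof.
move=> d0; have := cardsC (vset F); rewrite card_vset card_ord => h.
have /cards1P [i hi] : #|~: vset F| == 1%N.
  by move: #|_| h => x h; apply/eqP; lia.
by exists i; rewrite -(setCK (vset F)) hi setTD.
Qed.

(* Modulo the terms [tr_nn], which vanish on [e], each of the two summands of
   [tr_e] is a positive multiple of [dual_entry g t i j]. *)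
Lemma tr_e_vanish (e : Delta d (d - 2)) i j t : (1 < d)%N -> i != j -> t^T = t ->
  vset e = setT :\ i :\ j ->
  (forall F, vanish p (vset F) (tr_nn (face_normal p F) t)) ->
  vanish p (vset e) (tr_e p e t) -> vanish p (vset e) (dual_entry g t i j).
Proof.
move=> d1 ij tT ee hnn hte la hl.
have d0 : (0 < d)%N := ltnW d1.
have nn r (F : Delta d (d - 1)) : vset F = setT :\ r -> vset e \subset vset F ->
   peval (bary p la) (dual_entry g t r r) = 0.
  move=> eF sF; have [a a0 [hn _]] := face_normalP d0 eF.
  have /eqP := @vanishS _ _ _ _ _ _ sF (hnn F) la hl.
  have -> : tr_nn (face_normal p F) t = a%:MP * (a%:MP * dual_entry g t r r).
    by rewrite /tr_nn hn constpZ dotZl -scalemxAr dotZr.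
  by rewrite !rmorphM /= !pevalC !mulf_eq0 (lt_eqF a0) => /eqP.
(* The sum is not split into its two faces: each face containing [e] contributes a positive factor,
   and one such face suffices for a positive total. *)
have term (F : Delta d (d - 1)) : exists kap, vset e \subset vset F -> 0 < kap /\
    peval (bary p la) (dot (constp d (face_conormal p F e)) (t *m constp d (face_normal p F))) =
    kap * peval (bary p la) (dual_entry g t i j).
  have [sF|] := boolP (vset e \subset vset F); last by exists 0.
  have key r s : r != s -> vset F = setT :\ r -> vset e = setT :\ r :\ s ->
     exists kap, 0 < kap /\
     peval (bary p la) (dot (constp d (face_conormal p F e)) (t *m constp d (face_normal p F))) =
     kap * peval (bary p la) (dual_entry g t s r).
    move=> rs eF ee'; have [a a0 [hn _]] := face_normalP d0 eF.
    have [al [be be0 hc]] := face_conormalP d1 rs eF ee'.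
    (* Positive as a product of two negative numbers: normal and conormal both point against the
       gradients. *)
    exists (be * a); split; first by rewrite nmulr_rgt0.
    have -> : dot (constp d (face_conormal p F e)) (t *m constp d (face_normal p F)) =
        a%:MP * (al%:MP * dual_entry g t r r + be%:MP * dual_entry g t s r).
      rewrite hn hc constpD !constpZ -scalemxAr dotZr dotC dotDr !dotZr.
      by rewrite dotC (dotC _ (constp d (g s))).
    move: (nn r F eF sF) (dual_entry g t s r); move: (dual_entry g t r r) => X hX Y.
    by rewrite !mul_mpolyC pevalZ rmorphD /= !pevalZ hX mulr0 add0r mulrA (mulrC a).
  have [r eF] := DeltaF_form F d0.
  have rij : (r == i) || (r == j).
    apply: contraT; rewrite negb_or => /andP [ri rj].
    have : r \in vset F by apply: (subsetP sF); rewrite ee !inE ri rj.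
    by rewrite eF !inE eqxx.
  case/orP: rij => /eqP rE; rewrite rE in eF.
    have [kap [k0 ek]] := key i j ij eF ee; exists kap => _; split; first exact: k0.
    by rewrite (dual_entryC _ i j).
  have ji : j != i by rewrite eq_sym.
  have ee' : vset e = setT :\ j :\ i by rewrite ee; apply/setP => x; rewrite !inE andbCA.
  have [kap [k0 ek]] := key j i ji eF ee'.
  by exists kap => _; split; [exact: k0 | exact: ek].
have [kap hk] := fin_all_exists term.
have := hte la hl; rewrite /tr_e raddf_sum /=.
rewrite (eq_bigr (fun F => kap F * peval (bary p la) (dual_entry g t i j))); last first.
  by move=> F sF; exact: (hk F sF).2.
rewrite -mulr_suml => /eqP; rewrite mulf_eq0 => /orP [/eqP s0|/eqP //].
have [F eF] := DeltaF_ex i d0.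
have sF : vset e \subset vset F by rewrite ee eF subsetDl.
have : 0 < \sum_(F0 : Delta d (d - 1) | vset e \subset vset F0) kap F0.
  rewrite (bigD1 F) //= ltr_pwDl ?(hk F sF).1 // sumr_ge0 // => F' /andP [sF' _].
  by rewrite ltW // (hk F' sF').1.
by rewrite s0 ltxx.
Qed.

End Normals.

(** * Dimension count *)

Section Bases.
Variables (R : realType) (m : nat).
Implicit Types (V : lmodType {mpoly R[m]}).

(** Real subspaces of a module over the polynomial ring; only constant scalars act. *)
Definition rsubspace V (S : V -> Prop) :=
  S 0 /\ forall (c : R) u v, S u -> S v -> S (c%:MP *: u + v).

Lemma rsubspaceD V (S : V -> Prop) u v : rsubspace S -> S u -> S v -> S (u + v).
Proof. by move=> [_ h] hu hv; rewrite -[u]scale1r -mpolyC1; apply: h. Qed.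

Lemma rsubspaceZ V (S : V -> Prop) (c : R) u : rsubspace S -> S u -> S (c%:MP *: u).
Proof. by move=> [h0 h] hu; rewrite -[_ *: _]addr0; apply: h. Qed.

Lemma rsubspaceN V (S : V -> Prop) u : rsubspace S -> S u -> S (- u).
Proof. by move=> h hu; rewrite -scaleN1r -mpolyC1 -mpolyCN; apply: rsubspaceZ. Qed.

Lemma rsubspaceB V (S : V -> Prop) u v : rsubspace S -> S u -> S v -> S (u - v).
Proof. by move=> h hu hv; apply: rsubspaceD => //; apply: rsubspaceN. Qed.

Lemma rsubspace_sum V (S : V -> Prop) (I : Type) (r : seq I) (P : pred I) (F : I -> V) :
  rsubspace S -> (forall i, P i -> S (F i)) -> S (\sum_(i <- r | P i) F i).
Proof.
move=> h hF; elim/big_rec: _ => [|i x Pi hx]; first exact: h.1.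
by apply: rsubspaceD => //; apply: hF.
Qed.

Lemma rsubspace0 V : rsubspace (fun q : V => q = 0).
Proof. by split=> // c u v -> ->; rewrite scaler0 addr0. Qed.

Lemma rsubspace_eq0 V (S : V -> Prop) : rsubspace S -> forall q, q = 0 -> S q.
Proof. by move=> [h _] q ->. Qed.

Definition comb V (I : finType) (u : I -> V) (c : I -> R) : V := \sum_i (c i)%:MP *: u i.

Lemma combZ V (I : finType) (u : I -> V) (a : R) c : comb u (fun i => a * c i) = a%:MP *: comb u c.
Proof. by rewrite scaler_sumr; apply: eq_bigr => i _; rewrite mpolyCM scalerA. Qed.

(** Indexing a basis of [S / S0] by a finite type turns dimension counting into cardinals of sums
    and products of types. *)
Definition fbasis (I : finType) V (S S0 : V -> Prop) (u : I -> V) : Prop :=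
  [/\ forall i, S (u i), forall c, S0 (comb u c) -> forall i, c i = 0
    & forall q, S q -> exists c, S0 (q - comb u c)].

Lemma fbasis_seq V (S S0 : V -> Prop) b : basis_mod S S0 b -> fbasis S S0 (fun i : 'I_(size b) => b`_i).
Proof. by move=> [h1 h2 h3]; split=> // i; apply/h1/mem_nth. Qed.

(** A row vector killed by the matrix expressing [u] through [w] modulo [S0] is a relation among the
    [u], hence zero; the matrix has full row rank. *)
Lemma fbasis_card_leq (I J : finType) V (S S0 : V -> Prop) (u : I -> V) (w : J -> V) :
  rsubspace S0 -> fbasis S S0 u -> fbasis S S0 w -> (#|I| <= #|J|)%N.
Proof.
move=> h0 [u1 u2 _] [w1 _ w3].
have [A hA] := fin_all_exists (fun i => w3 _ (u1 i)).
pose M : 'M[R]_(#|I|, #|J|) := \matrix_(i, j) A (enum_val i) (enum_val j).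
suff : row_free M by rewrite -row_leq_rank => /leq_trans; apply; apply: rank_leq_col.
rewrite -kermx_eq0; apply/eqP/row_matrixP => i0; rewrite row0.
set z := row i0 _; have hz : z *m M = 0 by rewrite -row_mul mulmx_ker row0.
pose c i := z 0 (enum_rank i).
have hc : S0 (comb u c).
  have -> : comb u c = \sum_i (c i)%:MP *: (u i - comb w (A i)).
    rewrite /comb; under [RHS]eq_bigr do rewrite scalerBr.
    rewrite sumrB [X in _ - X](_ : _ = 0) ?subr0 //.
    under eq_bigr do rewrite -combZ /comb.
    rewrite exchange_big big1 //= => j _; rewrite -scaler_suml -raddf_sum /=.
    have := congr1 (fun X : 'rV_ _ => X 0 (enum_rank j)) hz; rewrite /= mxE [RHS]mxE => e.
    suff -> : \sum_i c i * A i j = 0 by rewrite mpolyC0 scale0r.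
    apply: etrans e; rewrite (reindex (fun r : 'I_#|I| => enum_val r)) /=; last first.
      by exists enum_rank => i _; rewrite ?enum_valK ?enum_rankK.
    by apply: eq_bigr => i _; rewrite /c enum_valK [M _ _]mxE enum_rankK.
  by apply: rsubspace_sum => // i _; apply: rsubspaceZ.
apply/matrixP => a i; rewrite (ord1 a) [RHS]mxE.
by have := u2 c hc (enum_val i); rewrite /c enum_valK.
Qed.

Lemma fbasis_card (I J : finType) V (S S0 : V -> Prop) (u : I -> V) (w : J -> V) :
  rsubspace S0 -> fbasis S S0 u -> fbasis S S0 w -> #|I| = #|J|.
Proof.
by move=> h hu hw; apply/eqP; rewrite eqn_leq (fbasis_card_leq h hu hw) (fbasis_card_leq h hw hu).
Qed.

(** Additivity of dimension along a chain of subspaces. *)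
Lemma fbasis_cat (I J : finType) V (S S1 S0 : V -> Prop) (u : I -> V) (w : J -> V) :
  rsubspace S1 -> rsubspace S0 -> (forall q, S0 q -> S1 q) -> (forall q, S1 q -> S q) ->
  fbasis S1 S0 u -> fbasis S S1 w ->
  fbasis S S0 (fun x : I + J => match x with inl i => u i | inr j => w j end).
Proof.
move=> c1 c0 s01 s1 [u1 u2 u3] [w1 w2 w3].
have combE c : comb (fun x : I + J => match x with inl i => u i | inr j => w j end) c =
    comb u (c \o inl) + comb w (c \o inr) by rewrite /comb big_sumType.
split=> [[i|j]|c|q hq]; [exact/s1/u1 | exact: w1 | |].
  rewrite combE => h.
  have hu : S1 (comb u (c \o inl)).
    by apply: rsubspace_sum => // i _; apply: rsubspaceZ.
  have hw j : c (inr j) = 0.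
    apply: (w2 (c \o inr)); have := rsubspaceB c1 (s01 _ h) hu.
    by rewrite addrAC subrr add0r.
  have w0 : comb w (c \o inr) = 0.
    by rewrite /comb big1 // => j _; rewrite /= hw mpolyC0 scale0r.
  by move: h; rewrite w0 addr0 => /u2 hi [i|j]; [apply: hi | apply: hw].
have [e he] := w3 q hq; have [c hc] := u3 _ he.
exists (fun x => match x with inl i => c i | inr j => e j end).
by rewrite combE [comb u _ + _]addrC opprD addrA.
Qed.

(** Scalars, vectors and symmetric matrices, of bounded or of fixed degree, are all combinations of
    a frame [E] with coefficients supported on a finite list of monomials. *)
Lemma fbasis_free (L : seq 'X_{1..m}) (A : finType) V (E : A -> V) (S : V -> Prop) : uniq L ->
  (forall c : A -> {mpoly R[m]}, \sum_a c a *: E a = 0 -> forall a, c a = 0) ->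
  (forall q, S q <-> exists2 c : A -> {mpoly R[m]},
      (forall a n, n \notin L -> (c a)@_n = 0) & q = \sum_a c a *: E a) ->
  fbasis S (fun q => q = 0) (fun x : 'I_(size L) * A => 'X_[nth 0%MM L x.1] *: E x.2).
Proof.
move=> uL hE hS.
have nthL (i : 'I_(size L)) n : (nth 0%MM L i == n) = (i == index n L :> nat) && (n \in L).
  apply/eqP/andP => [<-|[/eqP -> nL]]; last exact: nth_index.
  by rewrite index_uniq // mem_nth.
have combE c : comb (fun x : 'I_(size L) * A => 'X_[nth 0%MM L x.1] *: E x.2) c =
    \sum_a (\sum_i c (i, a) *: 'X_[nth 0%MM L i]) *: E a.
  transitivity (\sum_i \sum_a (c (i, a))%:MP *: ('X_[nth 0%MM L i] *: E a)).
    by rewrite pair_bigA; apply: eq_bigr => -[i a] _.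
  rewrite exchange_big /=; apply: eq_bigr => a _; rewrite scaler_suml; apply: eq_bigr => i _.
  by rewrite scalerA mul_mpolyC.
have coefE (c : 'I_(size L) -> R) n : (\sum_i c i *: 'X_[nth 0%MM L i])@_n =
    \sum_i c i * ((i == index n L :> nat) && (n \in L))%:R.
  by rewrite raddf_sum; apply: eq_bigr => i _; rewrite /= mcoeffZ mcoeffX nthL.
split=> [[i a]|c|q /hS [c hc ->]].
- apply/hS; exists (fun b => if b == a then 'X_[nth 0%MM L i] else 0) => [b n nL|].
    case: eqP => _; rewrite ?mcoeff0 // mcoeffX; case: eqP => // e.
    by move: nL; rewrite -e mem_nth.
  rewrite (bigD1 a) //= eqxx big1 ?addr0 // => b /negPf ->; exact: scale0r.
- rewrite combE => /hE h [i a]; have := congr1 (mcoeff (nth 0%MM L i)) (h a).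
  rewrite coefE mcoeff0 (bigD1 i) //= big1 ?addr0 => [|j ji].
    by rewrite index_uniq ?mem_nth // eqxx mulr1.
  rewrite index_uniq // (_ : (j == i :> nat) = false) ?mulr0 //; exact: negPf.
exists (fun x : 'I_(size L) * A => (c x.2)@_(nth 0%MM L x.1)); apply/eqP; rewrite subr_eq0 combE; apply/eqP.
apply: eq_bigr => a _; congr (_ *: _); apply/mpolyP => n; rewrite coefE.
have [nL|nL] := boolP (n \in L); last by rewrite hc // big1 // => i _; rewrite andbF mulr0.
have hi : (index n L < size L)%N by rewrite index_mem.
rewrite (bigD1 (Ordinal hi)) //= eqxx nth_index // mulr1 big1 ?addr0 // => i ni.
by rewrite (_ : (i == index n L :> nat) = false) ?mulr0 //; apply/negbTE.
Qed.

(** The hypotheses say that [f] induces an isomorphism of the quotients; it is applied to [grad], to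
    [defm] and to the identity. *)
Lemma fbasis_map (I : finType) V (V' : lmodType {mpoly R[m]}) (f : V -> V')
    (S S0 : V -> Prop) (S' S0' : V' -> Prop) (u : I -> V) :
  (forall (c : R) x y, f (c%:MP *: x + y) = c%:MP *: f x + f y) ->
  rsubspace S -> rsubspace S0' ->
  (forall q, S q -> S' (f q)) -> (forall q, S0 q -> S0' (f q)) ->
  (forall q, S q -> S0' (f q) -> S0 q) ->
  (forall q, S' q -> exists2 x, S x & S0' (q - f x)) ->
  fbasis S S0 u -> fbasis S' S0' (f \o u).
Proof.
move=> fl cS c0 fS f0 f0' fsurj [u1 u2 u3].
have f00 : f 0 = 0.
  have := fl 1 0 0; rewrite scaler0 addr0 mpolyC1 scale1r => /eqP.
  by rewrite -subr_eq0 opprD addNKr oppr_eq0 => /eqP.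
have fcomb c : f (comb u c) = comb (f \o u) c.
  rewrite /comb; elim: (index_enum I) => [|i s IH]; first by rewrite !big_nil f00.
  by rewrite !big_cons fl IH.
have Scomb c : S (comb u c) by apply: rsubspace_sum => // i _; apply: rsubspaceZ.
split=> [i|c h|q /fsurj [x Sx hx]]; first exact/fS/u1.
  by apply: u2; apply: f0' => //; rewrite fcomb.
have [c /f0 hc] := u3 x Sx; exists c; move: hc.
have -> : f (x - comb u c) = f x - comb (f \o u) c.
  by rewrite addrC -scaleN1r -mpolyC1 -mpolyCN fl fcomb mpolyCN mpolyC1 scaleN1r addrC.
by move=> /(rsubspaceD c0 hx); rewrite addrA subrK.
Qed.

End Bases.

(** * Dimensions of the polynomial spaces *)

Lemma monoms_homog n j : exists2 L : seq 'X_{1..n.+1}, uniq L /\ size L = 'C(j + n, j) &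
  forall x, (x \in L) = (mdeg x == j).
Proof.
exists [seq s2m t | t : j.-tuple 'I_n.+1 <- enum (basis n.+1 j)].
  by split; [apply: uniq_basis | apply: size_basis].
by move=> x; rewrite -basis_cover.
Qed.

(* Monomials of degree at most [k] are dehomogenised monomials of degree [k]. *)
Lemma monoms_le n k : exists2 L : seq 'X_{1..n}, uniq L /\ size L = 'C(k + n, k) &
  forall x, (x \in L) = (mdeg x <= k)%N.
Proof.
have [L [uL sL] hL] := monoms_homog n k.
pose drop (x : 'X_{1..n.+1}) := [multinom x (lift ord0 i) | i < n].
have mdrop x : mdeg x = (x ord0 + mdeg (drop x))%N.
  by rewrite !mdegE big_ord_recl; congr (_ + _)%N; apply: eq_bigr => i _; rewrite mnmE.
exists [seq drop x | x <- L]; first split.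
- rewrite map_inj_in_uniq // => x y; rewrite !hL => /eqP hx /eqP hy e.
  apply/mnmP => i; case: (unliftP ord0 i) => [i' ->|->].
    by have := congr1 (fun z : 'X_{1..n} => z i') e; rewrite !mnmE.
  by apply: (@addIn (mdeg (drop x))); rewrite -mdrop e -mdrop hx hy.
- by rewrite size_map.
move=> x; apply/mapP/idP => [[y]|hx].
  by rewrite hL => /eqP <- ->; rewrite mdrop leq_addl.
pose y := [multinom (if unlift ord0 i is Some j then x j else (k - mdeg x)%N) | i < n.+1].
have ey : drop y = x by apply/mnmP => i; rewrite !mnmE liftK.
by exists y; rewrite ?ey // hL mdrop ey mnmE unlift_none subnK.
Qed.

Section Dimensions.
Variables (R : realType) (m : nat).

Lemma scale_regular (a : mpoly m R) (u : (mpoly m R)^o) : a *: u = a * u.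
Proof. by []. Qed.

Definition PV k (v : 'cV[{mpoly R[m]}]_m) : Prop := forall i, (msize (v i 0%R) <= k.+1)%N.

Definition hompol j (q : (mpoly m R)^o) : Prop := q \is j.-homog for mdeg.

Definition hompolV j (v : 'cV[{mpoly R[m]}]_m) : Prop := forall i, v i 0 \is j.-homog for mdeg.

Lemma rsubspace_PV k : rsubspace (PV k).
Proof.
split=> [i|c u v hu hv i]; first by rewrite mxE msize0.
by rewrite !mxE mul_mpolyC msizeD_leq // msizeZ_leq.
Qed.

Lemma rsubspace_hompol j : rsubspace (hompol j).
Proof.
split=> [|c u v hu hv]; first exact: dhomog0.
by rewrite /hompol scale_regular mul_mpolyC dhomogD // dhomogZ.
Qed.

Lemma rsubspace_hompolV j : rsubspace (hompolV j).
Proof.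
split=> [i|c u v hu hv i]; first by rewrite mxE dhomog0.
by rewrite !mxE mul_mpolyC dhomogD // dhomogZ.
Qed.

Lemma rsubspace_ND k : rsubspace (@ND R m k).
Proof.
split.
  exists 0, 0; split; rewrite ?mul0mx ?addr0 ?trmx0 ?oppr0 //.
    by move=> i; rewrite mxE msize0.
  by move=> i j; rewrite mxE dhomog0.
move=> c _ _ [u [K [hu hK hKh ->]]] [u' [K' [hu' hK' hKh' ->]]].
exists (c%:MP *: u + u'), (c%:MP *: K + K'); split.
- by move=> i; rewrite !mxE mul_mpolyC msizeD_leq // msizeZ_leq.
- by rewrite linearD linearZ /= hK hK' scalerN opprD.
- by move=> i j; rewrite !mxE mul_mpolyC dhomogD // dhomogZ.
- by rewrite mulmxDl -scalemxAl scalerDr addrACA.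
Qed.

Lemma rsubspace_PSker k : rsubspace (@PSker R m k).
Proof.
split.
  split; first by split=> [|i j]; rewrite ?trmx0 // mxE msize0.
  by apply/mulmx_coordp_eq0; rewrite mul0mx.
move=> c u v [[uT hu] hu0] [[vT hv] hv0]; split.
  split=> [|i j]; first by rewrite linearD linearZ /= uT vT.
  by rewrite !mxE mul_mpolyC msizeD_leq // msizeZ_leq.
move/mulmx_coordp_eq0: hu0 => hu0; move/mulmx_coordp_eq0: hv0 => hv0.
by apply/mulmx_coordp_eq0; rewrite mulmxDl -scalemxAl hu0 hv0 scaler0 addr0.
Qed.

Lemma fbasis_P k : exists (I : finType) (u : I -> (mpoly m R)^o),
  fbasis (P_ k) (fun q => q = 0) u /\ #|I| = 'C(k + m, k).
Proof.
have [L [uL sL] hL] := monoms_le m k.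
have := @fbasis_free R m L 'I_1 (mpoly m R)^o (fun=> 1) (P_ k) uL.
case=> [c|q|h1 h2 h3]; first last.
- exists ('I_(size L) * 'I_1)%type; eexists; split; first by split; [exact: h1 | exact: h2 | exact: h3].
  by rewrite card_prod !card_ord muln1.
- split=> [/msize_leqP hq|[c hc ->]].
    exists (fun=> q); last by rewrite big_ord1 scale_regular mulr1.
    by move=> a x; rewrite hL -ltnNge; apply: hq.
  rewrite /P_ big_ord1; apply/msize_leqP => x hx; rewrite scale_regular mulr1.
  by apply: hc; rewrite hL -ltnNge.
- rewrite big_ord1 scale_regular mulr1 => h a.
  by rewrite (ord1 a).
Qed.

Lemma fbasis_PV k : exists (I : finType) (u : I -> 'cV[mpoly m R]_m),
  fbasis (PV k) (fun q => q = 0) u /\ #|I| = ('C(k + m, k) * m)%N.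
Proof.
have [L [uL sL] hL] := monoms_le m k.
have sumE (c : 'I_m -> mpoly m R) i : (\sum_a c a *: delta_mx a 0 : 'cV_m) i 0 = c i.
  rewrite summxE (bigD1 i) //= big1 ?addr0 => [|j ji]; first by rewrite !mxE !eqxx mulr1.
  by rewrite !mxE eq_sym (negPf ji) mulr0.
exists ('I_(size L) * 'I_m)%type; eexists; split; last by rewrite card_prod !card_ord sL.
apply: (@fbasis_free R m L 'I_m _ (fun i => delta_mx i 0)) => // [c h a|q].
  by rewrite -sumE h mxE.
split=> [hq|[c hc -> i]].
  exists (fun i => q i 0) => [a x|]; last by apply/matrixP => i j; rewrite (ord1 j) sumE.
  by rewrite hL -ltnNge => h; apply: ((msize_leqP _ _).2 (hq a)).
by rewrite sumE; apply/msize_leqP => x hx; apply: hc; rewrite hL -ltnNge.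
Qed.

(** A position is sorted before it is compared, so each pair [i <= j] yields one symmetric unit
    matrix. *)
Definition sym_unit (x : {x : 'I_m * 'I_m | (x.1 <= x.2)%N}) : 'M[mpoly m R]_m :=
  \matrix_(a, b) ((minn a b == (val x).1) && (maxn a b == (val x).2))%:R.

Lemma card_sym_index : #|{: {x : 'I_m * 'I_m | (x.1 <= x.2)%N}}| = 'C(m.+1, 2).
Proof.
rewrite card_sig -sum1_card -(pair_big_dep xpredT (fun i j : 'I_m => (i <= j)%N) (fun _ _ => 1%N)) /=.
rewrite (exchange_big_dep xpredT) //= -bin2_sum big_mkord big_ord_recl add0n; apply: eq_bigr => j _.
rewrite (eq_bigl (fun i : 'I_m => (i < j.+1)%N)) //.
by rewrite (big_ord_narrow (ltn_ord j)) sum_nat_const card_ord muln1.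
Qed.

Lemma fbasis_PS k : exists (I : finType) (u : I -> 'M[mpoly m R]_m),
  fbasis (@PS R m k) (fun q => q = 0) u /\ #|I| = ('C(k + m, k) * 'C(m.+1, 2))%N.
Proof.
have [L [uL sL] hL] := monoms_le m k.
pose T := {x : 'I_m * 'I_m | (x.1 <= x.2)%N}.
have unitE (x y : T) a b : val x = (a, b) \/ val x = (b, a) -> sym_unit y a b = (y == x)%:R.
  rewrite mxE -val_eqE; case: x => -[x1 x2] /= hx; case: y => -[y1 y2] /= hy.
  rewrite xpair_eqE => -[[e1 e2]|[e1 e2]]; move: hx; rewrite e1 e2 => hx.
    by rewrite (minn_idPl hx) (maxn_idPr hx) -!val_eqE /= ![_ == nat_of_ord y1]eq_sym ![_ == nat_of_ord y2]eq_sym.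
  by rewrite (minn_idPr hx) (maxn_idPl hx) -!val_eqE /= ![_ == nat_of_ord y1]eq_sym ![_ == nat_of_ord y2]eq_sym.
have sumE (c : T -> mpoly m R) x a b : val x = (a, b) \/ val x = (b, a) ->
    (\sum_y c y *: sym_unit y) a b = c x.
  move=> hx; rewrite summxE (bigD1 x) //= big1 ?addr0 => [|y yx].
    by rewrite mxE (unitE x) // eqxx mulr1.
  by rewrite mxE (unitE x) // (negPf yx) mulr0.
have index a b : exists x : T, val x = (a, b) \/ val x = (b, a).
  have [h|h] := leqP a b; first by exists (exist _ (a, b) h); left.
  by exists (exist _ (b, a) (ltnW h)); right.
exists ('I_(size L) * T)%type; eexists; split; last by rewrite card_prod card_ord sL card_sym_index.
apply: (@fbasis_free R m L T _ sym_unit) => // [c h x|t].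
  have hx : val x = ((val x).1, (val x).2) by case: (val x).
  by rewrite -(sumE c x _ _ (or_introl hx)) h mxE.
split=> [[tT ht]|[c hc ->]].
  exists (fun x => t (val x).1 (val x).2) => [x n|].
    by rewrite hL -ltnNge => h; apply: ((msize_leqP _ _).2 (ht _ _)).
  apply/matrixP => a b; have [x hx] := index a b; rewrite (sumE _ x) //.
  by case: hx => -> //=; rewrite -{1}tT mxE.
split=> [|a b].
  apply/matrixP => a b; have [x hx] := index a b; rewrite mxE !(sumE _ x) //.
  by case: hx; [right | left].
have [x hx] := index a b; rewrite (sumE _ x) //.
by apply/msize_leqP => y hy; apply: hc; rewrite hL -ltnNge.
Qed.

End Dimensions.

Section HomogeneousDimensions.
Variables (R : realType) (n : nat).

Lemma fbasis_hompol j : exists (I : finType) (u : I -> (mpoly n.+1 R)^o),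
  fbasis (@hompol R n.+1 j) (fun q => q = 0) u /\ #|I| = 'C(j + n, j).
Proof.
have [L [uL sL] hL] := monoms_homog n j.
have := @fbasis_free R n.+1 L 'I_1 (mpoly n.+1 R)^o (fun=> 1) (@hompol R n.+1 j) uL.
case=> [c|q|h1 h2 h3]; first last.
- exists ('I_(size L) * 'I_1)%type; eexists; split; first by split; [exact: h1 | exact: h2 | exact: h3].
  by rewrite card_prod !card_ord muln1.
- split=> [hq|[c hc ->]].
    exists (fun=> q); last by rewrite big_ord1 scale_regular mulr1.
    by move=> a x; rewrite hL => hx; apply: (dhomog_nemf_coeff hq).
  rewrite /hompol big_ord1 scale_regular mulr1; apply/dhomogP => x; rewrite mcoeff_msupp /= => cx.
  by apply/eqP; rewrite -hL; apply: contraR cx => /hc ->.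
- rewrite big_ord1 scale_regular mulr1 => h a.
  by rewrite (ord1 a).
Qed.

Lemma fbasis_hompolV j : exists (I : finType) (u : I -> 'cV[mpoly n.+1 R]_n.+1),
  fbasis (@hompolV R n.+1 j) (fun q => q = 0) u /\ #|I| = ('C(j + n, j) * n.+1)%N.
Proof.
have [L [uL sL] hL] := monoms_homog n j.
have sumE (c : 'I_n.+1 -> mpoly n.+1 R) i : (\sum_a c a *: delta_mx a 0 : 'cV_n.+1) i 0 = c i.
  rewrite summxE (bigD1 i) //= big1 ?addr0 => [|l li]; first by rewrite !mxE !eqxx mulr1.
  by rewrite !mxE eq_sym (negPf li) mulr0.
exists ('I_(size L) * 'I_n.+1)%type; eexists; split; last by rewrite card_prod !card_ord sL.
apply: (@fbasis_free R n.+1 L 'I_n.+1 _ (fun i => delta_mx i 0)) => // [c h a|q].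
  by rewrite -sumE h mxE.
split=> [hq|[c hc -> i]].
  exists (fun i => q i 0) => [a x|]; last by apply/matrixP => i l; rewrite (ord1 l) sumE.
  by rewrite hL => hx; apply: (dhomog_nemf_coeff (hq a)).
rewrite sumE; apply/dhomogP => x; rewrite mcoeff_msupp /= => cx.
by apply/eqP; rewrite -hL; apply: contraR cx => /hc ->.
Qed.

Local Notation m := n.+1.

Lemma ND_PV k v : @ND R m k v -> PV k.+1 v.
Proof.
move=> [u [K [hu _ hK ->]]] i; rewrite mxE msizeD_leq //.
  by apply: leq_trans (hu i) _.
rewrite mxE; apply: msize_sum_leq => j _; rewrite mxE mulrC.
by apply: (@msizeM_leq _ _ _ _ 1); rewrite ?msizeX ?mdeg1 // dhomog_msize_leq.
Qed.

(** For positive [k] the affine fields of [ND 0] already lie in the full polynomial summand of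
    [ND k]. *)
Lemma ND0_ND k v : @ND R m 0 v -> ND k v.
Proof.
case: k => [|k] // /ND_PV hv; exists v, 0; split.
- by move=> i; apply: leq_trans (hv i) _.
- by rewrite trmx0 oppr0.
- by move=> i j; rewrite mxE dhomog0.
- by rewrite mul0mx addr0.
Qed.

Lemma grad_lin (c : R) (x y : (mpoly m R)^o) :
  grad (c%:MP *: x + y) = c%:MP *: grad x + grad y.
Proof. by rewrite scale_regular mul_mpolyC grad_linear. Qed.

Lemma fbasis_PV_ND k : exists (I : finType) (u : I -> 'cV[mpoly m R]_m),
  fbasis (PV k.+1) (ND k) u /\ #|I| = 'C(k.+2 + n, k.+2).
Proof.
have [I [u [hu cI]]] := fbasis_hompol k.+2.
exists I, (@grad R m \o u); split => //.
apply: (fbasis_map (S := @hompol R m k.+2) (S0 := fun q => q = 0)) => //.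
- exact: grad_lin.
- exact: rsubspace_hompol.
- exact: rsubspace_ND.
- by move=> q hq i; rewrite mxE; apply: msize_mderiv; apply: dhomog_msize_leq hq.
- move=> q ->; have -> : grad (0 : mpoly m R) = 0 by apply/matrixP => i j; rewrite !mxE mderiv0.
  exact: (rsubspace_ND R m k).1.
- by move=> q; apply: grad_ND_eq0.
- by move=> v /grad_ND_decomp [s hs h]; exists s.
Qed.

(** The gradients of homogeneous potentials complete [ND k] to all fields of degree [k + 1]; the
    additive form avoids truncated subtraction. *)
Lemma size_ND k b : is_basis (@ND R m k) b ->
  (size b + 'C(k.+2 + n, k.+2) = 'C(k.+1 + m, k.+1) * m)%N.
Proof.
move=> /fbasis_seq hb; have [I [u [hu cI]]] := fbasis_PV_ND k.
have [J [w [hw cJ]]] := fbasis_PV R m k.+1.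
have c0 := @rsubspace0 R m 'cV[mpoly m R]_m.
have h0 := rsubspace_eq0 (rsubspace_ND R m k).
have hcat := fbasis_cat (rsubspace_ND R m k) c0 h0 (@ND_PV k) hb hu.
by rewrite -cJ -(fbasis_card c0 hcat hw) card_sum card_ord cI.
Qed.

Lemma fbasis_PV_PV k : exists (I : finType) (u : I -> 'cV[mpoly m R]_m),
  fbasis (PV k.+1) (PV k) u /\ #|I| = ('C(k.+1 + n, k.+1) * m)%N.
Proof.
have [I [u [hu cI]]] := fbasis_hompolV k.+1; exists I, (id \o u); split=> //.
apply: (fbasis_map (S := @hompolV R m k.+1) (S0 := fun q => q = 0)) => //.
- exact: rsubspace_hompolV.
- exact: rsubspace_PV.
- by move=> q hq i; apply: dhomog_msize_leq.
- by move=> q -> i; rewrite mxE msize0.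
- move=> q hq h; apply/matrixP => i j; rewrite (ord1 j) mxE.
  exact: dhomog_eq0_msize (hq i) (h i).
- move=> v hv; exists (\col_i pihomog mdeg k.+1 (v i 0)) => i; rewrite !mxE ?pihomogP //.
  exact: pihomog_top.
Qed.

(** Climb from [ND 0] through [ND k] and the fields of degree [k + 1] to those of degree [k + 2],
    carry the quotient by [ND 0] over with [defm], and add the kernel of multiplication by [x]. *)
Lemma size_ND_PSker k be bf : basis_mod (@ND R m k) (@ND R m 0) be -> is_basis (@PSker R m k.+1) bf ->
  (size be + 'C(k.+2 + n, k.+2) + 'C(k.+2 + n, k.+2) * m + size bf =
   'C(k.+1 + m, k.+1) * 'C(m.+1, 2))%N.
Proof.
move=> /fbasis_seq he /fbasis_seq hf.
have [I [u [hu cI]]] := fbasis_PV_ND k; have [J [w [hw cJ]]] := fbasis_PV_PV k.+1.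
have [T [t [ht cT]]] := fbasis_PS R m k.+1.
have c0 := rsubspace_ND R m 0.
have h1 := fbasis_cat (rsubspace_ND R m k) c0 (@ND0_ND k) (@ND_PV k) he hu.
have h01 (q : 'cV[mpoly m R]_m) : ND 0 q -> PV k.+1 q by move=> h; apply/ND_PV/ND0_ND.
have h12 (q : 'cV[mpoly m R]_m) : PV k.+1 q -> PV k.+2 q.
  by move=> hq i; apply: leq_trans (hq i) _.
have h2 := fbasis_cat (rsubspace_PV R m k.+1) c0 h01 h12 h1 hw.
have h3 := fbasis_map (@defm_linear R m) (rsubspace_PV R m k.+2)
  (rsubspace_PSker R m k.+1) (@defm_PS R m k.+1) _ _ _ h2.
have {}h3 := h3 _ _ _.
have c00 := @rsubspace0 R m 'M[mpoly m R]_m.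
have hk := rsubspace_eq0 (rsubspace_PSker R m k.+1).
have hS q : PSker k.+1 q -> @PS R m k.+1 q by case.
have h4 := fbasis_cat (rsubspace_PSker R m k.+1) c00 hk hS hf (h3 _ _ _).
rewrite -cT -(fbasis_card c00 (h4 _ _ _) ht).
  by rewrite !card_sum !card_ord cI cJ; lia.
- by move=> q /defm_ND0; apply: (rsubspace_eq0 (rsubspace_PSker R m k.+1)).
- by move=> q _ [_ /mulmx_coordp_eq0 /defm_coordp_eq0].
- by move=> q /PS_defm_decomp [v hv hq]; exists v.
Qed.

End HomogeneousDimensions.

(** * Summing up the degrees of freedom *)

Lemma card_Delta d l : #|Delta d l| = 'C(d.+1, l.+1).
Proof. by rewrite card_sig -[d.+1 in RHS]card_ord -card_draws cardsE. Qed.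

(** Here [d = n + 2] and the degree is [k + 3]. Pascal's rule reduces every binomial in the degree
    to row [N]; what remains is linear in three of them, given that twice ['C(n.+3, 2)] is
    [n.+3 * n.+2]. *)
Lemma dof_count n k (sd sef : nat) :
  (sd + 'C(k.+3 + n, k.+3) = 'C(k.+2 + n.+1, k.+2) * n.+1)%N ->
  (sef + 'C(k.+2 + n.+1, k.+2) * n.+3 = 'C(k.+1 + n.+2, k.+1) * 'C(n.+3, 2))%N ->
  ('C(n.+3, 2) * 'C(k.+3 + n, k.+3) + n.+3 * 'C(k.+3 + n.+1, k.+3)
   + n.+3 * 'C(k.+2 + n.+1, k.+2) + n.+3 * sd + sef =
   'C(k.+3 + n.+2, k.+3) * 'C(n.+3, 2))%N.
Proof.
pose N := (k + n).+3.
have -> : (k.+3 + n.+2 = N.+2)%N by rewrite /N; lia.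
have -> : (k.+3 + n.+1 = N.+1)%N by rewrite /N; lia.
have -> : (k.+3 + n = N)%N by rewrite /N; lia.
have -> : (k.+2 + n.+1 = N)%N by rewrite /N; lia.
have -> : (k.+1 + n.+2 = N)%N by rewrite /N; lia.
have h : ('C(n.+3, 2) * 2 = n.+3 * n.+2)%N by rewrite -[2%N]/(2`!) bin_ffact ffactnS ffactn1.
rewrite [in 'C(N.+2, _)]binS !['C(N.+1, _)]binS.
move: h; set T := 'C(n.+3, 2); set a := 'C(N, k.+3); set b := 'C(N, k.+2); set c := 'C(N, k.+1).
move=> h h1 h2.
have h1' : (n.+3 * sd + n.+3 * a = n.+3 * b * n.+1)%N by rewrite -mulnDr h1; ring.
have h' : (b * T * 2 = n.+3 * b * n.+2)%N by rewrite -mulnA h; ring.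
have -> : (T * a + n.+3 * (a + b) + n.+3 * b + n.+3 * sd + sef =
  T * a + n.+3 * b + (n.+3 * sd + n.+3 * a) + (sef + b * n.+3))%N by ring.
rewrite h1' h2; have -> : (T * a + n.+3 * b + n.+3 * b * n.+1 + c * T =
  T * a + c * T + n.+3 * b * n.+2)%N by ring.
rewrite -h'; ring.
Qed.

Lemma size_P_basis (R : realType) m j b : is_basis (@P_ R m j) b -> size b = 'C(j + m, j).
Proof.
move=> /fbasis_seq h; have [I [u [hu <-]]] := fbasis_P R m j.
by rewrite -(fbasis_card (@rsubspace0 R m (mpoly m R)^o) h hu) card_ord.
Qed.

Lemma size_PS_basis (R : realType) m j b : is_basis (@PS R m j) b -> size b = ('C(j + m, j) * 'C(m.+1, 2))%N.
Proof.
move=> /fbasis_seq h; have [I [u [hu <-]]] := fbasis_PS R m j.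
by rewrite -(fbasis_card (@rsubspace0 R m 'M[mpoly m R]_m) h hu) card_ord.
Qed.

Lemma size_ND_basis (R : realType) m j b : (0 < m)%N -> is_basis (@ND R m j) b ->
  (size b + 'C(j.+2 + m.-1, j.+2) = 'C(j.+1 + m, j.+1) * m)%N.
Proof. by case: m b => // n b _; apply: size_ND. Qed.

Lemma size_ND_PSker_basis (R : realType) m j b b' : (0 < m)%N -> basis_mod (@ND R m j) (@ND R m 0) b ->
  is_basis (@PSker R m j.+1) b' ->
  (size b + size b' + 'C(j.+2 + m.-1, j.+2) * m.+1 = 'C(j.+1 + m, j.+1) * 'C(m.+1, 2))%N.
Proof. by case: m b b' => // n b b' _ h h'; have := size_ND_PSker h h'; rewrite /=; lia. Qed.

Section Count.
Variables (R : realType) (d k : nat).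
Hypotheses (hd : (2 <= d)%N) (hk : (3 <= k)%N).
Variables (bS : seq 'M[mpoly d R]_d) (hS : is_basis (@PS R d k) bS)
    (ba : Delta d (d - 2) -> seq (mpoly (d - 2) R)^o)
    (ha : forall e, is_basis (@P_ R (d - 2) k) (ba e))
    (bb : Delta d (d - 1) -> seq (mpoly (d - 1) R)^o)
    (hb : forall F, is_basis (@P_ R (d - 1) k) (bb F))
    (bc : Delta d (d - 1) -> seq (mpoly (d - 1) R)^o)
    (hc : forall F, is_basis (@P_ R (d - 1) (k - 1)) (bc F))
    (bd : Delta d (d - 1) -> seq 'cV[mpoly (d - 1) R]_(d - 1))
    (hbd : forall F, is_basis (@ND R (d - 1) (k - 2)) (bd F))
    (be : seq 'cV[mpoly d R]_d)
    (he : basis_mod (@ND R d (k - 3)) (@ND R d 0) be)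
    (bf : seq 'M[mpoly d R]_d)
    (hf : is_basis (@PSker R d (k - 2)) bf).

Lemma dof_number :
  (\sum_e size (ba e) + \sum_F size (bb F) + \sum_F size (bc F)
   + \sum_F size (bd F) + size be + size bf = size bS)%N.
Proof.
have [n dE] : exists n, d = n.+2 by exists (d - 2)%N; lia.
have [K kE] : exists K, k = K.+3 by exists (k - 3)%N; lia.
have d1 : (d - 1 = n.+1)%N by lia.
have d2 : (d - 2 = n)%N by lia.
have sumE l (F : Delta d l -> nat) X : (forall D, F D = X) ->
    (\sum_D F D = 'C(d.+1, l.+1) * X)%N.
  by move=> h; rewrite (eq_bigr (fun=> X)) // sum_nat_const card_Delta.
have c1 : 'C(d.+1, (d - 1).+1) = n.+3 by rewrite d1 dE binSn.
have c2 : 'C(d.+1, (d - 2).+1) = 'C(n.+3, 2) by rewrite d2 dE -bin_sub; [congr 'C(_, _); lia | lia].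
rewrite (@sumE _ _ 'C(K.+3 + n, K.+3)); last by move=> e; rewrite (size_P_basis (ha e)) d2 kE.
rewrite (@sumE _ (fun F => size (bb F)) 'C(K.+3 + n.+1, K.+3)); last first.
  by move=> F; rewrite (size_P_basis (hb F)) d1 kE.
rewrite (@sumE _ (fun F => size (bc F)) 'C(K.+2 + n.+1, K.+2)); last first.
  by move=> F; rewrite (size_P_basis (hc F)) d1 kE subn1.
have sd F : (size (bd F) + 'C(K.+3 + n, K.+3) = 'C(K.+2 + n.+1, K.+2) * n.+1)%N.
  have d0 : (0 < d - 1)%N by rewrite d1.
  have := size_ND_basis d0 (hbd F); move: (size (bd F)) => x.
  by rewrite d1 kE (_ : K.+3 - 2 = K.+1)%N //; lia.
(* The common number of moments (d) per face; the subtraction is exact by [sd]. *)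
pose X := ('C(K.+2 + n.+1, K.+2) * n.+1 - 'C(K.+3 + n, K.+3))%N.
have sdX F : size (bd F) = X by rewrite /X -(sd F) addnK.
(* Some face exists, so the relation [sd] holds for the common value [X]. *)
have [F0 _] := DeltaF_ex (ord0 : 'I_d.+1) (ltnW hd).
rewrite (@sumE _ (fun F => size (bd F)) X) // c1 c2.
have hbeK : basis_mod (@ND R d K) (@ND R d 0) be.
  by move: he; rewrite kE (_ : K.+3 - 3 = K)%N //; lia.
have hbfK : is_basis (@PSker R d K.+1) bf.
  by move: hf; rewrite kE (_ : K.+3 - 2 = K.+1)%N //; lia.
rewrite (size_PS_basis hS) kE -addnA; move: (size_ND_PSker_basis (ltnW hd) hbeK hbfK).
move: (size be + size bf)%N (sd F0); rewrite (sdX F0) => x hX; rewrite dE /= => hE.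
by rewrite (@dof_count n K).
Qed.

End Count.

(** * Unisolvence of the degrees of freedom *)

Theorem lemma2p7 (R : realType) (d k : nat) (hd : (2 <= d)%N) (hk : (3 <= k)%N)
    (p : 'I_d.+1 -> 'cV[R]_d) (hp : nondeg_simplex p)
    (ch : forall (l : nat) (D : Delta d l), chart R l d)
    (hch : forall (l : nat) (D : Delta d l), is_chart (vert p D) (ch l D))
    (bS : seq 'M[mpoly d R]_d) (hS : is_basis (@PS R d k) bS)
    (ba : Delta d (d - 2) -> seq (mpoly (d - 2) R)^o)
    (ha : forall e, is_basis (@P_ R (d - 2) k) (ba e))
    (bb : Delta d (d - 1) -> seq (mpoly (d - 1) R)^o)
    (hb : forall F, is_basis (@P_ R (d - 1) k) (bb F))
    (bc : Delta d (d - 1) -> seq (mpoly (d - 1) R)^o)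
    (hc : forall F, is_basis (@P_ R (d - 1) (k - 1)) (bc F))
    (bd : Delta d (d - 1) -> seq 'cV[mpoly (d - 1) R]_(d - 1))
    (hbd : forall F, is_basis (@ND R (d - 1) (k - 2)) (bd F))
    (be : seq 'cV[mpoly d R]_d)
    (he : basis_mod (@ND R d (k - 3)) (@ND R d 0) be)
    (bf : seq 'M[mpoly d R]_d)
    (hf : is_basis (@PSker R d (k - 2)) bf) :
  (\sum_e size (ba e) + \sum_F size (bb F) + \sum_F size (bc F)
   + \sum_F size (bd F) + size be + size bf = size bS)%N
  /\
  forall t : 'M[mpoly d R]_d, PS k t ->
    (forall e q, q \in ba e -> pair_face p e (ch _ e) (tr_e p e t) q = 0) ->
    (forall F q, q \in bb F ->
       pair_face p F (ch _ F) (tr_nn (face_normal p F) t) q = 0) ->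
    (forall F q, q \in bc F ->
       pair_face p F (ch _ F) (tr_2 (face_normal p F) t) q = 0) ->
    (forall F q, q \in bd F ->
       pair_face_vec p F (ch _ F) (tr_t (face_normal p F) t) q = 0) ->
    (forall q, q \in be -> pair_mx p t (defm q) = 0) ->
    (forall q, q \in bf -> pair_mx p t q = 0) ->
    t = 0.
Proof.
split; first exact: (dof_number hd hk hS ha hb hc hbd he hf).
move=> t ht h1 h2 h3 h4 h5 h6.
have [K kE] : exists K, k = K.+3 by exists (k - 3)%N; lia.
subst k; rewrite (_ : K.+3 - 3 = K)%N in he; last by lia.
have [g [hg hgs hge]] := dual_frame hp.
have frob0 : frob t 0 = 0 by rewrite -(scale0r 0) frobZr mul0r.
have [tT tk] := ht; have d0 : (0 < d)%N := ltnW hd.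
have tw n i : (msize ((t *m constp d n) i 0%R : mpoly d R) <= K.+4)%N.
  by rewrite mxE; apply: msize_sum_leq => j _; rewrite mxE mulrC mul_mpolyC msizeZ_leq.
have dotk j u (w : 'cV[mpoly d R]_d) : (forall i, (msize (w i 0%R) <= j)%N) ->
    (msize (dot (constp d u) w) <= j)%N.
  by move=> hw; rewrite dot_constpE; apply: msize_sum_leq => i _; apply: msizeZ_leq.
have nn F : vanish p (vset F) (tr_nn (face_normal p F) t).
  by apply: (pair_face_unisolvent hg (hch _ F) (hb F) _ (h2 F)); apply: dotk.
have tr2 F : vanish p (vset F) (tr_2 (face_normal p F) t).
  apply: (pair_face_unisolvent hg (hch _ F) (hc F) _ (h3 F)); rewrite subn1 /=.
  apply: msizeD_leq.
    by apply: dotk => i; rewrite mxE; apply: msize_sum_leq => j _; apply: msize_mderiv.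
  apply: msize_sum_leq => i _; rewrite mxE; apply: msize_sum_leq => j _.
  rewrite mxE mul_mpolyC msizeZ_leq // mxE msize_mderiv // mxE.
  by apply: msize_sum_leq => r _; rewrite mxE mul_mpolyC msizeZ_leq.
have tre e : vanish p (vset e) (tr_e p e t).
  apply: (pair_face_unisolvent hg (hch _ e) (ha e) _ (h1 e)).
  by apply: msize_sum_leq => F _; apply: dotk.
(* Faces are re-indexed by their opposite vertices, to match the gradients [g i]. *)
have [Fi hFi] := fin_all_exists (fun i => DeltaF_ex i d0).
have hex i : exists x, face_normal p (Fi i) = x *: g i /\
    dot (face_normal p (Fi i)) (face_normal p (Fi i)) = 1.
  by have [x _ hx] := face_normalP hg hgs hge d0 (hFi i); exists x.
have [a ha'] := fin_all_exists hex.
apply: (@dof_injective _ _ p g hg hgs hge t K (fun i => face_normal p (Fi i)) a (d - 1)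
   (fun i => ch _ (Fi i)) hd ht).
- by move=> i; case: (ha' i).
- by move=> i; case: (ha' i).
- by move=> i; case: (hch _ (Fi i)).
- by move=> i j ji; apply: (chart_on (hch _ (Fi i))); rewrite hFi !inE ji.
- move=> i j ij; have [e he'] := Deltae_ex hd ij.
  by rewrite -he'; apply: (tr_e_vanish hg hgs hge hd ij tT he' nn (tre e)).
- by move=> i; rewrite -hFi; apply: nn.
- by move=> i; rewrite -hFi; apply: tr2.
- move=> i q hq; rewrite -hFi.
  exact: (pair_face_vec_ND hg (hch _ (Fi i)) (hbd (Fi i)) (h4 (Fi i)) hq).
(* A basis modulo [ND 0] suffices because [defm] kills [ND 0]. *)
- apply: (lin_basis_mod he) => [u v|c v|q /defm_ND0 ->|q /h5 /(pair_mx_eq0 hg) //].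
  + by rewrite -[u]scale1r -mpolyC1 defm_linear mpolyC1 !scale1r frobDr raddfD.
  + rewrite -[c%:MP *: v]addr0 defm_linear frobDr frobZr raddfD /= mul_mpolyC linearZ /=.
    rewrite (_ : defm 0 = 0) ?frob0 ?raddf0 ?addr0 //.
    by apply/matrixP => i j; rewrite !mxE !mderiv0 addr0 scaler0.
  + by rewrite frob0 raddf0.
apply: (lin_basis_mod hf) => [u v|c v|q ->|q /h6 /(pair_mx_eq0 hg) //].
+ by rewrite frobDr raddfD.
+ by rewrite frobZr mul_mpolyC linearZ.
+ by rewrite frob0 raddf0.
Qed.
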